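(* Let $A\in\mathbb{R}^{n\times n}$ and $B\in\mathbb{R}^{n\times m}$ be such that $(A,B)$ is stabilizable and all eigenvalues of $A$ lie in the closed left half plane. Let $\bar\tau\ge 0$ satisfy \[ \bar{\tau}\,\omega_{\max}<\frac{\pi}{2}, \] where $\omega_{\max}=0$ if $A$ is Hurwitz and $\omega_{\max}=\max\{\omega\in\mathbb{R} : \det(j\omega I-A)=0\}$ otherwise. Then there exist $\rho>1$ and $\varepsilon^*>0$, depending only on $A$, $B$ and $\bar\tau$, such that the following holds for every $\varepsilon\in(0,\varepsilon^*]$. Let $P_\varepsilon$ be the unique positive definite solution of \[ A^{T}P_\varepsilon+P_\varepsilon A-P_\varepsilon BB^{T}P_\varepsilon+\varepsilon I=0 . \] Consider any integer $N\ge1$, any nonempty node set $\mathcal{C}\subseteq\{1,\dots,N\}$, and any weighted directed graph $\mathcal{G}\in\mathbb{G}_{\mathcal{C}}^N$ with adjacency weights $a_{ij}\ge0$ ($a_{ii}=0$). Consider any delays $\tau_1,\dots,\tau_N\in[0,\bar\tau]$. Let the multi-agent system be \[ \dot x_i(t)=Ax_i(t)+Bu_i(t-\tau_i),\qquad x_i(\delta)=\phi_i(\delta),\ \delta\in[-\bar\tau,0],\qquad i=1,\dots,N, \] with arbitrary continuous initial functions $\phi_i$. Let the exosystem be $\dot x_r(t)=Ax_r(t)$ with arbitrary initial condition. Let each agent $i$ use the protocol \[ \dot\chi_i(t)=A\chi_i(t)+Bu_i(t-\tau_i)+\bar\zeta_i(t)-\hat\zeta_i(t)-\iota_i\chi_i(t),\qquad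 u_i(t)=-\rho B^{T}P_\varepsilon\chi_i(t), \] with arbitrary initial conditions, where \[ \bar\zeta_i(t)=\sum_{j=1}^N a_{ij}(x_i(t)-x_j(t))+\iota_i(x_i(t)-x_r(t)),\qquad \hat\zeta_i(t)=\sum_{j=1}^N a_{ij}(\chi_i(t)-\chi_j(t)), \] and $\iota_i=1$ if $i\in\mathcal{C}$, $\iota_i=0$ otherwise. Then $\lim_{t\to\infty}(x_i(t)-x_r(t))=0$ for all $i=1,\dots,N$; that is, the scalable regulated state synchronization problem with additional information exchange is solved.
   Context: A weighted directed graph on nodes $\{1,\dots,N\}$ has adjacency matrix $[a_{ij}]$ with $a_{ij}>0$ iff there is an edge from $j$ to $i$, and $a_{ii}=0$. A directed tree is a subgraph in which every node has exactly one parent except one node, the root, which has none. For a node set $\mathcal{C}$, $\mathbb{G}_{\mathcal{C}}^N$ denotes the set of all such graphs with $N$ nodes containing $\mathcal{C}$ in which every node is a member of a directed tree whose root lies in $\mathcal{C}$. $j=\sqrt{-1}$. ''Hurwitz'' means all eigenvalues lie in the open left half plane. *)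

(* Defs.v *)
From HB Require Import structures.
From mathcomp Require Import all_boot all_order all_algebra.
From mathcomp Require Import all_classical all_reals all_analysis.
From mathcomp Require Import complex.
Set Implicit Arguments. Unset Strict Implicit. Unset Printing Implicit Defensive.
Import Order.TTheory GRing.Theory Num.Theory.
Import numFieldNormedType.Exports.
Local Open Scope classical_set_scope.
Local Open Scope ring_scope.

Definition cmx (R : realType) (n : nat) (A : 'M[R]_n) : 'M[R[i]]_n :=
  map_mx (fun x : R => (x%:C)%C) A.

Definition hurwitz (R : realType) (n : nat) (A : 'M[R]_n) : Prop :=
  forall l : R[i], eigenvalue (cmx A) l -> complex.Re l < 0.

Definition eig_closed_lhp (R : realType) (n : nat) (A : 'M[R]_n) : Prop :=
  forall l : R[i], eigenvalue (cmx A) l -> complex.Re l <= 0.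

Definition stabilizable (R : realType) (n m : nat)
  (A : 'M[R]_n) (B : 'M[R]_(n, m)) : Prop :=
  exists K : 'M[R]_(m, n), hurwitz (A + B *m K).

(* omega_max = 0 if A Hurwitz, max { w | det (j w I - A) = 0 } otherwise
   (the max of a finite nonempty set is its sup). *)
Definition omega_max (R : realType) (n : nat) (A : 'M[R]_n) : R :=
  if `[< hurwitz A >] then 0
  else sup [set w : R | \det ((Complex 0 w)%:M - cmx A) = 0].

Definition posdef (R : realType) (n : nat) (P : 'M[R]_n) : Prop :=
  P^T = P /\ forall v : 'cV[R]_n, v != 0 -> 0 < (v^T *m P *m v) 0 0.

(* A directed tree in the weighted graph with adjacency a (edge j -> i iff
   a i j > 0): node set T, root r in T, every non-root node k of T has exactly
   one parent par k in T (the edge par k -> k), and following parents from any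
   node of T reaches the root (so the subgraph is a tree). *)
Definition directed_tree (R : realType) (N : nat) (a : 'I_N -> 'I_N -> R)
  (T : {set 'I_N}) (r : 'I_N) (par : 'I_N -> 'I_N) : Prop :=
  r \in T /\
  (forall k, k \in T -> k != r -> par k \in T /\ 0 < a k (par k)) /\
  (forall k, k \in T -> exists p : nat, iter p par k = r).

Definition graph_in_GC (R : realType) (N : nat) (C : {set 'I_N})
  (a : 'I_N -> 'I_N -> R) : Prop :=
  (forall i j, 0 <= a i j) /\ (forall i, a i i = 0) /\
  forall i : 'I_N, exists (T : {set 'I_N}) (r : 'I_N) (par : 'I_N -> 'I_N),
    directed_tree a T r par /\ i \in T /\ r \in C.

(* Main.v *)
(* Put [e_i = x_i - xr - chi_i].  Then [e_i' = A e_i - sum_j Lbar_ij e_j] with [Lbar]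
   the pinned Laplacian, and [chi_i' = A chi_i - rho B B' P chi_i(t - tau_i) + g_i]
   where [g_i = sum_j Lbar_ij e_j].

   Consensus.  [Lbar] is a nonsingular M-matrix, hence diagonally stable, while the
   spectrum of [A] lies in the closed left half plane; a quadratic Lyapunov function
   gives [e_i -> 0] and [e_i] square integrable.

   Delayed loop.  Let [V = chi' P chi], [z = P chi] and [v = B' z].  The Riccati equation
   yields [V' = |v|^2 - eps |chi|^2 - 2 rho v . v(t - tau) + 2 z . g] and the adjoint
   dynamics [z' = - A' z + f], where [f] is small compared with [v] and [eps chi] because
   [P -> 0] as [eps -> 0].  Along [z' = - A' z + f] the signal [v] is, up to errors
   controlled by [f], a superposition of the frequencies of the imaginary eigenvalues of
   [A], all at most [omega_max]; modes with distinct frequencies are almost orthogonal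
   in time average, and the delay rotates each of them by less than [pi / 2].  So the
   integral of [v . v(t - tau)] dominates a fixed multiple [kappa] of that of [|v|^2];
   with [rho kappa > 1] the energy stays bounded and [chi] is square integrable.

   [P -> 0].  Otherwise a limit of the normalised solutions has an [A]-invariant row
   space, which contains an uncontrollable left eigenvector of [A] on the imaginary axis,
   against stabilizability. *)
Require Import Defs.
From HB Require Import structures.
From mathcomp Require Import all_boot all_order all_algebra.
From mathcomp Require Import all_classical all_reals all_analysis.
From mathcomp Require Import complex.
From mathcomp Require Import ring lra.
Set Implicit Arguments. Unset Strict Implicit. Unset Printing Implicit Defensive.
Import Order.TTheory GRing.Theory Num.Theory.
Import numFieldNormedType.Exports.
Local Open Scope classical_set_scope.
Local Open Scope ring_scope.

(** * Derivatives, primitives and comparison *)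

(** The gain must be fixed before the network, the delays and the trajectories, so every estimate
    separates two kinds of constants: factors chosen from [A], [B] and [taubar] alone, and one
    additive constant per trajectory. Time averages therefore appear as inequalities between
    primitives up to a constant, proved by comparing derivatives; no transform is taken, since the
    signals are not known to be square integrable beforehand. The price is a boundary term
    [|z(T)|^2]. It is harmless because [|P chi|^2 <= c chi' P chi] with [c] small, so the energy
    absorbs it. The same term pays for the modes of [- A'] with positive real part: they grow
    forwards, so their energy is bounded by their final value and the forcing. Jordan blocks on the
    imaginary axis are the obstacle to the picture of pure rotations; there each chain element is
    small in mean square relative to the preceding one, up to forcing and boundary terms, and counts
    as a perturbation of the head. The order of choices is [kappa] from the spectrum and the phase
    margin, [rho] from [kappa], then [c], then [eps_star]. *)

Section ScalarCalculus.
Context {R : realType}.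
Implicit Types (f g h : R -> R) (t : R).

(* A transparent alias of [is_derive] that instance resolution does not see, so
   that the shape of computed derivatives stays under control. *)
Definition has_deriv t f (d : R) : Prop := is_derive t (1 : R) f d.

Lemma drv_eq f t a b : has_deriv t f a -> a = b -> has_deriv t f b.
Proof. by move=> ? <-. Qed.

Lemma drv_cst t (c : R) : has_deriv t (fun=> c) 0.
Proof. exact: is_derive_cst. Qed.

Lemma drv_id t : has_deriv t (fun s => s) 1.
Proof. exact: is_derive_id. Qed.

Lemma drvD f g t a b : has_deriv t f a -> has_deriv t g b ->
  has_deriv t (fun s => f s + g s) (a + b).
Proof. by move=> ? ?; exact: is_deriveD. Qed.

Lemma drvN f t a : has_deriv t f a -> has_deriv t (fun s => - f s) (- a).
Proof. by move=> ?; exact: is_deriveN. Qed.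

Lemma drvM f g t a b : has_deriv t f a -> has_deriv t g b ->
  has_deriv t (fun s => f s * g s) (f t * b + a * g t).
Proof.
move=> fa gb; have := is_deriveM fa gb.
by rewrite /GRing.scale/= [g t * a]mulrC.
Qed.

Lemma drvZ (k : R) f t a : has_deriv t f a ->
  has_deriv t (fun s => k * f s) (k * a).
Proof. by move=> fa; apply: drv_eq (drvM (drv_cst t k) fa) _; ring. Qed.

Lemma drvX2 f t a : has_deriv t f a ->
  has_deriv t (fun s => f s ^+ 2) (2 * f t * a).
Proof. by move=> fa; apply: drv_eq (drvM fa fa) _; ring. Qed.

Lemma drv_comp f g t a b : has_deriv t g b -> has_deriv (g t) f a ->
  has_deriv t (fun s => f (g s)) (a * b).
Proof.
move=> gb fa.
have := @is_derive1_comp R f g t a b fa gb; exact.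
Qed.

Lemma drv_shift f t a c : has_deriv (t - c) f a ->
  has_deriv t (fun s => f (s - c)) a.
Proof.
move=> fa; have h : has_deriv t (fun s => s - c) 1.
  by apply: drv_eq (drvD (drv_id t) (drv_cst t (- c))) _; rewrite addr0.
by apply: drv_eq (drv_comp h fa) _; rewrite mulr1.
Qed.

Lemma drv_sum (I : Type) (r : seq I) (F : I -> R -> R) (D : I -> R) t :
  (forall i, has_deriv t (F i) (D i)) ->
  has_deriv t (fun s => \sum_(i <- r) F i s) (\sum_(i <- r) D i).
Proof.
move=> FD; elim: r => [|i r IH].
  rewrite big_nil; under eq_fun do rewrite big_nil; exact: drv_cst.
rewrite big_cons; under eq_fun do rewrite big_cons; exact: drvD.
Qed.

Lemma drv_continuous f t a : has_deriv t f a -> {for t, continuous f}.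
Proof.
by move=> [df _]; apply: differentiable_continuous; apply/derivable1_diffP.
Qed.

Lemma le_drv f g (f' g' : R -> R) (a b : R) : a <= b ->
  (forall t, a <= t <= b -> has_deriv t f (f' t)) ->
  (forall t, a <= t <= b -> has_deriv t g (g' t)) ->
  (forall t, a <= t <= b -> f' t <= g' t) ->
  f b - f a <= g b - g a.
Proof.
move=> ab df dg fg.
have d t : a <= t <= b -> has_deriv t (fun s => g s - f s) (g' t - f' t).
  by move=> tab; apply: drvD; [exact: dg | apply: drvN; exact: df].
suff : g a - f a <= g b - f b by lra.
apply: (@ger0_derive1_ndecr R (fun s => g s - f s) a b) => //.
- by move=> x /[!in_itv]/= /andP[/ltW ax /ltW xb]; case: (d x); rewrite ?ax.
- move=> x /[!in_itv]/= /andP[/ltW ax /ltW xb].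
  have := d x; rewrite ax xb => /(_ isT); rewrite /has_deriv => dx.
  by rewrite derive1E derive_val subr_ge0 fg// ax.
- apply/continuous_in_subspaceT => x /[!inE]/= /[!in_itv]/= xab.
  exact: drv_continuous (d _ xab).
Qed.

Lemma ndecr_drv f (f' : R -> R) (a b : R) : a <= b ->
  (forall t, a <= t <= b -> has_deriv t f (f' t)) ->
  (forall t, a <= t <= b -> 0 <= f' t) -> f a <= f b.
Proof.
move=> ab df f0.
have := @le_drv (fun=> 0) f (fun=> 0) f' a b ab (fun t _ => drv_cst t 0) df f0.
by lra.
Qed.

(* Only used at [t > 0]: [prim h t = 0] for [t <= 0]. *)
Definition prim h : R -> R :=
  fun t => (\int[@lebesgue_measure R]_(s in [set` `[0, t]]) h s)%R.

Lemma drv_prim h t : continuous h -> 0 < t -> has_deriv t (prim h) (h t).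
Proof.
move=> ch t0.
have [] := @continuous_FTC1_closed R h 0 t (t + 1) _ _ t0 (ch t).
- by rewrite ltrDl.
- apply: continuous_compact_integrable; first exact: segment_compact.
  by apply: continuous_subspaceT.
by move=> d <-; rewrite derive1E; apply: DeriveDef.
Qed.

End ScalarCalculus.

Section Continuity.
Context {R : realType}.
Implicit Types (f g : R -> R) (s t : R).

Lemma contD f g : continuous f -> continuous g -> continuous (fun s => f s + g s).
Proof. by move=> cf cg s; apply: cvgD; [exact: cf | exact: cg]. Qed.

Lemma contN f : continuous f -> continuous (fun s => - f s).
Proof. by move=> cf s; apply: cvgN; exact: cf. Qed.

Lemma contM f g : continuous f -> continuous g -> continuous (fun s => f s * g s).
Proof. by move=> cf cg s; apply: cvgM; [exact: cf | exact: cg]. Qed.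

Lemma contX2 f : continuous f -> continuous (fun s => f s ^+ 2).
Proof. by move=> cf; apply: contM. Qed.

Lemma cont_cst (c : R) : continuous (fun _ : R => c).
Proof. by move=> s; exact: cvg_cst. Qed.

Lemma cont_shift f c : continuous f -> continuous (fun s => f (s - c)).
Proof.
move=> cf s; apply: (@continuous_comp _ _ _ (fun s => s - c) f); last exact: cf.
by apply: cvgB; [exact: cvg_id | exact: cvg_cst].
Qed.

Lemma cont_sum (I : Type) (r : seq I) (F : I -> R -> R) :
  (forall i, continuous (F i)) -> continuous (fun s => \sum_(i <- r) F i s).
Proof.
move=> cF; elim: r => [|i r IH].
  under eq_fun do rewrite big_nil; exact: cont_cst.
under eq_fun do rewrite big_cons; exact: contD.
Qed.

End Continuity.

Ltac cont := repeat lazymatch goal with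
  | |- continuous (fun s => _ + _) => apply: contD
  | |- continuous (fun s => - _) => apply: contN
  | |- continuous (fun s => _ ^+ 2) => apply: contX2
  | |- continuous (fun s => _ * _) => apply: contM
  | |- continuous (fun s => _ (s - _)) => apply: cont_shift
  | |- _ => first [apply: cont_cst | assumption]
  end.

Ltac nng := repeat first [assumption | by [] | apply: sqr_ge0 | apply: addr_ge0
  | apply: mulr_ge0 | (apply: ltW; assumption) | rewrite invr_ge0].

Ltac drv := repeat first [eassumption | apply: drvD | apply: drvN
  | apply: drvX2 | apply: drvZ | apply: drvM | apply: drv_cst ].

Section BoundedComparison.
Context {R : realType}.
Implicit Types (F G H h : R -> R) (a s t T : R).

(* The constant [C] may depend on the trajectory at hand; the factors in front of
   primitives never do. *)
Definition bdle (a : R) F G := exists C, forall T, a <= T -> F T <= G T + C.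

Lemma bdle_drv a F G (F' G' : R -> R) :
  (forall t, a <= t -> has_deriv t F (F' t)) ->
  (forall t, a <= t -> has_deriv t G (G' t)) ->
  (forall t, a <= t -> F' t <= G' t) -> bdle a F G.
Proof.
move=> dF dG FG; exists (F a - G a) => T aT.
suff : F T - F a <= G T - G a by lra.
by apply: (le_drv aT) => t /andP[at_ _]; [exact: dF | exact: dG | exact: FG].
Qed.

Lemma bdle_trans a G F H : bdle a F G -> bdle a G H -> bdle a F H.
Proof.
move=> [C FG] [C' GH]; exists (C + C') => T aT.
by have := FG _ aT; have := GH _ aT; lra.
Qed.

Lemma bdle_le a F G : (forall T, a <= T -> F T <= G T) -> bdle a F G.
Proof. by move=> FG; exists 0 => T /FG; rewrite addr0. Qed.

Lemma bdleD a F G F' G' : bdle a F G -> bdle a F' G' ->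
  bdle a (fun T => F T + F' T) (fun T => G T + G' T).
Proof.
move=> [C FG] [C' FG']; exists (C + C') => T aT.
by have := FG _ aT; have := FG' _ aT; lra.
Qed.

Lemma bdle_sum a (I : Type) (r : seq I) (F G : I -> R -> R) :
  (forall i, bdle a (F i) (G i)) ->
  bdle a (fun T => \sum_(i <- r) F i T) (fun T => \sum_(i <- r) G i T).
Proof.
move=> FG; elim: r => [|i r IH].
  by apply: bdle_le => T _; rewrite !big_nil.
apply: bdle_trans (bdle_trans (bdleD (FG i) IH) _);
  by apply: bdle_le => T _; rewrite !big_cons.
Qed.

Lemma prim_ndecr h (s t : R) : continuous h -> (forall u, 0 <= h u) ->
  0 < s -> s <= t -> prim h s <= prim h t.
Proof.
move=> ch h0 s0 st; apply: (@ndecr_drv R _ h) => // u /andP[su _].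
exact: drv_prim (lt_le_trans s0 su).
Qed.

Lemma prim_ge0 h (t : R) : (forall u, 0 <= h u) -> 0 <= prim h t.
Proof. by move=> h0; apply: Rintegral_ge0 => u _; exact: h0. Qed.

Lemma bdle_prim a F (F' : R -> R) h : 0 < a -> continuous h ->
  (forall t, a <= t -> has_deriv t F (F' t)) ->
  (forall t, a <= t -> h t <= F' t) -> bdle a (prim h) F.
Proof.
move=> a0 ch dF hF; apply: (@bdle_drv _ _ _ h F') => // t at_.
exact: drv_prim (lt_le_trans a0 at_).
Qed.

End BoundedComparison.

Lemma young (R : realFieldType) (k x y : R) : 0 < k ->
  `|2 * (x * y)| <= k * x ^+ 2 + k^-1 * y ^+ 2.
Proof.
move=> k0; have kV : k * k^-1 = 1 by rewrite mulfV ?gt_eqF.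
have kV0 : 0 < k^-1 by rewrite invr_gt0.
(* Completing the square with [s = 1] and [s = -1] settles both signs of the absolute value. *)
have h s : s ^+ 2 = 1 -> k * x ^+ 2 + k^-1 * y ^+ 2 - s * (2 * (x * y)) =
    k * (x - s * k^-1 * y) ^+ 2.
  move=> s2.
  have -> : k * (x - s * k^-1 * y) ^+ 2 = k * x ^+ 2 - (k * k^-1) * (s * (2 * (x * y)))
    + (k * k^-1) * (k^-1 * y ^+ 2) * s ^+ 2 by ring.
  by rewrite kV s2; ring.
have sq0 z : 0 <= k * z ^+ 2 by rewrite mulr_ge0 ?sqr_ge0 ?ltW.
have := h 1 (expr1n _ 2); have := h (-1) (sqrr_sign _ 1).
rewrite ler_norml => h1 h2.
have := sq0 (x - 1 * k^-1 * y); rewrite -h2.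
have := sq0 (x - -1 * k^-1 * y); rewrite -h1.
by lra.
Qed.

(* [p j] and [q j] are the real and imaginary parts of [y_j], where
   [y_j' = (al + i om) y_j + y_(j+1) + (c j + i d j)] and [y_n = 0]. *)
Record jordan_chain (R : realType) (al om kap : R) (n : nat)
    (p q c d : nat -> R -> R) (phi psi : R -> R) : Prop := JordanChain {
  jc_contp : forall j, continuous (p j);
  jc_contq : forall j, continuous (q j);
  jc_contc : forall j, continuous (c j);
  jc_contd : forall j, continuous (d j);
  jc_contphi : continuous phi;
  jc_phi0 : forall t, 0 <= phi t;
  jc_psi0 : forall t, 0 <= psi t;
  jc_odep : forall j (t : R), 0 < t ->
    has_deriv t (p j) (al * p j t - om * q j t + p j.+1 t + c j t);
  jc_odeq : forall j (t : R), 0 < t ->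
    has_deriv t (q j) (om * p j t + al * q j t + q j.+1 t + d j t);
  jc_endp : forall t, p n t = 0;
  jc_endq : forall t, q n t = 0;
  jc_force : forall j t, c j t ^+ 2 + d j t ^+ 2 <= kap * phi t;
  jc_state : forall j t, p j t ^+ 2 + q j t ^+ 2 <= kap * psi t }.

Arguments jc_contp {R al om kap n p q c d phi psi} _ j _.
Arguments jc_contq {R al om kap n p q c d phi psi} _ j _.
Arguments jc_contc {R al om kap n p q c d phi psi} _ j _.
Arguments jc_contd {R al om kap n p q c d phi psi} _ j _.
Arguments jc_contphi {R al om kap n p q c d phi psi} _ _.

Section Chains.
Context {R : realType}.
Implicit Types (al om kap a : R) (p q c d : nat -> R -> R) (phi psi : R -> R).

(** A growing mode only carries energy that is still present at time [T] or was injected: [|y_j|^2]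
    increases at rate at least [al |y_j|^2] minus multiples of the forcing and of the next element.
    The next element is bounded beforehand, by induction from the end of the chain. *)
Lemma unstable_chain_bound al om kap n : 0 < al -> 0 <= kap ->
  exists2 K : R, 0 <= K & forall p q c d phi psi a,
    jordan_chain al om kap n p q c d phi psi -> 0 < a ->
    bdle a (prim (fun t => p 0%N t ^+ 2 + q 0%N t ^+ 2))
           (fun T => K * (prim phi T + psi T)).
Proof.
move=> al0 kap0.
suff : forall j, (j <= n)%N -> exists2 K : R, 0 <= K & forall p q c d phi psi a,
    jordan_chain al om kap n p q c d phi psi -> 0 < a ->
    bdle a (prim (fun t => p (n - j)%N t ^+ 2 + q (n - j)%N t ^+ 2))
           (fun T => K * (prim phi T + psi T)).
  by move=> /(_ n (leqnn n)); rewrite subnn.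
elim=> [_|j IH jn].
  exists 0 => // p q c d phi psi a ch a0.
  apply: (bdle_prim (F' := fun=> 0)) => //.
  - by have := jc_contp ch n; have := jc_contq ch n => ? ?; rewrite subn0; cont.
  - by move=> t _; under eq_fun do rewrite mul0r; exact: drv_cst.
  - by move=> t _; rewrite subn0 (jc_endp ch) (jc_endq ch) expr0n addr0.
have [K K0 HK] := IH (ltnW jn).
have E : (n - j = (n - j.+1).+1)%N by rewrite -subSn.
rewrite {IH}E in HK; move: (n - j.+1)%N HK => i HK.
have alV : 0 < al^-1 by rewrite invr_gt0.
exists (al^-1 * (2 * al^-1 * (K + kap) + kap)).
  by nng.
move=> p q c d phi psi a ch a0.
have cp := jc_contp ch i; have cq := jc_contq ch i.
have cp1 := jc_contp ch i.+1; have cq1 := jc_contq ch i.+1.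
have cphi := jc_contphi ch.
set h1 := fun t => p i.+1 t ^+ 2 + q i.+1 t ^+ 2.
have ch1 : continuous h1 by rewrite /h1; cont.
have HB : bdle a (prim (fun t => p i t ^+ 2 + q i t ^+ 2))
  (fun T => al^-1 * ((p i T ^+ 2 + q i T ^+ 2) + 2 * al^-1 * (prim h1 T + kap * prim phi T))).
  apply: (bdle_prim a0); first by cont.
    move=> t at_; have t0 := lt_le_trans a0 at_.
    have dp := jc_odep ch i t0; have dq := jc_odeq ch i t0.
    have d1 := drv_prim ch1 t0; have d2 := drv_prim cphi t0.
    drv.
  move=> t at_ /=.
  rewrite -(ler_pM2l al0) [al * (al^-1 * _)]mulrA mulfV ?gt_eqF// mul1r /h1.
  have := jc_force ch i t.
  (* Weight [al / 2] in each of the four cross terms uses up half of the growth [2 al |y_i|^2]. *)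
  have a2 : 0 < al / 2 by lra.
  have := young (p i t) (p i.+1 t) a2; have := young (p i t) (c i t) a2.
  have := young (q i t) (q i.+1 t) a2; have := young (q i t) (d i t) a2.
  rewrite !ler_norml invf_div => /andP[y1 _] /andP[y2 _] /andP[y3 _] /andP[y4 _] fb.
  have fb' : 0 <= al^-1 * (kap * phi t - (c i t ^+ 2 + d i t ^+ 2)).
    by rewrite mulr_ge0 ?subr_ge0// ltW.
  move: (al^-1) alV y1 y2 y3 y4 fb' => ia alV y1 y2 y3 y4 fb'.
  by lra.
apply: bdle_trans HB _.
have [C HC] := HK _ _ _ _ _ _ a ch a0.
exists (al^-1 * (2 * al^-1 * C)) => T aT.
have Phi0 := prim_ge0 T (jc_phi0 ch); have psi0 := jc_psi0 ch T.
have := HC _ aT; have := jc_state ch i T.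
rewrite -subr_ge0 => /(mulr_ge0 (ltW alV)) B1.
rewrite -subr_ge0 => /(mulr_ge0 (mulr_ge0 (ltW alV) (ltW alV))) B2.
have B3 := mulr_ge0 (mulr_ge0 (ltW alV) kap0) Phi0.
have B4 := mulr_ge0 (mulr_ge0 (mulr_ge0 (ltW alV) (ltW alV)) kap0) psi0.
by move: (al^-1) B1 B2 B3 B4 => ia; rewrite /h1; lra.
Qed.

End Chains.

(** * Jordan chains and delayed correlations *)

Section NeutralChains.
Context {R : realType}.
Implicit Types (om kap a t T tau : R) (p q r s : R -> R).

(** The derivative of [Re (conj y_k * y_(k+1))] is [|y_(k+1)|^2] plus the product of [y_k] with
    [y_(k+2)] and forcing terms, since the rotation cancels. So the energy of [y_(k+1)] is a small
    part of that of [y_k], once [y_(k+2)] has been made smaller still, by induction from the end of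
    the chain. *)
Lemma neutral_chain_bound om kap n : 0 <= kap -> forall theta : R, 0 < theta ->
  exists2 K : R, 0 <= K & forall (p q c d : nat -> R -> R) (phi psi : R -> R) a,
    jordan_chain 0 om kap n.+1 p q c d phi psi -> 0 < a ->
    bdle a (prim (fun t => p 1%N t ^+ 2 + q 1%N t ^+ 2))
           (fun T => theta * prim (fun t => p 0%N t ^+ 2 + q 0%N t ^+ 2) T
                     + K * (prim phi T + psi T)).
Proof.
move=> kap0.
suff : forall j, (j <= n)%N -> forall theta : R, 0 < theta ->
    exists2 K : R, 0 <= K & forall (p q c d : nat -> R -> R) (phi psi : R -> R) a,
    jordan_chain 0 om kap n.+1 p q c d phi psi -> 0 < a ->
    bdle a (prim (fun t => p (n - j).+1%N t ^+ 2 + q (n - j).+1%N t ^+ 2))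
           (fun T => theta * prim (fun t => p (n - j)%N t ^+ 2 + q (n - j)%N t ^+ 2) T
                     + K * (prim phi T + psi T)).
  by move=> /(_ n (leqnn n)); rewrite subnn.
elim=> [_|j IH jn] theta th0.
  exists 0 => // p q c d phi psi a ch a0; rewrite subn0.
  have cp := jc_contp ch n; have cq := jc_contq ch n.
  have cp1 := jc_contp ch n.+1; have cq1 := jc_contq ch n.+1.
  have cyn : continuous (fun t => p n t ^+ 2 + q n t ^+ 2) by cont.
  apply: (bdle_prim (F' := fun t => theta * (p n t ^+ 2 + q n t ^+ 2))) => //.
  - by cont.
  - move=> t at_; have t0 := lt_le_trans a0 at_.
    have d1 := drv_prim cyn t0.
    by under eq_fun do rewrite mul0r addr0; drv.
  - by move=> t _; rewrite (jc_endp ch) (jc_endq ch) expr0n addr0; nng.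
have E : (n - j = (n - j.+1).+1)%N by rewrite -subSn.
have {}IH := IH (ltnW jn); rewrite {}E in IH.
move: (n - j.+1)%N IH => k IH.
(* In [H1] the energy of [y_(k+2)] carries the factor [4 / theta]; with [theta / 8] here, half of
   the energy of [y_(k+1)] returns and is moved to the left. *)
have th8 : 0 < theta / 8 by lra.
have [K' K'0 HK'] := IH _ th8.
have thV : 0 < theta^-1 by rewrite invr_gt0.
exists (4 * kap + 2 * kap * (1 + 4 * theta^-1) + 8 * theta^-1 * K'); first by nng.
move=> p q c d phi psi a ch a0.
have cp := jc_contp ch k; have cq := jc_contq ch k.
have cp1 := jc_contp ch k.+1; have cq1 := jc_contq ch k.+1.
have cp2 := jc_contp ch k.+2; have cq2 := jc_contq ch k.+2.
have cphi := jc_contphi ch.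
set y0 := fun t => p k t ^+ 2 + q k t ^+ 2.
set y1 := fun t => p k.+1 t ^+ 2 + q k.+1 t ^+ 2.
set y2 := fun t => p k.+2 t ^+ 2 + q k.+2 t ^+ 2.
have c0 : continuous y0 by rewrite /y0; cont.
have c1 : continuous y1 by rewrite /y1; cont.
have c2 : continuous y2 by rewrite /y2; cont.
have [C1 H1] : bdle a (prim y1) (fun T => 2 * (p k T * p k.+1 T + q k T * q k.+1 T)
    + kap * (1 + 4 * theta^-1) * prim phi T + theta / 2 * prim y0 T
    + 4 * theta^-1 * prim y2 T).
  apply: (bdle_prim a0 c1).
    move=> t at_; have t0 := lt_le_trans a0 at_.
    have dp := jc_odep ch k t0; have dq := jc_odeq ch k t0.
    have dp1 := jc_odep ch k.+1 t0; have dq1 := jc_odeq ch k.+1 t0.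
    have d1 := drv_prim c0 t0; have d2 := drv_prim cphi t0; have d3 := drv_prim c2 t0.
    drv.
  move=> t at_ /=; rewrite /y0 /y1 /y2.
  have f0 := jc_force ch k t.
  have : 0 <= theta^-1 * (kap * phi t - (c k.+1 t ^+ 2 + d k.+1 t ^+ 2)).
    by rewrite mulr_ge0 ?subr_ge0 ?(jc_force ch)// ltW.
  have th4 : 0 < theta / 4 by lra.
  have := young (p k.+1 t) (c k t) ltr01; have := young (q k.+1 t) (d k t) ltr01.
  have := young (p k t) (p k.+2 t) th4; have := young (p k t) (c k.+1 t) th4.
  have := young (q k t) (q k.+2 t) th4; have := young (q k t) (d k.+1 t) th4.
  rewrite !ler_norml invf_div invr1 => /andP[z1 _] /andP[z2 _] /andP[z3 _]
    /andP[z4 _] /andP[z5 _] /andP[z6 _] z7.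
  move: (theta^-1) thV z1 z2 z3 z4 z7 => it thV z1 z2 z3 z4 z7.
  by lra.
have [C2 H2] := HK' _ _ _ _ _ _ a ch a0.
exists (2 * (C1 + 4 * theta^-1 * C2)) => T aT.
have Phi0 := prim_ge0 T (jc_phi0 ch); have psi0 := jc_psi0 ch T.
have := H1 T aT; have := H2 T aT; rewrite -/y2 -/y1 -/y0.
rewrite -subr_ge0 => /(mulr_ge0 (ltW thV)).
have -> : theta^-1 * (theta / 8 * prim y1 T + K' * (prim phi T + psi T) + C2 - prim y2 T)
  = theta^-1 * theta / 8 * prim y1 T +
    theta^-1 * (K' * (prim phi T + psi T) + C2 - prim y2 T) by ring.
rewrite mulVf ?gt_eqF// => B1 B2.
have s0 := jc_state ch k T; have s1 := jc_state ch k.+1 T.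
have := young (p k T) (p k.+1 T) ltr01; have := young (q k T) (q k.+1 T) ltr01.
rewrite !ler_norml invr1 => /andP[_ Y1] /andP[_ Y2].
have B3 := mulr_ge0 kap0 Phi0.
have B4 := mulr_ge0 kap0 psi0.
have B5 := mulr_ge0 (ltW thV) B4.
move: (theta^-1) thV B1 B2 B5 => it thV B1 B2 B5.
by lra.
Qed.

(** The complex equation [w' = i om w + (r + i s)] for [w = p + i q], the head of a neutral chain;
    [r + i s] gathers the next chain element and the forcing. *)
Definition rotating om p q r s := forall t : R, 0 < t ->
  has_deriv t p (- om * q t + r t) /\ has_deriv t q (om * p t + s t).

Lemma drv_flip f t u (b : R) : has_deriv (t - u) f b ->
  has_deriv u (fun v : R => f (t - v)) (- b).
Proof.
move=> fb; have h : has_deriv u (fun v => t - v) (-1).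
  by apply: drv_eq (drvD (drv_cst u t) (drvN (drv_id u))) _; rewrite add0r.
by apply: drv_eq (drv_comp h fb) _; rewrite mulrN1.
Qed.

(* The left-hand side is the defect of the rotation by [om * tau] as a model of
   the delay. *)
Lemma delay_defect om p q r s t tau :
  rotating om p q r s -> continuous r -> continuous s -> 0 <= tau -> tau < t ->
  (cos (om * tau) * p (t - tau) - sin (om * tau) * q (t - tau) - p t) ^+ 2 +
  (sin (om * tau) * p (t - tau) + cos (om * tau) * q (t - tau) - q t) ^+ 2 <=
  expR tau * (prim (fun t => r t ^+ 2 + s t ^+ 2) t
              - prim (fun t => r t ^+ 2 + s t ^+ 2) (t - tau)).
Proof.
move=> rot cr cs tau0 taut.
set h := fun t => r t ^+ 2 + s t ^+ 2.
have ch : continuous h by rewrite /h; cont.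
(* Real and imaginary part of [exp (i om u) w(t - u) - w(t)], the defect as a function of the lag
   [u]. It vanishes at [u = 0], and its derivative is the rotated perturbation alone. *)
pose Gp u := cos (om * u) * p (t - u) - sin (om * u) * q (t - u) - p t.
pose Gq u := sin (om * u) * p (t - u) + cos (om * u) * q (t - u) - q t.
rewrite -ler_pdivrMl ?expR_gt0// -expRN -/(Gp tau) -/(Gq tau).
have G0 : expR (- 0) * (Gp 0 ^+ 2 + Gq 0 ^+ 2) = 0.
  by rewrite /Gp /Gq mulr0 cos0 sin0 subr0 !mul0r !mul1r add0r subr0 !subrr expr0n addr0 mulr0.
have dG u : 0 <= u <= tau ->
    has_deriv u Gp (- cos (om * u) * r (t - u) + sin (om * u) * s (t - u)) /\
    has_deriv u Gq (- sin (om * u) * r (t - u) - cos (om * u) * s (t - u)).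
  move=> /andP[u0 utau]; have tu : 0 < t - u by lra.
  have [dp dq] := rot _ tu.
  have dpf := drv_flip dp; have dqf := drv_flip dq.
  have dom := drvZ om (drv_id u).
  have dc := drv_comp dom (is_derive_cos (om * u)).
  have ds := drv_comp dom (is_derive_sin (om * u)).
  split.
    by apply: drv_eq; [rewrite /Gp; drv | cbv beta; ring].
  by apply: drv_eq; [rewrite /Gq; drv | cbv beta; ring].
(* The weight [expR (- u)] cancels the [|G|^2] left over by
   [2 Re (conj G * G') <= |G|^2 + |G'|^2]. *)
have := @le_drv R (fun u => expR (- u) * (Gp u ^+ 2 + Gq u ^+ 2)) (fun u => - prim h (t - u))
  (fun u => expR (- u) * (2 * Gp u * (- cos (om * u) * r (t - u) + sin (om * u) * s (t - u))
     + 2 * Gq u * (- sin (om * u) * r (t - u) - cos (om * u) * s (t - u)))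
     + (- expR (- u)) * (Gp u ^+ 2 + Gq u ^+ 2))
  (fun u => h (t - u)) 0 tau tau0.
rewrite G0 !subr0 => H.
suff : expR (- tau) * (Gp tau ^+ 2 + Gq tau ^+ 2) <= - prim h (t - tau) - - prim h t by lra.
apply: H => u utau; have [dp dq] := dG u utau; have /andP[u0 ut] := utau.
- have de : has_deriv u (fun u => expR (- u)) (- expR (- u)).
    by apply: drv_eq (drv_comp (drvN (drv_id u)) (is_derive_expR (- u))) _; rewrite mulrN1.
  by drv.
- have tu : 0 < t - u by lra.
  by apply: drv_eq (drvN (drv_flip (drv_prim ch tu))) _; rewrite opprK.
- have e1 : expR (- u) <= 1 by rewrite -expR0 ler_expR; lra.
  have e0 := expR_gt0 (- u).
  set A := - cos (om * u) * r (t - u) + sin (om * u) * s (t - u).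
  set B := - sin (om * u) * r (t - u) - cos (om * u) * s (t - u).
  have AB : A ^+ 2 + B ^+ 2 = h (t - u).
    rewrite /A /B /h -[RHS]mul1r -(cos2Dsin2 (om * u)); ring.
  have h0 : 0 <= h (t - u) by rewrite /h; nng.
  have E : 2 * Gp u * A + 2 * Gq u * B - (Gp u ^+ 2 + Gq u ^+ 2) <= h (t - u).
    by have := sqr_ge0 (Gp u - A); have := sqr_ge0 (Gq u - B); rewrite -AB; lra.
  apply: (@le_trans _ _ (expR (- u) * h (t - u))).
    have := mulr_ge0 (ltW e0) (_ : 0 <= h (t - u) - (2 * Gp u * A + 2 * Gq u * B - (Gp u ^+ 2 + Gq u ^+ 2))).
    by rewrite subr_ge0 => /(_ E); lra.
  by rewrite ler_piMl.
Qed.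

End NeutralChains.

Section DelayedCorrelation.
Context {R : realType}.
Implicit Types (om kap a t T tau : R) (p q r s : R -> R).

(* [H] is the integral of [(u - t + tau) * h u] over [t - tau, t], written with
   primitives only. *)
Lemma prim_window_bound (h g : R -> R) (a tau : R) :
  continuous h -> (forall t, 0 <= h t) -> continuous g -> 0 <= tau -> tau < a ->
  (forall t, a <= t -> g t <= expR tau * (prim h t - prim h (t - tau))) ->
  bdle a (prim g) (fun T => expR tau * tau * prim h T).
Proof.
move=> ch h0 cg tau0 taua gh.
have a0 : 0 < a by lra.
pose h1 u : R := u * h u.
have ch1 : continuous h1 by apply: contM => // u; exact: cvg_id.
pose H t : R := prim h1 t - prim h1 (t - tau) - (t - tau) * (prim h t - prim h (t - tau)).
have H0 t : a <= t -> 0 <= H t.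
  move=> at_.
  have := @ndecr_drv R (fun u => prim h1 u - (t - tau) * prim h u)
    (fun u => u * h u - (t - tau) * h u) (t - tau) t.
  have E1 : t - tau <= t by lra.
  move=> /(_ E1) N; suff : prim h1 (t - tau) - (t - tau) * prim h (t - tau) <=
    prim h1 t - (t - tau) * prim h t by rewrite /H; lra.
  apply: N => u /andP[u1 u2].
    have u0 : 0 < u by lra.
    by have d1 := drv_prim ch1 u0; have d2 := drv_prim ch u0; drv.
  by rewrite -mulrBl mulr_ge0// subr_ge0.
(* In place of an exchange of integrals: [H] has derivative [tau * h t] minus the window integral,
   so this function is a primitive of the assumed bound on [g]. *)
apply: (@bdle_trans _ _ (fun T => expR tau * (tau * prim h T - H T))); last first.
  apply: bdle_le => T aT; rewrite -mulrA ler_wpM2l ?expR_ge0//.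
  by have := H0 T aT; lra.
apply: (bdle_prim (F' := fun t => expR tau * (prim h t - prim h (t - tau))) a0 cg);
  last exact: gh.
move=> t at_.
have t0 : 0 < t by lra.
have ttau : 0 < t - tau by lra.
have d1 := drv_prim ch t0; have d2 := drv_prim ch1 t0.
have d3 := drv_shift (drv_prim ch ttau); have d4 := drv_shift (drv_prim ch1 ttau).
have d5 := drvD (drv_id t) (drv_cst t (- tau)).
apply: drv_eq; first by rewrite /H; drv.
by rewrite /h1; ring.
Qed.

(** The product of one signal with the conjugate of the other rotates at the nonzero speed
    [om' - om], so up to perturbations it is the derivative of itself divided by [i (om' - om)]; its
    integral is a boundary term plus errors. The unit vector [(x, y)] is a free phase, later the
    rotation caused by the delay, and [K] must not depend on it. *)
Lemma cross_frequency_bound om om' theta : om != om' -> 0 < theta ->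
  exists2 K : R, 0 <= K & forall p q r s p' q' r' s' (a x y : R),
    rotating om p q r s -> rotating om' p' q' r' s' -> 0 < a ->
    continuous p -> continuous q -> continuous r -> continuous s ->
    continuous p' -> continuous q' -> continuous r' -> continuous s' ->
    x ^+ 2 + y ^+ 2 = 1 ->
    bdle a (prim (fun t => - (x * (p t * p' t + q t * q' t) + y * (p t * q' t - q t * p' t))))
      (fun T => theta * (prim (fun t => p t ^+ 2 + q t ^+ 2) T
                         + prim (fun t => p' t ^+ 2 + q' t ^+ 2) T)
       + K * (prim (fun t => r t ^+ 2 + s t ^+ 2) T + prim (fun t => r' t ^+ 2 + s' t ^+ 2) T)
       + K * ((p T ^+ 2 + q T ^+ 2) + (p' T ^+ 2 + q' T ^+ 2))).
Proof.
move=> om12 th0.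
pose iD := (om' - om)^-1.
have iDE : (om' - om) * iD = 1 by rewrite mulfV// subr_eq0 eq_sym.
have thV : 0 < theta^-1 by rewrite invr_gt0.
exists (theta^-1 * iD ^+ 2 + iD ^+ 2 + 1); first by nng.
move=> p q r s p' q' r' s' a x y rot rot' a0 cp cq cr cs cp' cq' cr' cs' xy.
set Y := fun t => p t ^+ 2 + q t ^+ 2; set Y' := fun t => p' t ^+ 2 + q' t ^+ 2.
set Q := fun t => r t ^+ 2 + s t ^+ 2; set Q' := fun t => r' t ^+ 2 + s' t ^+ 2.
have cY : continuous Y by rewrite /Y; cont.
have cY' : continuous Y' by rewrite /Y'; cont.
have cQ : continuous Q by rewrite /Q; cont.
have cQ' : continuous Q' by rewrite /Q'; cont.
apply: (@bdle_trans _ _ (fun T => theta * (prim Y T + prim Y' T)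
    + theta^-1 * iD ^+ 2 * (prim Q T + prim Q' T)
    + iD * (p T * (y * p' T - x * q' T) + q T * (y * q' T + x * p' T)))); last first.
  apply: bdle_le => T aT.
  have := young (p T) (iD * (y * p' T - x * q' T)) ltr01.
  have := young (q T) (iD * (y * q' T + x * p' T)) ltr01.
  rewrite !ler_norml invr1 => /andP[_ Y1] /andP[_ Y2].
  have P1 : 0 <= prim Q T by apply: prim_ge0 => u; rewrite /Q; nng.
  have P2 : 0 <= prim Q' T by apply: prim_ge0 => u; rewrite /Q'; nng.
  have E : (iD * (y * p' T - x * q' T)) ^+ 2 + (iD * (y * q' T + x * p' T)) ^+ 2
    = iD ^+ 2 * Y' T by rewrite /Y' -[RHS]mul1r -xy; ring.
  have YY : 0 <= Y T by rewrite /Y; nng.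
  have YY' : 0 <= Y' T by rewrite /Y'; nng.
  have iD2 := sqr_ge0 iD.
  have B1 := mulr_ge0 iD2 P1; have B2 := mulr_ge0 iD2 P2.
  have B3 := mulr_ge0 iD2 YY; have B4 := mulr_ge0 iD2 YY'.
  have B5 := mulr_ge0 (ltW thV) B3; have B6 := mulr_ge0 (ltW thV) B4.
  rewrite -/(Y T) -/(Y' T).
  have {}Y1 : iD * (p T * (y * p' T - x * q' T) + q T * (y * q' T + x * p' T))
    <= Y T + iD ^+ 2 * Y' T by rewrite /Y -E in YY YY' *; lra.
  by move: (theta^-1) (iD ^+ 2) thV iD2 B1 B2 B3 B4 B5 B6 Y1 => it i2 *; lra.
apply: bdle_prim => //; first by cont.
  move=> t at_; have t0 := lt_le_trans a0 at_.
  have [dp dq] := rot t t0; have [dp' dq'] := rot' t t0.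
  have d1 := drv_prim cY t0; have d2 := drv_prim cY' t0.
  have d3 := drv_prim cQ t0; have d4 := drv_prim cQ' t0.
  by drv.
move=> t at_ /=.
have := young (y * p' t - x * q' t) (iD * r t) th0.
have := young (y * q' t + x * p' t) (iD * s t) th0.
have := young (y * p t + x * q t) (iD * r' t) th0.
have := young (y * q t - x * p t) (iD * s' t) th0.
rewrite !ler_norml => /andP[Y1 _] /andP[Y2 _] /andP[Y3 _] /andP[Y4 _].
have E1 : (y * p t + x * q t) ^+ 2 + (y * q t - x * p t) ^+ 2 = Y t.
  by rewrite /Y -[RHS]mul1r -xy; ring.
have E2 : (y * p' t - x * q' t) ^+ 2 + (y * q' t + x * p' t) ^+ 2 = Y' t.
  by rewrite /Y' -[RHS]mul1r -xy; ring.
have YY : 0 <= Y t by rewrite /Y; nng.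
have YY' : 0 <= Y' t by rewrite /Y'; nng.
have B1 := mulr_ge0 (ltW th0) YY; have B2 := mulr_ge0 (ltW th0) YY'.
have B3 : 0 <= theta^-1 * iD ^+ 2 * (Q t + Q' t) by rewrite /Q /Q'; nng.
set Z := x * (p t * p' t + q t * q' t) + y * (p t * q' t - q t * p' t).
have EZ : iD * (p t * (y * (- om' * q' t + r' t) - x * (om' * p' t + s' t)) +
   (- om * q t + r t) * (y * p' t - x * q' t) +
   (q t * (y * (om' * p' t + s' t) + x * (- om' * q' t + r' t)) +
    (om * p t + s t) * (y * q' t + x * p' t))) = - ((om' - om) * iD) * Z +
   (y * p' t - x * q' t) * (iD * r t) + (y * q' t + x * p' t) * (iD * s t)
   + (y * p t + x * q t) * (iD * r' t) + (y * q t - x * p t) * (iD * s' t).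
  by rewrite /Z; ring.
rewrite EZ iDE.
have S : theta * Y t + theta * Y' t + theta^-1 * iD ^+ 2 * (Q t + Q' t) >=
  - 2 * ((y * p' t - x * q' t) * (iD * r t) + (y * q' t + x * p' t) * (iD * s t)
   + (y * p t + x * q t) * (iD * r' t) + (y * q t - x * p t) * (iD * s' t)).
  by rewrite -E1 -E2 /Q /Q'; lra.
by lra.
Qed.

End DelayedCorrelation.

Section ChainPairs.
Context {R : realType}.
Implicit Types (al om kap a t T tau taubar theta : R) (p q r s : R -> R).

Lemma bdle_prim_sum a (g : R -> R) (I : Type) (l : seq I) (k : I -> R) (h : I -> R -> R) :
  0 < a -> continuous g -> (forall i, continuous (h i)) ->
  (forall t, a <= t -> g t <= \sum_(i <- l) k i * h i t) ->
  bdle a (prim g) (fun T => \sum_(i <- l) k i * prim (h i) T).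
Proof.
move=> a0 cg ch gh; apply: (bdle_prim (F' := fun t => \sum_(i <- l) k i * h i t)) => // t at_.
apply: drv_sum => i; apply: drvZ; apply: drv_prim => //; exact: lt_le_trans at_.
Qed.

Lemma bdle_prim2 a (g h1 h2 : R -> R) k1 k2 :
  0 < a -> continuous g -> continuous h1 -> continuous h2 ->
  (forall t, a <= t -> g t <= k1 * h1 t + k2 * h2 t) ->
  bdle a (prim g) (fun T => k1 * prim h1 T + k2 * prim h2 T).
Proof.
move=> a0 cg c1 c2 gh; apply: (bdle_prim (F' := fun t => k1 * h1 t + k2 * h2 t)) => // t at_.
have t0 := lt_le_trans a0 at_; have d1 := drv_prim c1 t0; have d2 := drv_prim c2 t0; drv.
Qed.

Lemma bdle_prim3 a (g h1 h2 h3 : R -> R) k1 k2 k3 :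
  0 < a -> continuous g -> continuous h1 -> continuous h2 -> continuous h3 ->
  (forall t, a <= t -> g t <= k1 * h1 t + k2 * h2 t + k3 * h3 t) ->
  bdle a (prim g) (fun T => k1 * prim h1 T + k2 * prim h2 T + k3 * prim h3 T).
Proof.
move=> a0 cg c1 c2 c3 gh.
apply: (bdle_prim (F' := fun t => k1 * h1 t + k2 * h2 t + k3 * h3 t)) => // t at_.
have t0 := lt_le_trans a0 at_.
have d1 := drv_prim c1 t0; have d2 := drv_prim c2 t0; have d3 := drv_prim c3 t0; drv.
Qed.

(** A crude bound for pairs in which one mode is unstable: [k] puts the large weight on that mode,
    whose energy is already controlled. The delay costs nothing because primitives of squares are
    nondecreasing. *)
Lemma correlation_young k p q p' q' a tau : 0 < k -> 0 <= tau -> tau < a ->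
  continuous p -> continuous q -> continuous p' -> continuous q' ->
  bdle a (prim (fun t => - (p t * p' (t - tau) + q t * q' (t - tau))))
    (fun T => k * prim (fun t => p t ^+ 2 + q t ^+ 2) T
              + k^-1 * prim (fun t => p' t ^+ 2 + q' t ^+ 2) T).
Proof.
move=> k0 tau0 taua cp cq cp' cq'; have a0 : 0 < a by lra.
have kV : 0 < k^-1 by rewrite invr_gt0.
set Y := fun t => p t ^+ 2 + q t ^+ 2; set Y' := fun t => p' t ^+ 2 + q' t ^+ 2.
have cY : continuous Y by rewrite /Y; cont.
have cY' : continuous Y' by rewrite /Y'; cont.
have Y0 t : 0 <= Y t by rewrite /Y; nng.
have Y'0 t : 0 <= Y' t by rewrite /Y'; nng.
apply: (@bdle_trans _ _ (fun T => k * prim Y T + k^-1 * prim Y' (T - tau))); last first.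
  apply: bdle_le => T aT; rewrite lerD2l; apply: ler_wpM2l; first exact: ltW.
  by apply: prim_ndecr => //; lra.
apply: (bdle_prim (F' := fun t => k * Y t + k^-1 * Y' (t - tau))) => //.
- by cont.
- move=> t at_; have t0 : 0 < t by lra.
  have ttau : 0 < t - tau by lra.
  by have d1 := drv_prim cY t0; have d2 := drv_shift (drv_prim cY' ttau); drv.
- move=> t at_.
  have := young (p t) (p' (t - tau)) k0; have := young (q t) (q' (t - tau)) k0.
  rewrite !ler_norml => /andP[Z1 _] /andP[Z2 _].
  have := mulr_ge0 (ltW k0) (Y0 t); have := mulr_ge0 (ltW kV) (Y'0 (t - tau)).
  by rewrite /Y /Y'; lra.
Qed.

(** The delayed signal is the current one plus its defect, both turned by [- om' * tau]. The defect
    has energy at most a multiple of that of the perturbation, uniformly in [tau <= taubar], so what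
    remains is a correlation without delay, with a phase. *)
Lemma delay_replace om' taubar theta : 0 <= taubar -> 0 < theta ->
  exists2 K : R, 0 <= K & forall p q p' q' r' s' a tau,
    rotating om' p' q' r' s' -> 0 <= tau <= taubar -> taubar < a ->
    continuous p -> continuous q -> continuous p' -> continuous q' ->
    continuous r' -> continuous s' ->
    bdle a (prim (fun t => - (p t * p' (t - tau) + q t * q' (t - tau))))
      (fun T => prim (fun t => - (cos (om' * tau) * (p t * p' t + q t * q' t)
                                  + sin (om' * tau) * (p t * q' t - q t * p' t))) T
         + theta * prim (fun t => p t ^+ 2 + q t ^+ 2) T
         + K * prim (fun t => r' t ^+ 2 + s' t ^+ 2) T).
Proof.
move=> tb0 th0; have thV : 0 < theta^-1 by rewrite invr_gt0.
exists (theta^-1 * (expR taubar * taubar)); first by nng; exact: expR_ge0.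
move=> p q p' q' r' s' a tau rot /andP[tau0 taub] tba cp cq cp' cq' cr cs.
set co := cos (om' * tau); set si := sin (om' * tau).
have cs1 : co ^+ 2 + si ^+ 2 = 1 by exact: cos2Dsin2.
set Gp := fun t => co * p' (t - tau) - si * q' (t - tau) - p' t.
set Gq := fun t => si * p' (t - tau) + co * q' (t - tau) - q' t.
set G2 := fun t => Gp t ^+ 2 + Gq t ^+ 2.
set Q := fun t => r' t ^+ 2 + s' t ^+ 2.
have cG : continuous G2 by rewrite /G2 /Gp /Gq; cont.
have cQ : continuous Q by rewrite /Q; cont.
have Q0 t : 0 <= Q t by rewrite /Q; nng.
have a0 : 0 < a by lra.
have ta : tau < a by lra.
have [C1 H1] : bdle a (prim G2) (fun T => expR tau * tau * prim Q T).
  apply: prim_window_bound => // t at_.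
  by apply: (delay_defect rot) => //; lra.
set X := fun t => - (co * (p t * p' t + q t * q' t) + si * (p t * q' t - q t * p' t)).
set Y := fun t => p t ^+ 2 + q t ^+ 2.
have cX : continuous X by rewrite /X; cont.
have cY : continuous Y by rewrite /Y; cont.
have [C2 H2] : bdle a (prim (fun t => - (p t * p' (t - tau) + q t * q' (t - tau))))
    (fun T => 1 * prim X T + theta * prim Y T + theta^-1 * prim G2 T).
  apply: (bdle_prim3 a0 _ cX cY cG); first by cont.
  move=> t at_.
  have := young (p t) (co * Gp t + si * Gq t) th0.
  have := young (q t) (- si * Gp t + co * Gq t) th0.
  rewrite !ler_norml => /andP[Z1 _] /andP[Z2 _].
  have G20 : 0 <= theta^-1 * G2 t by rewrite /G2; nng.
  have Y0 : 0 <= theta * Y t by rewrite /Y; nng.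
  have E : (co * Gp t + si * Gq t) ^+ 2 + (- si * Gp t + co * Gq t) ^+ 2 = G2 t.
    by rewrite /G2 -[RHS]mul1r -cs1; ring.
  have E1 : p' (t - tau) = co * (p' t + Gp t) + si * (q' t + Gq t).
    by rewrite /Gp /Gq -[LHS]mul1r -cs1; ring.
  have E2 : q' (t - tau) = - si * (p' t + Gp t) + co * (q' t + Gq t).
    by rewrite /Gp /Gq -[LHS]mul1r -cs1; ring.
  have {}Z1 : - (theta * Y t + theta^-1 * G2 t) <=
    2 * (p t * (co * Gp t + si * Gq t)) + 2 * (q t * (- si * Gp t + co * Gq t)).
    by rewrite -E /Y; lra.
  rewrite E1 E2 /X; move: Z1 G20 Y0; move: (G2 t) (Y t) (Gp t) (Gq t) => *; lra.
exists (C2 + theta^-1 * C1) => T aT.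
have := H2 T aT; have := H1 T aT; rewrite -subr_ge0 => /(mulr_ge0 (ltW thV)) B1 B2.
have e1 : expR tau <= expR taubar by rewrite ler_expR.
have e2 : expR tau * tau * prim Q T <= expR taubar * taubar * prim Q T.
  by rewrite ler_wpM2r ?prim_ge0// ler_pM// expR_ge0.
move: e2; rewrite -subr_ge0 => /(mulr_ge0 (ltW thV)) e2.
by move: (theta^-1) thV B1 B2 e2 => it; lra.
Qed.

Lemma chain_rotating om kap n (p q c d : nat -> R -> R) (phi psi : R -> R) :
  jordan_chain 0 om kap n p q c d phi psi ->
  rotating om (p 0%N) (q 0%N) (fun t => p 1%N t + c 0%N t) (fun t => q 1%N t + d 0%N t).
Proof.
move=> ch t t0; split.
  by apply: drv_eq (jc_odep ch 0 t0) _; ring.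
by apply: drv_eq (jc_odeq ch 0 t0) _; ring.
Qed.

(** This lets a Jordan block act like a simple eigenvalue: the coupling to the next chain element is
    as harmless as the forcing. *)
Lemma chain_remainder_bound om kap n theta : 0 <= kap -> 0 < theta ->
  exists2 K : R, 0 <= K & forall (p q c d : nat -> R -> R) (phi psi : R -> R) a,
    jordan_chain 0 om kap n.+1 p q c d phi psi -> 0 < a ->
    bdle a (prim (fun t => (p 1%N t + c 0%N t) ^+ 2 + (q 1%N t + d 0%N t) ^+ 2))
           (fun T => theta * prim (fun t => p 0%N t ^+ 2 + q 0%N t ^+ 2) T
                     + K * (prim phi T + psi T)).
Proof.
move=> kap0 th0; have th2 : 0 < theta / 2 by lra.
have [K K0 HK] := neutral_chain_bound om n kap0 th2.
exists (2 * K + 2 * kap); first by nng.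
move=> p q c d phi psi a ch a0.
have cp1 := jc_contp ch 1; have cq1 := jc_contq ch 1.
have cc := jc_contc ch 0; have cd := jc_contd ch 0; have cphi := jc_contphi ch.
set Y1 := fun t => p 1%N t ^+ 2 + q 1%N t ^+ 2.
have cY1 : continuous Y1 by rewrite /Y1; cont.
have [C1 H1] : bdle a (prim (fun t => (p 1%N t + c 0%N t) ^+ 2 + (q 1%N t + d 0%N t) ^+ 2))
    (fun T => 2 * prim Y1 T + 2 * kap * prim phi T).
  apply: (bdle_prim2 a0 _ cY1 cphi); first by cont.
  move=> t at_; have := jc_force ch 0 t; rewrite /Y1.
  have := sqr_ge0 (p 1%N t - c 0%N t); have := sqr_ge0 (q 1%N t - d 0%N t); lra.
have [C2 H2] := HK _ _ _ _ _ _ a ch a0.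
exists (C1 + 2 * C2) => T aT; have := H1 T aT; have := H2 T aT.
have := mulr_ge0 kap0 (jc_psi0 ch T); lra.
Qed.

End ChainPairs.

Section ChainPairBounds.
Context {R : realType}.
Implicit Types (al om kap a t T tau taubar theta : R) (p q r s : R -> R).

(** If one mode is unstable, its energy is bounded by forcing and final value, and Young's
    inequality suffices. If both lie on the imaginary axis, their frequencies differ: the delay is
    turned into a phase, and the absence of resonance does the rest. *)
Lemma pair_correlation_bound al om al' om' kap n taubar theta :
  0 <= al -> 0 <= al' -> (al, om) != (al', om') -> 0 <= kap -> 0 <= taubar -> 0 < theta ->
  exists2 K : R, 0 <= K & forall (p q c d p' q' c' d' : nat -> R -> R) (phi psi : R -> R) a tau,
    jordan_chain al om kap n.+1 p q c d phi psi ->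
    jordan_chain al' om' kap n.+1 p' q' c' d' phi psi ->
    0 <= tau <= taubar -> taubar < a ->
    bdle a (prim (fun t => - (p 0%N t * p' 0%N (t - tau) + q 0%N t * q' 0%N (t - tau))))
      (fun T => theta * (prim (fun t => p 0%N t ^+ 2 + q 0%N t ^+ 2) T
                         + prim (fun t => p' 0%N t ^+ 2 + q' 0%N t ^+ 2) T)
                + K * (prim phi T + psi T)).
Proof.
move=> al0 al'0 neq kap0 tb0 th0; have thV : 0 < theta^-1 by rewrite invr_gt0.
have prim_sq0 (f g : R -> R) T : 0 <= prim (fun t => f t ^+ 2 + g t ^+ 2) T.
  by apply: prim_ge0 => t; nng.
have [al_eq|al_neq] := eqVneq al 0; last first.
  have alp : 0 < al by rewrite lt_def al_neq.
  have [K K0 HK] := unstable_chain_bound om n.+1 alp kap0.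
  exists (theta^-1 * K); first by nng.
  move=> p q c d p' q' c' d' phi psi a tau ch ch' /andP[tau0 tautb] tba.
  have a0 : 0 < a by lra.
  have [C1 H1] := HK _ _ _ _ _ _ a ch a0.
  have ta : tau < a by lra.
  have [C2 H2] := correlation_young thV tau0 ta (jc_contp ch 0) (jc_contq ch 0)
    (jc_contp ch' 0) (jc_contq ch' 0).
  exists (C2 + theta^-1 * C1) => T aT; have := H2 T aT; have := H1 T aT.
  rewrite invrK -subr_ge0 => /(mulr_ge0 (ltW thV)) B1 B2.
  have B3 := mulr_ge0 (ltW th0) (prim_sq0 (p 0%N) (q 0%N) T).
  by move: (theta^-1) B1 B2 => it; lra.
have [al'_eq|al'_neq] := eqVneq al' 0; last first.
  have alp : 0 < al' by rewrite lt_def al'_neq.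
  have [K K0 HK] := unstable_chain_bound om' n.+1 alp kap0.
  exists (theta^-1 * K); first by nng.
  move=> p q c d p' q' c' d' phi psi a tau ch ch' /andP[tau0 tautb] tba.
  have a0 : 0 < a by lra.
  have [C1 H1] := HK _ _ _ _ _ _ a ch' a0.
  have ta : tau < a by lra.
  have [C2 H2] := correlation_young th0 tau0 ta (jc_contp ch 0) (jc_contq ch 0)
    (jc_contp ch' 0) (jc_contq ch' 0).
  exists (C2 + theta^-1 * C1) => T aT; have := H2 T aT; have := H1 T aT.
  rewrite -subr_ge0 => /(mulr_ge0 (ltW thV)) B1 B2.
  have B3 := mulr_ge0 (ltW th0) (prim_sq0 (p' 0%N) (q' 0%N) T).
  by move: (theta^-1) B1 B2 => it; lra.
rewrite {}al_eq {}al'_eq in al0 al'0 neq *.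
have omneq : om != om' by move: neq; rewrite xpair_eqE eqxx.
have th4 : 0 < theta / 4 by lra.
have [K1 K10 HK1] := delay_replace om' tb0 th4.
have [K2 K20 HK2] := cross_frequency_bound omneq th4.
(* The perturbations enter with factors [K2] and [K1 + K2]; [eta] brings each of them back to at
   most [theta / 4] of the energy of its chain head. *)
pose eta := theta / (4 * (K1 + K2 + 1)).
have eta0 : 0 < eta by rewrite divr_gt0//; lra.
have etaE : eta * (K1 + K2 + 1) = theta / 4.
  by rewrite /eta; field; rewrite gt_eqF//; lra.
have [K3 K30 HK3] := chain_remainder_bound om n kap0 eta0.
have [K4 K40 HK4] := chain_remainder_bound om' n kap0 eta0.
exists (K2 * K3 + (K1 + K2) * K4 + 2 * K2 * kap); first by nng.
move=> p q c d p' q' c' d' phi psi a tau ch ch' tautb tba.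
have a0 : 0 < a by lra.
have rot := chain_rotating ch; have rot' := chain_rotating ch'.
have cp := jc_contp ch 0; have cq := jc_contq ch 0.
have cp' := jc_contp ch' 0; have cq' := jc_contq ch' 0.
have cr : continuous (fun t => p 1%N t + c 0%N t).
  by have := jc_contp ch 1; have := jc_contc ch 0 => ? ?; cont.
have cs : continuous (fun t => q 1%N t + d 0%N t).
  by have := jc_contq ch 1; have := jc_contd ch 0 => ? ?; cont.
have cr' : continuous (fun t => p' 1%N t + c' 0%N t).
  by have := jc_contp ch' 1; have := jc_contc ch' 0 => ? ?; cont.
have cs' : continuous (fun t => q' 1%N t + d' 0%N t).
  by have := jc_contq ch' 1; have := jc_contd ch' 0 => ? ?; cont.
have [C1 H1] := HK1 _ _ _ _ _ _ a tau rot' tautb tba cp cq cp' cq' cr' cs'.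
have [C2 H2] := HK2 _ _ _ _ _ _ _ _ a _ _ rot rot' a0 cp cq cr cs cp' cq' cr' cs'
  (cos2Dsin2 (om' * tau)).
have [C3 H3] := HK3 _ _ _ _ _ _ a ch a0.
have [C4 H4] := HK4 _ _ _ _ _ _ a ch' a0.
exists (C1 + C2 + K2 * C3 + (K1 + K2) * C4) => T aT.
have := H1 T aT; have := H2 T aT.
have := H3 T aT; rewrite -subr_ge0 => /(mulr_ge0 K20).
have := H4 T aT; rewrite -subr_ge0 => /(mulr_ge0 (addr_ge0 K10 K20)).
have := jc_state ch 0 T; rewrite -subr_ge0 => /(mulr_ge0 K20).
have := jc_state ch' 0 T; rewrite -subr_ge0 => /(mulr_ge0 K20).
have := mulr_ge0 (mulr_ge0 K20 kap0) (prim_ge0 T (jc_phi0 ch)).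
have := prim_sq0 (p 0%N) (q 0%N) T; have := prim_sq0 (p' 0%N) (q' 0%N) T.
set P := prim (fun t => p 0%N t ^+ 2 + q 0%N t ^+ 2) T.
set P' := prim (fun t => p' 0%N t ^+ 2 + q' 0%N t ^+ 2) T.
move=> P'0 P0.
have L1 : K2 * eta * P <= theta / 4 * P.
  rewrite ler_wpM2r// -etaE mulrC ler_pM2l//; lra.
have L2 : (K1 + K2) * eta * P' <= theta / 4 * P'.
  rewrite ler_wpM2r// -etaE mulrC ler_pM2l//; lra.
have := mulr_ge0 (ltW th0) P0; have := mulr_ge0 (ltW th0) P'0.
set Q := prim (fun t => (p 1%N t + c 0%N t) ^+ 2 + (q 1%N t + d 0%N t) ^+ 2) T.
set Q' := prim (fun t => (p' 1%N t + c' 0%N t) ^+ 2 + (q' 1%N t + d' 0%N t) ^+ 2) T.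
set X := prim _ T; set Z := prim _ T.
move: (psi T) => ps.
by move: P P' Q Q' X Z L1 L2 P0 P'0 => P P' Q Q' X Z *; lra.
Qed.
End ChainPairBounds.

Section ChainFamilies.
Context {R : realType}.
Implicit Types (al om kap a t T tau taubar theta : R) (p q r s : R -> R).

(** A neutral mode against its own past leaves [cos (om * tau)] times its energy; the sine part
    cancels identically. For [al > 0] no condition on the phase is required, the energy itself being
    controlled. *)
Lemma self_correlation_bound al om kap n taubar theta (c0 : R) :
  0 <= al -> (al = 0 -> forall tau, 0 <= tau <= taubar -> c0 <= cos (om * tau)) ->
  0 <= c0 -> 0 <= kap -> 0 <= taubar -> 0 < theta ->
  exists2 K : R, 0 <= K & forall (p q c d : nat -> R -> R) (phi psi : R -> R) a tau,
    jordan_chain al om kap n.+1 p q c d phi psi ->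
    0 <= tau <= taubar -> taubar < a ->
    bdle a (prim (fun t => c0 * (p 0%N t ^+ 2 + q 0%N t ^+ 2)
                           - (p 0%N t * p 0%N (t - tau) + q 0%N t * q 0%N (t - tau))))
      (fun T => theta * prim (fun t => p 0%N t ^+ 2 + q 0%N t ^+ 2) T
                + K * (prim phi T + psi T)).
Proof.
move=> al0 hcos c00 kap0 tb0 th0.
have prim_sq0 (f g : R -> R) T : 0 <= prim (fun t => f t ^+ 2 + g t ^+ 2) T.
  by apply: prim_ge0 => t; nng.
have [al_eq|al_neq] := eqVneq al 0; last first.
  have alp : 0 < al by rewrite lt_def al_neq.
  have [K K0 HK] := unstable_chain_bound om n.+1 alp kap0.
  exists ((c0 + 2) * K); first by nng.
  move=> p q c d phi psi a tau ch /andP[tau0 tautb] tba.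
  have a0 : 0 < a by lra.
  have ta : tau < a by lra.
  have cp := jc_contp ch 0; have cq := jc_contq ch 0.
  have [C1 H1] := HK _ _ _ _ _ _ a ch a0.
  have [C2 H2] := correlation_young ltr01 tau0 ta cp cq cp cq.
  set Y := fun t => p 0%N t ^+ 2 + q 0%N t ^+ 2.
  set X := fun t => - (p 0%N t * p 0%N (t - tau) + q 0%N t * q 0%N (t - tau)).
  have cY : continuous Y by rewrite /Y; cont.
  have cX : continuous X by rewrite /X; cont.
  set W := (fun t => _ - _).
  have [C3 H3] : bdle a (prim W) (fun T => c0 * prim Y T + 1 * prim X T).
    by apply: (bdle_prim2 a0 _ cY cX); [rewrite /W; cont | move=> t _; rewrite mul1r].
  exists (C3 + C2 + (c0 + 2) * C1) => T aT.
  have := H3 T aT; have := H2 T aT; rewrite -/Y -/X invr1.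
  have := H1 T aT; rewrite -subr_ge0 => /(mulr_ge0 (addr_ge0 c00 (ler0n _ 2))).
  rewrite -/Y; have := mulr_ge0 (ltW th0) (prim_sq0 (p 0%N) (q 0%N) T); rewrite -/Y.
  by clearbody W X Y; clear -R; lra.
rewrite {}al_eq in al0 hcos *; have {}hcos := hcos erefl.
have th2 : 0 < theta / 2 by lra.
have [K1 K10 HK1] := delay_replace om tb0 th2.
pose eta := theta / (2 * (K1 + 1)).
have eta0 : 0 < eta by rewrite divr_gt0//; lra.
have etaE : eta * (K1 + 1) = theta / 2.
  by rewrite /eta; field; rewrite gt_eqF//; lra.
have [K3 K30 HK3] := chain_remainder_bound om n kap0 eta0.
exists (K1 * K3); first by nng.
move=> p q c d phi psi a tau ch tautb tba.
have a0 : 0 < a by lra.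
have rot := chain_rotating ch.
have cp := jc_contp ch 0; have cq := jc_contq ch 0.
have cr : continuous (fun t => p 1%N t + c 0%N t).
  by have := jc_contp ch 1; have := jc_contc ch 0 => ? ?; cont.
have cs : continuous (fun t => q 1%N t + d 0%N t).
  by have := jc_contq ch 1; have := jc_contd ch 0 => ? ?; cont.
have [C1 H1] := HK1 _ _ _ _ _ _ a tau rot tautb tba cp cq cp cq cr cs.
have [C3 H3] := HK3 _ _ _ _ _ _ a ch a0.
set Y := fun t => p 0%N t ^+ 2 + q 0%N t ^+ 2.
set X := fun t => - (p 0%N t * p 0%N (t - tau) + q 0%N t * q 0%N (t - tau)).
have cY : continuous Y by rewrite /Y; cont.
have cX : continuous X by rewrite /X; cont.
set Z := fun t => - (cos (om * tau) * (p 0%N t * p 0%N t + q 0%N t * q 0%N t)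
   + sin (om * tau) * (p 0%N t * q 0%N t - q 0%N t * p 0%N t)).
have cZ : continuous Z by rewrite /Z; cont.
set W := (fun t => _ - _).
have [C2 H2] : bdle a (prim W) (fun T => c0 * prim Y T + 1 * prim X T).
  by apply: (bdle_prim2 a0 _ cY cX); [rewrite /W; cont | move=> t _; rewrite mul1r].
have [C4 H4] : bdle a (prim Z) (fun T => - c0 * prim Y T + 0 * prim Y T).
  apply: (bdle_prim2 a0 cZ cY cY) => t _; rewrite mul0r addr0.
  have := ler_wpM2r (_ : 0 <= Y t) (hcos _ tautb); rewrite /Y /Z.
  by move=> /(_ ltac:(nng)); lra.
exists (C1 + C2 + K1 * C3 + C4) => T aT.
have := H1 T aT; have := H2 T aT; have := H4 T aT; have := H3 T aT.
rewrite -subr_ge0 => /(mulr_ge0 K10).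
have P0 := prim_sq0 (p 0%N) (q 0%N) T; rewrite -/Y -/X -/Z in P0 *.
have : K1 * eta * prim Y T <= theta / 2 * prim Y T.
  by rewrite ler_wpM2r// -etaE mulrC ler_pM2l//; lra.
have := mulr_ge0 (ltW th0) P0.
set Q := prim _ T; clearbody Q W X Y Z; clear -R.
by lra.
Qed.

Lemma sqr_sum_le (L : nat) (f : 'I_L -> R) :
  (\sum_i f i) ^+ 2 <= L%:R * \sum_i f i ^+ 2.
Proof.
have -> : (\sum_i f i) ^+ 2 = \sum_i \sum_j f i * f j.
  by rewrite expr2 mulr_suml; apply: eq_bigr => i _; rewrite mulr_sumr.
have -> : L%:R * \sum_i f i ^+ 2 = \sum_i \sum_j ((f i ^+ 2 + f j ^+ 2) / 2).
  transitivity (\sum_i \sum_(j < L) (f i ^+ 2 / 2) + \sum_(i < L) \sum_j (f j ^+ 2 / 2)).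
    have cst x : \sum_(j < L) x = L%:R * x :> R by rewrite sumr_const card_ord mulr_natl.
    rewrite cst (eq_bigr _ (fun i _ => cst _)) -mulr_sumr -mulr_suml; lra.
  by rewrite -big_split; apply: eq_bigr => i _; rewrite -big_split; apply: eq_bigr => j _ /=; lra.
apply: ler_sum => i _; apply: ler_sum => j _.
by have := sqr_ge0 (f i - f j); lra.
Qed.

(** Because the imaginary parts of the heads sum to zero, [v t * v (t - tau)] is the sum over all
    pairs of [Re (conj y_i(t) * y_j(t - tau))]. Diagonal pairs yield about [c0] times their energy,
    all others almost nothing. *)
Lemma chain_family_correlation (L : nat) (al om : 'I_L -> R) kap n taubar (c0 : R) :
  (forall i, 0 <= al i) -> (forall i j, i != j -> (al i, om i) != (al j, om j)) ->
  (forall i, al i = 0 -> forall tau, 0 <= tau <= taubar -> c0 <= cos (om i * tau)) ->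
  0 < c0 -> 0 <= kap -> 0 <= taubar ->
  exists2 K : R, 0 <= K & forall (p q c d : 'I_L -> nat -> R -> R) (phi psi v : R -> R) a tau,
    (forall i, jordan_chain (al i) (om i) kap n.+1 (p i) (q i) (c i) (d i) phi psi) ->
    (forall t, v t = \sum_i p i 0%N t) -> (forall t, \sum_i q i 0%N t = 0) ->
    0 <= tau <= taubar -> taubar < a ->
    bdle a (prim (fun t => c0 / (2 * L.+1%:R) * v t ^+ 2 - v t * v (t - tau)))
           (fun T => K * (prim phi T + psi T)).
Proof.
move=> al0 inj hcos c00 kap0 tb0.
have L0 : 0 < (L.+1%:R : R) by rewrite ltr0n.
(* All pairs together lose at most [2 * L * theta] times the total energy, hence at most half of
   what the diagonal yields; the other half dominates the multiple of [v^2] by Cauchy-Schwarz.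
   [L.+1] keeps the divisor nonzero. *)
pose theta : R := c0 / (4 * L.+1%:R).
have th0 : 0 < theta by rewrite divr_gt0// mulr_gt0.
pose D (p q : 'I_L -> nat -> R -> R) tau (i j : 'I_L) t : R :=
  (if i == j then c0 else 0) * (p i 0%N t ^+ 2 + q i 0%N t ^+ 2)
  - (p i 0%N t * p j 0%N (t - tau) + q i 0%N t * q j 0%N (t - tau)).
have : forall ij : 'I_L * 'I_L, exists2 K : R, 0 <= K &
  forall (p q c d : 'I_L -> nat -> R -> R) (phi psi : R -> R) a tau,
    (forall i, jordan_chain (al i) (om i) kap n.+1 (p i) (q i) (c i) (d i) phi psi) ->
    0 <= tau <= taubar -> taubar < a ->
    bdle a (prim (D p q tau ij.1 ij.2))
      (fun T => theta * (prim (fun t => p ij.1 0%N t ^+ 2 + q ij.1 0%N t ^+ 2) T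
                         + prim (fun t => p ij.2 0%N t ^+ 2 + q ij.2 0%N t ^+ 2) T)
                + K * (prim phi T + psi T)).
  move=> [i j] /=; rewrite /D.
  have [<-|ij] := eqVneq i j.
    have [K K0 HK] := self_correlation_bound n (al0 i) (hcos i) (ltW c00) kap0 tb0 th0.
    exists K => // p q c d phi psi a tau ch tautb tba.
    apply: bdle_trans (HK _ _ _ _ _ _ a tau (ch i) tautb tba) _.
    apply: bdle_le => T _; rewrite lerD2r; apply: ler_wpM2l; first exact: ltW.
    rewrite lerDl.
    by apply: prim_ge0 => t; nng.
  have [K K0 HK] := pair_correlation_bound n (al0 i) (al0 j) (inj _ _ ij) kap0 tb0 th0.
  exists K => // p q c d phi psi a tau ch tautb tba.
  have -> : (fun t => 0 * (p i 0%N t ^+ 2 + q i 0%N t ^+ 2)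
    - (p i 0%N t * p j 0%N (t - tau) + q i 0%N t * q j 0%N (t - tau))) =
    (fun t => - (p i 0%N t * p j 0%N (t - tau) + q i 0%N t * q j 0%N (t - tau))).
    by apply/funext => t; rewrite mul0r add0r.
  exact: (HK _ _ _ _ _ _ _ _ _ _ a tau (ch i) (ch j) tautb tba).
move=> /fin_all_exists2[K0 K00 HK].
exists (\sum_ij K0 ij); first by apply: sumr_ge0.
move=> p q c d phi psi v a tau ch vE qE tautb tba.
have a0 : 0 < a by lra.
pose Y i t : R := p i 0%N t ^+ 2 + q i 0%N t ^+ 2.
have cY i : continuous (Y i).
  by have := jc_contp (ch i) 0; have := jc_contq (ch i) 0 => ? ?; rewrite /Y; cont.
have cv : continuous v.
  rewrite (_ : v = fun t => \sum_i p i 0%N t); last exact/funext.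
  by apply: cont_sum => i; exact: jc_contp (ch i) 0.
have cD i j : continuous (D p q tau i j).
  have := jc_contp (ch i) 0; have := jc_contq (ch i) 0.
  have := jc_contp (ch j) 0; have := jc_contq (ch j) 0 => ? ? ? ?.
  by rewrite /D; cont.
have step : bdle a (prim (fun t => c0 / (2 * L.+1%:R) * v t ^+ 2 - v t * v (t - tau)))
   (fun T => \sum_ij prim (D p q tau ij.1 ij.2) T + - (c0 / 2) * \sum_i prim (Y i) T).
  apply: (bdle_prim (F' := fun t => \sum_ij D p q tau ij.1 ij.2 t + - (c0 / 2) * \sum_i Y i t)).
  - exact: a0.
  - by cont.
  - move=> t at_; have t0 := lt_le_trans a0 at_.
    apply: drvD; first by apply: drv_sum => ij; exact: drv_prim.
    by apply: drvZ; apply: drv_sum => i; exact: drv_prim.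
  move=> t at_.
  have -> : \sum_ij D p q tau ij.1 ij.2 t = c0 * \sum_i Y i t - v t * v (t - tau).
    rewrite -(pair_bigA _ (fun i j => D p q tau i j t)) /=.
    transitivity (\sum_i (c0 * Y i t - (p i 0%N t * v (t - tau)))).
      apply: eq_bigr => i _; rewrite /D sumrB; congr (_ - _).
        rewrite (bigD1 i)//= eqxx big1 ?addr0// => j; rewrite eq_sym => /negbTE ->.
        by rewrite mul0r.
      by rewrite big_split /= -!mulr_sumr qE mulr0 addr0 vE.
    by rewrite sumrB -mulr_sumr -mulr_suml -vE.
  have vY : c0 / (2 * L.+1%:R) * v t ^+ 2 <= c0 / 2 * \sum_i Y i t.
    have -> : c0 / 2 * \sum_i Y i t = c0 / (2 * L.+1%:R) * (L.+1%:R * \sum_i Y i t).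
      by move: (L.+1%:R) L0 => l l0; field; rewrite gt_eqF.
    apply: ler_wpM2l; first by rewrite divr_ge0 ?mulr_ge0 ?ltW.
    rewrite vE; apply: le_trans (sqr_sum_le _) _.
    have Y0 : 0 <= \sum_i Y i t by apply: sumr_ge0 => i _; rewrite /Y; nng.
    apply: (@le_trans _ _ (L%:R * \sum_i Y i t)).
      rewrite ler_wpM2l// ler_sum// => i _; rewrite /Y; have := sqr_ge0 (q i 0%N t); lra.
    by rewrite ler_wpM2r// ler_nat leqnSn.
  by move: vY; move: (_ / (2 * _)) (\sum_i Y i t) (v t) (v _) => *; lra.
apply: bdle_trans step _.
have [C HC] := bdle_sum (index_enum _) (fun ij => HK ij _ _ _ _ _ _ a tau ch tautb tba).
exists C => T aT; have {HC} := HC T aT.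
rewrite big_split /= -mulr_suml -mulr_sumr big_split /=.
rewrite -(pair_bigA _ (fun i j => prim (Y i) T)) -(pair_bigA _ (fun i j => prim (Y j) T)) /=.
have cst x : \sum_(j < L) x = L%:R * x :> R by rewrite sumr_const card_ord mulr_natl.
rewrite cst (eq_bigr _ (fun i _ => cst _)) -mulr_sumr.
set S := \sum_i prim (Y i) T.
have S0 : 0 <= S by apply: sumr_ge0 => i _; apply: prim_ge0 => t; rewrite /Y; nng.
have : theta * (L%:R * S + L%:R * S) <= c0 / 2 * S.
  have -> : c0 / 2 * S = theta * (L.+1%:R * S + L.+1%:R * S).
    by rewrite /theta; move: (L.+1%:R) L0 => l l0; field; rewrite gt_eqF.
  apply: ler_wpM2l; first exact: ltW.
  by rewrite lerD// ler_wpM2r// ler_nat leqnSn.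
by lra.
Qed.

End ChainFamilies.

(** * Generalised eigenvectors *)

(** The idempotents of the Chinese remainder theorem. Evaluated at a matrix annihilated by the
    product, they are the projections onto its generalised eigenspaces. *)
Lemma poly_primary_partition (F : fieldType) (k : F -> nat) (s : seq F) : uniq s ->
  exists E : F -> {poly F},
    (\prod_(x <- s) ('X - x%:P) ^+ k x %| 1 - \sum_(x <- s) E x) /\
    forall x, x \in s ->
      \prod_(y <- s) ('X - y%:P) ^+ k y %| E x * ('X - x%:P) ^+ k x.
Proof.
elim: s => [_|x s IH /= /andP[xs us]].
  by exists (fun=> 0); rewrite !big_nil; split => //; exact: dvd1p.
have [E [E1 E2]] := IH us.
set Q := \prod_(y <- s) _ in E1 E2.
have /Bezout_eq1_coprimepP[[u w] /= uw] : coprimep (('X - x%:P) ^+ k x) Q.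
  apply: coprimep_expl; rewrite coprimep_sym coprimep_XsubC /Q.
  rewrite /root horner_prod prodf_seq_neq0; apply/allP => y ys /=.
  rewrite hornerE !hornerE expf_neq0// subr_eq0.
  by apply: contraNneq xs => ->.
(* Bezout splits 1 into [w * Q], the share of the new root, and a multiple of [('X - x%:P) ^+ k x],
   by which the earlier shares are multiplied. *)
exists (fun y => if y == x then w * Q else E y * (u * ('X - x%:P) ^+ k x)).
have sE : \sum_(y <- s) (if y == x then w * Q else E y * (u * ('X - x%:P) ^+ k x)) =
    (\sum_(y <- s) E y) * (u * ('X - x%:P) ^+ k x).
  rewrite mulr_suml !big_seq; apply: eq_bigr => y ys.
  by case: eqVneq ys => // ->; rewrite (negbTE xs).
rewrite !big_cons eqxx sE -/Q; split.
  have -> : 1 - (w * Q + (\sum_(y <- s) E y) * (u * ('X - x%:P) ^+ k x)) =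
     ('X - x%:P) ^+ k x * ((1 - \sum_(y <- s) E y) * u).
    rewrite -{1}uw; ring.
  by rewrite dvdp_mul// dvdp_mulr.
move=> y; rewrite inE; case: eqVneq => [-> _|yx /= ys].
  have -> : w * Q * ('X - x%:P) ^+ k x = w * (('X - x%:P) ^+ k x * Q) by ring.
  exact: dvdp_mull.
have -> : E y * (u * ('X - x%:P) ^+ k x) * ('X - y%:P) ^+ k y =
  ('X - x%:P) ^+ k x * (E y * ('X - y%:P) ^+ k y * u) by ring.
by rewrite dvdp_mul// dvdp_mulr// E2.
Qed.

Section RealParts.
Context {R : realType}.

Lemma ReD (x y : R[i]) : complex.Re (x + y) = complex.Re x + complex.Re y.
Proof. by case: x y => [? ?] [? ?]. Qed.

Lemma ImD (x y : R[i]) : complex.Im (x + y) = complex.Im x + complex.Im y.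
Proof. by case: x y => [? ?] [? ?]. Qed.

Lemma Re_sum (I : Type) (r : seq I) (F : I -> R[i]) :
  complex.Re (\sum_(i <- r) F i) = \sum_(i <- r) complex.Re (F i).
Proof. by elim: r => [|i r IH]; rewrite ?big_nil// !big_cons ReD IH. Qed.

Lemma Im_sum (I : Type) (r : seq I) (F : I -> R[i]) :
  complex.Im (\sum_(i <- r) F i) = \sum_(i <- r) complex.Im (F i).
Proof. by elim: r => [|i r IH]; rewrite ?big_nil// !big_cons ImD IH. Qed.

Definition Remx m n (v : 'M[R[i]]_(m, n)) : 'M[R]_(m, n) := map_mx (@complex.Re R) v.
Definition Immx m n (v : 'M[R[i]]_(m, n)) : 'M[R]_(m, n) := map_mx (@complex.Im R) v.

Lemma Remx_mul m n (v : 'M[R[i]]_(m, n)) (A : 'M[R]_n) :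
  Remx (v *m cmx A) = Remx v *m A.
Proof.
apply/matrixP => i j; rewrite !mxE Re_sum; apply: eq_bigr => k _; rewrite !mxE.
by case: (v i k) => a b /=; rewrite mulr0 subr0.
Qed.

Lemma Immx_mul m n (v : 'M[R[i]]_(m, n)) (A : 'M[R]_n) :
  Immx (v *m cmx A) = Immx v *m A.
Proof.
apply/matrixP => i j; rewrite !mxE Im_sum; apply: eq_bigr => k _; rewrite !mxE.
by case: (v i k) => a b /=; rewrite mulr0 add0r.
Qed.

Lemma RemxD m n (v w : 'M[R[i]]_(m, n)) : Remx (v + w) = Remx v + Remx w.
Proof. by apply/matrixP => i j; rewrite !mxE ReD. Qed.

Lemma ImmxD m n (v w : 'M[R[i]]_(m, n)) : Immx (v + w) = Immx v + Immx w.
Proof. by apply/matrixP => i j; rewrite !mxE ImD. Qed.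

Lemma RemxZ m n (l : R[i]) (v : 'M[R[i]]_(m, n)) :
  Remx (l *: v) = complex.Re l *: Remx v - complex.Im l *: Immx v.
Proof. by apply/matrixP => i j; rewrite !mxE; case: l (v i j) => [? ?] [? ?]. Qed.

Lemma ImmxZ m n (l : R[i]) (v : 'M[R[i]]_(m, n)) :
  Immx (l *: v) = complex.Im l *: Remx v + complex.Re l *: Immx v.
Proof.
apply/matrixP => i j; rewrite !mxE; case: l (v i j) => [? ?] [? ?] /=; exact: addrC.
Qed.

End RealParts.

(** The chains are [b E_i(M) (M - lambda_i)^k], with real part [r] and imaginary part [s]; no Jordan
    basis is involved, as the elements need not be independent. The eigenvalues are fixed before
    [b], and [b] being real makes the imaginary heads cancel. *)
Lemma generalized_eigenrows (R : realType) (n : nat) (M : 'M[R]_n) :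
  exists (L : nat) (al om : 'I_L -> R),
    [/\ forall i, eigenvalue (cmx M) (Complex (al i) (om i)),
        forall i j, i != j -> (al i, om i) != (al j, om j) &
        forall b : 'rV[R]_n, exists r s : 'I_L -> nat -> 'rV[R]_n,
        [/\ forall i k, r i k *m M = al i *: r i k - om i *: s i k + r i k.+1,
            forall i k, s i k *m M = om i *: r i k + al i *: s i k + s i k.+1,
            forall i k, (n < k)%N -> r i k = 0 /\ s i k = 0,
            b = \sum_i r i 0%N & \sum_i s i 0%N = 0]].
Proof.
(* [horner_mx] lives on matrices of successor size; in dimension 0 the empty family serves. *)
case: n M => [|n] M.
  exists 0%N, (fun=> 0), (fun=> 0); split => [[]//|[]//|b].
  by exists (fun _ _ => 0), (fun _ _ => 0); split => [[]|[]|[]||] //; rewrite !big_ord0// thinmx0.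
set Mc := cmx M.
have [rs] := closed_field_poly_normal (char_poly Mc).
rewrite (monicP (char_poly_monic _)) scale1r => chE.
set lam := undup rs; pose k x := count_mem x rs.
have [E [E1 E2]] := poly_primary_partition k (undup_uniq rs).
have QE : \prod_(x <- lam) ('X - x%:P) ^+ k x = char_poly Mc.
  by rewrite chE (prodr_undup_exp_count rs xpredT (fun x => 'X - x%:P)).
rewrite QE in E1 E2.
have kill p : char_poly Mc %| p -> horner_mx Mc p = 0.
  by move=> /dvdpP[u ->]; rewrite rmorphM /= Cayley_Hamilton mulr0.
pose nlam (i : 'I_(size lam)) := nth 0 lam i.
have nlamE (i : 'I_(size lam)) : nlam i \in lam by rewrite mem_nth.
exists (size lam), (fun i => complex.Re (nlam i)), (fun i => complex.Im (nlam i)).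
split.
- move=> i; rewrite eigenvalue_root_char chE root_prod_XsubC.
  by have := nlamE i; rewrite mem_undup; case: (nlam i).
- move=> i j; apply: contraNneq => eqij; apply/eqP/val_inj/eqP.
  rewrite -(nth_uniq 0 (ltn_ord i) (ltn_ord j) (undup_uniq rs)); apply/eqP.
  by move: eqij; rewrite -/(nlam i) -/(nlam j); case: (nlam i) (nlam j) => [? ?] [? ?] [] /= -> ->.
move=> b.
pose bc : 'rV[R[i]]_n.+1 := map_mx (fun x : R => (x%:C)%C) b.
pose rc (i : 'I_(size lam)) (j : nat) :=
  bc *m horner_mx Mc (E (nlam i) * ('X - (nlam i)%:P) ^+ j).
have rcM i j : rc i j *m Mc = nlam i *: rc i j + rc i j.+1.
  have hM p q : horner_mx Mc p *m horner_mx Mc q = horner_mx Mc (p * q).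
    by rewrite rmorphM.
  rewrite /rc -mulmxA -{2}(horner_mx_X Mc) hM scalemxAr -mulmxDr; congr (_ *m _).
  rewrite -mul_scalar_mx -(horner_mx_C Mc) hM -rmorphD /=; congr horner_mx.
  by rewrite exprS; ring.
have rc0 i j : (n.+1 < j)%N -> rc i j = 0.
  move=> nj.
  rewrite /rc kill ?mulmx0//.
  have kn : (k (nlam i) <= j)%N.
    apply: leq_trans (count_size _ _) _.
    have := size_char_poly Mc; by rewrite chE size_prod_XsubC => -[->]; exact: ltnW.
  rewrite -(subnK kn) exprD mulrCA dvdp_mull//; exact: E2.
have rcS : \sum_i rc i 0%N = bc.
  rewrite /rc -mulmx_sumr -raddf_sum /=; under eq_bigr do rewrite expr0 mulr1.
  have -> : \sum_(i < size lam) E (nlam i) = \sum_(x <- lam) E x.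
    by rewrite (big_nth 0) big_mkord.
  have := kill _ E1; rewrite rmorphB rmorph1 /= => /eqP; rewrite subr_eq0 => /eqP <-.
  by rewrite mulmx1.
exists (fun i j => Remx (rc i j)), (fun i j => Immx (rc i j)); split.
- by move=> i j; rewrite -Remx_mul rcM RemxD RemxZ.
- by move=> i j; rewrite -Immx_mul rcM ImmxD ImmxZ.
- by move=> i j nj; rewrite rc0//; split; apply/matrixP => ? ?; rewrite !mxE.
- apply/matrixP => i j; transitivity (Remx bc i j); first by rewrite !mxE.
  by rewrite -rcS /Remx [LHS]mxE summxE Re_sum summxE; apply: eq_bigr => ? _; rewrite [RHS]mxE.
- apply/matrixP => i j; transitivity (Immx bc i j); last by rewrite !mxE.
  by rewrite -rcS /Immx [RHS]mxE !summxE Im_sum; apply: eq_bigr => ? _; rewrite [LHS]mxE.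
Qed.

Section VectorSignals.
Context {R : realType}.

Definition dot n (u v : 'cV[R]_n) : R := \sum_i u i 0 * v i 0.
Definition nsq n (v : 'cV[R]_n) : R := \sum_i v i 0 ^+ 2.
Definition ev n (b : 'rV[R]_n) (v : 'cV[R]_n) : R := (b *m v) 0 0.
Definition vcont n (z : R -> 'cV[R]_n) := forall i, continuous (fun s : R => z s i 0).
Definition vderiv n (t : R) (z : R -> 'cV[R]_n) (D : 'cV[R]_n) :=
  forall i, has_deriv t (fun s => z s i 0) (D i 0).

Lemma nsq_ge0 n (v : 'cV[R]_n) : 0 <= nsq v.
Proof. by apply: sumr_ge0 => i _; exact: sqr_ge0. Qed.

Lemma nsqE n (v : 'cV[R]_n) : nsq v = dot v v.
Proof. by []. Qed.

Lemma evE n (b : 'rV[R]_n) v : ev b v = \sum_i b 0 i * v i 0.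
Proof. by rewrite /ev mxE. Qed.

Lemma evD n (b : 'rV[R]_n) u v : ev b (u + v) = ev b u + ev b v.
Proof. by rewrite /ev mulmxDr mxE. Qed.

Lemma ev_mul n (b : 'rV[R]_n) (M : 'M[R]_n) v : ev b (M *m v) = ev (b *m M) v.
Proof. by rewrite /ev mulmxA. Qed.

Lemma ev_suml n (I : Type) (l : seq I) (b : I -> 'rV[R]_n) v :
  ev (\sum_(i <- l) b i) v = \sum_(i <- l) ev (b i) v.
Proof. by rewrite /ev mulmx_suml summxE. Qed.

Lemma dot_sqr_le n (u v : 'cV[R]_n) : dot u v ^+ 2 <= nsq u * nsq v.
Proof.
rewrite -subr_ge0.
(* Lagrange's identity. *)
suff -> : nsq u * nsq v - dot u v ^+ 2 =
    2^-1 * \sum_i \sum_j (u i 0 * v j 0 - u j 0 * v i 0) ^+ 2.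
  apply: mulr_ge0 => //; apply: sumr_ge0 => i _; apply: sumr_ge0 => j _; exact: sqr_ge0.
have prodE (f g : 'I_n -> R) : (\sum_i f i) * (\sum_i g i) = \sum_i \sum_j f i * g j.
  by rewrite mulr_suml; apply: eq_bigr => i _; rewrite mulr_sumr.
have -> : \sum_i \sum_j (u i 0 * v j 0 - u j 0 * v i 0) ^+ 2 =
  nsq u * nsq v + nsq v * nsq u - 2 * (dot u v * dot u v).
  rewrite /nsq /dot !prodE mulr_sumr -big_split -sumrB; apply: eq_bigr => i _ /=.
  rewrite mulr_sumr -big_split -sumrB; apply: eq_bigr => j _ /=; ring.
by field.
Qed.

Lemma ev_sqr_le n (b : 'rV[R]_n) v : ev b v ^+ 2 <= nsq b^T * nsq v.
Proof.
have -> : ev b v = dot b^T v by rewrite evE; apply: eq_bigr => i _; rewrite mxE.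
exact: dot_sqr_le.
Qed.

Lemma cont_ev n (b : 'rV[R]_n) (z : R -> 'cV[R]_n) :
  vcont z -> continuous (fun t => ev b (z t)).
Proof.
move=> cz; under eq_fun do rewrite evE.
by apply: cont_sum => i; apply: contM; [exact: cont_cst | exact: cz].
Qed.

Lemma drv_ev n (b : 'rV[R]_n) (z : R -> 'cV[R]_n) t D :
  vderiv t z D -> has_deriv t (fun t => ev b (z t)) (ev b D).
Proof.
move=> dz; under eq_fun do rewrite evE; rewrite evE.
by apply: drv_sum => i; apply: drvZ; exact: dz.
Qed.

Lemma vcont_mul m n (A : 'M[R]_(m, n)) z : vcont z -> vcont (fun t => A *m z t).
Proof.
move=> cz i; have := cont_ev (b := row i A) cz; rewrite /ev.
by under eq_fun do rewrite -row_mul mxE.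
Qed.

Lemma vderiv_mul m n (A : 'M[R]_(m, n)) z t D :
  vderiv t z D -> vderiv t (fun t => A *m z t) (A *m D).
Proof.
move=> dz i; have := drv_ev (row i A) dz; rewrite /ev.
by under eq_fun do rewrite -row_mul mxE; rewrite -row_mul mxE.
Qed.

Lemma cont_nsq n (z : R -> 'cV[R]_n) : vcont z -> continuous (fun t => nsq (z t)).
Proof. by move=> cz; apply: cont_sum => i; apply: contX2; exact: cz. Qed.

Lemma cont_dot n (y z : R -> 'cV[R]_n) : vcont y -> vcont z ->
  continuous (fun t => dot (y t) (z t)).
Proof. by move=> cy cz; apply: cont_sum => i; apply: contM; [exact: cy | exact: cz]. Qed.

Lemma drv_dot n (y z : R -> 'cV[R]_n) t D E : vderiv t y D -> vderiv t z E ->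
  has_deriv t (fun t => dot (y t) (z t)) (dot (y t) E + dot D (z t)).
Proof.
move=> dy dz; rewrite /dot -big_split; apply: drv_sum => i.
by apply: drvM; [exact: dy | exact: dz].
Qed.

End VectorSignals.

(** Each row of [B^T] splits into chains of generalised left eigenvectors of [M], which, evaluated
    along [z], form a [jordan_chain] forced by [f]. The use is with [M = - A^T], hence the right
    half plane. *)
Lemma delay_correlation (R : realType) (n m : nat) (M : 'M[R]_n) (B : 'M[R]_(n, m))
    (taubar c0 : R) :
  (forall l, eigenvalue (cmx M) l -> 0 <= complex.Re l) ->
  (forall w, eigenvalue (cmx M) (Complex 0 w) ->
     forall tau, 0 <= tau <= taubar -> c0 <= cos (w * tau)) ->
  0 < c0 -> 0 <= taubar ->
  exists2 kappa : R, 0 < kappa & exists2 K : R, 0 <= K &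
  forall (z f : R -> 'cV[R]_n) (a tau : R), vcont z -> vcont f ->
    (forall t : R, 0 < t -> vderiv t z (M *m z t + f t)) ->
    0 <= tau <= taubar -> taubar < a ->
    bdle a (prim (fun t => kappa * nsq (B^T *m z t)
                           - dot (B^T *m z t) (B^T *m z (t - tau))))
           (fun T => K * (prim (fun t => nsq (f t)) T + nsq (z T))).
Proof.
move=> Mre Mcos c00 tb0.
have [L [al [om [eigM inj rows]]]] := generalized_eigenrows M.
have al0 i : 0 <= al i by exact: Mre (eigM i).
have hcos i : al i = 0 -> forall tau, 0 <= tau <= taubar -> c0 <= cos (om i * tau).
  by move=> ai; apply: Mcos; rewrite -ai; exact: eigM.
(* [L] counts eigenvalues of [M] and does not depend on the row of [B^T], so one [kappa] serves all
   inputs. *)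
exists (c0 / (2 * L.+1%:R)); first by rewrite divr_gt0// mulr_gt0.
have : forall j : 'I_m, exists2 K : R, 0 <= K &
  forall (z f : R -> 'cV[R]_n) (a tau : R), vcont z -> vcont f ->
    (forall t : R, 0 < t -> vderiv t z (M *m z t + f t)) ->
    0 <= tau <= taubar -> taubar < a ->
    bdle a (prim (fun t => c0 / (2 * L.+1%:R) * ev (row j B^T) (z t) ^+ 2
                           - ev (row j B^T) (z t) * ev (row j B^T) (z (t - tau))))
           (fun T => K * (prim (fun t => nsq (f t)) T + nsq (z T))).
  move=> j; have [r [s [rM sM rs0 rS sS]]] := rows (row j B^T).
  (* The sum of the squared norms of all chain vectors that may be nonzero: by Cauchy-Schwarz it
     bounds every forcing term by [nsq f] and every state by [nsq z]. *)
  pose kap : R := \sum_(i < L) \sum_(k < n.+1) (nsq (r i k)^T + nsq (s i k)^T).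
  have kap0 : 0 <= kap.
    by apply: sumr_ge0 => i _; apply: sumr_ge0 => k _; rewrite addr_ge0 ?nsq_ge0.
  have kapE i k (v : 'cV[R]_n) : ev (r i k) v ^+ 2 + ev (s i k) v ^+ 2 <= kap * nsq v.
    have [kn|kn] := ltnP n k.
      have [-> ->] := rs0 i k kn.
      by rewrite /ev !mul0mx !mxE expr0n addr0 mulr_ge0 ?nsq_ge0.
    apply: (@le_trans _ _ ((nsq (r i k)^T + nsq (s i k)^T) * nsq v)).
      by rewrite mulrDl lerD// ev_sqr_le.
    rewrite ler_wpM2r ?nsq_ge0// /kap (bigD1 i)//= (bigD1 (Ordinal (kn : (k < n.+1)%N)))//=.
    rewrite -addrA lerDl addr_ge0//; apply: sumr_ge0 => *; rewrite ?addr_ge0 ?nsq_ge0//.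
    by apply: sumr_ge0 => *; rewrite addr_ge0 ?nsq_ge0.
  have [K K0 HK] := chain_family_correlation n al0 inj hcos c00 kap0 tb0.
  exists K => // z f a tau cz cf dz tautb tba.
  apply: (HK (fun i k t => ev (r i k) (z t)) (fun i k t => ev (s i k) (z t))
    (fun i k t => ev (r i k) (f t)) (fun i k t => ev (s i k) (f t))
    (fun t => nsq (f t)) (fun t => nsq (z t)) (fun t => ev (row j B^T) (z t)) a tau) => //.
  - move=> i; split => //.
    + by move=> k; exact: cont_ev.
    + by move=> k; exact: cont_ev.
    + by move=> k; exact: cont_ev.
    + by move=> k; exact: cont_ev.
    + exact: cont_nsq.
    + by move=> t; exact: nsq_ge0.
    + by move=> t; exact: nsq_ge0.
    + move=> k t t0; apply: drv_eq (drv_ev (r i k) (dz t t0)) _.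
      by rewrite evD ev_mul rM /ev !mulmxDl mulNmx -!scalemxAl !mxE.
    + move=> k t t0; apply: drv_eq (drv_ev (s i k) (dz t t0)) _.
      by rewrite evD ev_mul sM /ev !mulmxDl -!scalemxAl !mxE.
    + by move=> t; have [-> _] := rs0 i n.+1 (ltnSn n); rewrite /ev mul0mx mxE.
    + by move=> t; have [_ ->] := rs0 i n.+1 (ltnSn n); rewrite /ev mul0mx mxE.
  - by move=> t; rewrite rS ev_suml.
  - by move=> t; rewrite -ev_suml sS /ev mul0mx mxE.
move=> /fin_all_exists2[K K0 HK].
exists (\sum_j K j); first exact: sumr_ge0.
move=> z f a tau cz cf dz tautb tba.
have a0 : 0 < a by lra.
have czt : vcont (fun t => z (t - tau)) by move=> i; exact: (cont_shift (f := fun s => z s i 0) (cz i)).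
have cBz : vcont (fun t => B^T *m z t) by exact: (vcont_mul (A := B^T) cz).
have cBzt : vcont (fun t => B^T *m z (t - tau)) by exact: (vcont_mul (A := B^T) czt).
have [C1 H1] := bdle_sum (index_enum _) (fun j => HK j z f a tau cz cf dz tautb tba).
have [C2 H2] : bdle a (prim (fun t => c0 / (2 * L.+1%:R) * nsq (B^T *m z t)
                           - dot (B^T *m z t) (B^T *m z (t - tau))))
   (fun T => \sum_j prim (fun t => c0 / (2 * L.+1%:R) * ev (row j B^T) (z t) ^+ 2
                           - ev (row j B^T) (z t) * ev (row j B^T) (z (t - tau))) T).
  apply: (bdle_prim (F' := fun t => \sum_j (c0 / (2 * L.+1%:R) * ev (row j B^T) (z t) ^+ 2
                           - ev (row j B^T) (z t) * ev (row j B^T) (z (t - tau))))) => //.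
  - apply: contD; first by apply: contM; [exact: cont_cst | exact: (cont_nsq cBz)].
    by apply: contN; exact: (cont_dot cBz cBzt).
  - move=> t at_; apply: drv_sum => j; apply: drv_prim; last exact: lt_le_trans at_.
    have c1 := cont_ev (b := row j B^T) cz; have c2 := cont_ev (b := row j B^T) czt; cont.
  - move=> t at_; rewrite sumrB -mulr_sumr.
    have E j v : ev (row j B^T) v = (B^T *m v) j 0 by rewrite /ev -row_mul mxE.
    have -> : \sum_j ev (row j B^T) (z t) ^+ 2 = nsq (B^T *m z t).
      by apply: eq_bigr => j _; rewrite E.
    have -> // : \sum_j ev (row j B^T) (z t) * ev (row j B^T) (z (t - tau)) =
        dot (B^T *m z t) (B^T *m z (t - tau)).
    by apply: eq_bigr => j _; rewrite !E.
exists (C1 + C2) => T aT; have := H1 T aT; have := H2 T aT.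
by rewrite -mulr_suml; lra.
Qed.

(** * Smallness of the Riccati solution *)

Section DotProduct.
Context {R : realType}.

Lemma dotE n (u v : 'cV[R]_n) : dot u v = (u^T *m v) 0 0.
Proof. by rewrite mxE; apply: eq_bigr => i _; rewrite mxE. Qed.

Lemma dotC n (u v : 'cV[R]_n) : dot u v = dot v u.
Proof. by apply: eq_bigr => i _; rewrite mulrC. Qed.

Lemma dotDr n (u v w : 'cV[R]_n) : dot u (v + w) = dot u v + dot u w.
Proof. by rewrite !dotE mulmxDr mxE. Qed.

Lemma dotZr n (k : R) (u v : 'cV[R]_n) : dot u (k *: v) = k * dot u v.
Proof. by rewrite !dotE -scalemxAr mxE. Qed.

Lemma dotNr n (u v : 'cV[R]_n) : dot u (- v) = - dot u v.
Proof. by rewrite !dotE mulmxN mxE. Qed.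

Lemma dotDl n (u v w : 'cV[R]_n) : dot (v + w) u = dot v u + dot w u.
Proof. by rewrite dotC dotDr !(dotC u). Qed.

Lemma dotZl n (k : R) (u v : 'cV[R]_n) : dot (k *: v) u = k * dot v u.
Proof. by rewrite dotC dotZr (dotC u). Qed.

Lemma dotNl n (u v : 'cV[R]_n) : dot (- v) u = - dot v u.
Proof. by rewrite dotC dotNr (dotC u). Qed.

Lemma dot_mul m n (u : 'cV[R]_m) (X : 'M[R]_(m, n)) v : dot u (X *m v) = dot (X^T *m u) v.
Proof. by rewrite !dotE trmx_mul trmxK mulmxA. Qed.

Lemma nsq_eq0 n (v : 'cV[R]_n) : nsq v <= 0 -> v = 0.
Proof.
move=> v0; have : nsq v == 0 by rewrite eq_le v0 nsq_ge0.
rewrite psumr_eq0 => [/allP v00|i _]; last exact: sqr_ge0.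
apply/colP => i; rewrite mxE; apply/eqP; rewrite -sqrf_eq0.
by apply: v00; rewrite mem_index_enum.
Qed.

Lemma nsqN n (v : 'cV[R]_n) : nsq (- v) = nsq v.
Proof. by apply: eq_bigr => i _; rewrite mxE sqrrN. Qed.

Lemma nsqZ n k (v : 'cV[R]_n) : nsq (k *: v) = k ^+ 2 * nsq v.
Proof. by rewrite /nsq mulr_sumr; apply: eq_bigr => i _; rewrite mxE exprMn. Qed.

Lemma lin_quad_ge0 (b g : R) : (forall t, 0 <= t * b + t ^+ 2 * g) -> b = 0.
Proof.
move=> H; pose s : R := (`|g| + 1)^-1.
have g1 : 0 < `|g| + 1 by rewrite ltr_wpDl.
have s0 : 0 < s by rewrite invr_gt0.
have sE : s * (`|g| + 1) = 1 by rewrite mulVf ?gt_eqF.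
have := H (- s * b).
have -> : - s * b * b + (- s * b) ^+ 2 * g = - (s * b ^+ 2 * (1 - s * g)) by ring.
rewrite oppr_ge0 pmulr_lle0; last first.
  by rewrite -sE; have := ler_norm g; move=> /(ler_wpM2l (ltW s0)); lra.
rewrite pmulr_rle0// => b2; apply/eqP; rewrite -sqrf_eq0 eq_le b2; exact: sqr_ge0.
Qed.

Lemma psd_kernel n (P : 'M[R]_n) v : P^T = P -> (forall w, 0 <= dot w (P *m w)) ->
  dot v (P *m v) = 0 -> P *m v = 0.
Proof.
move=> Ps P0 Pv.
suff b0 : dot (P *m v) (P *m v) = 0 by apply: nsq_eq0; rewrite nsqE b0.
suff H : 2 * dot (P *m v) (P *m v) = 0 by lra.
apply: (@lin_quad_ge0 _ (dot (P *m v) (P *m (P *m v)))) => t.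
have := P0 (v + t *: (P *m v)).
rewrite mulmxDr -scalemxAr !dotDr !dotDl !dotZr !dotZl Pv.
by rewrite (dot_mul v) Ps; lra.
Qed.

(* The limit equation of the normalised Riccati solutions has no nonzero positive
   semidefinite solution: the row space of [P] is [A]-invariant, so it contains a
   left eigenvector [w = y P] of [A], which turns out to be uncontrollable. *)
Lemma riccati_limit_eq0 n m (A : 'M[R]_n) (B : 'M[R]_(n, m)) (P : 'M[R]_n) (del : R) :
  stabilizable A B -> eig_closed_lhp A -> 0 < del ->
  P^T = P -> (forall v, 0 <= dot v (P *m v)) ->
  (forall v, del * nsq (B^T *m (P *m v)) <= 2 * dot (P *m v) (A *m v)) -> P = 0.
Proof.
move=> [K hK] hA del0 Ps P0 Ric; apply/eqP; apply: contraT => Pn0.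
(* Perturb [y] in the direction [w = P A y]: in [Ric] the term linear in [t] is [2 t |w|^2], all
   others are quadratic, so [w] must vanish. *)
have ker (y : 'cV[R]_n) : P *m y = 0 -> P *m (A *m y) = 0.
  move=> Py; apply: nsq_eq0; rewrite nsqE; set w := P *m (A *m y).
  suff -> : dot w w = 0 by [].
  suff H : 2 * dot w w = 0 by lra.
  apply: (@lin_quad_ge0 _ (2 * dot (P *m w) (A *m w))) => t.
  have := Ric (y + t *: w).
  rewrite [P *m (y + _)]mulmxDr Py add0r -scalemxAr -scalemxAr nsqZ !mulmxDr.
  rewrite -[A *m (t *: w)]scalemxAr dotDr !dotZl dotZr.
  have -> : dot (P *m w) (A *m y) = dot w w by rewrite -{1}Ps -dot_mul.
  have := mulr_ge0 (ltW del0) (mulr_ge0 (sqr_ge0 t) (nsq_ge0 (B^T *m (P *m w)))).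
  by lra.
(* The columns of [cokermx P] span the kernel of [P], so its invariance under [A] becomes invariance
   of the row space. *)
have sub : (P *m A <= P)%MS.
  rewrite submxE; apply/eqP/matrixP => i j.
  have : P *m (A *m col j (cokermx P)) = 0.
    by apply: ker; rewrite colE mulmxA mulmx_coker mul0mx.
  by rewrite colE !mulmxA -colE => /matrixP/(_ i 0); rewrite [LHS]mxE => ->; rewrite !mxE.
pose V := cmx P.
have subV : (V *m cmx A <= V)%MS by rewrite /V /cmx -map_mxM map_submx.
have rV : (0 < \rank V)%N by rewrite lt0n mxrank_eq0 map_mx_eq0.
have /submxP[D DE] : (row_base V *m cmx A <= row_base V)%MS.
  by rewrite (eqmxMr _ (eq_row_base V)) eq_row_base.
have [l /eigenvalueP[u uD un0]] := eigenvalue_closed D rV.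
pose w := u *m row_base V.
have wA : w *m cmx A = l *: w by rewrite /w -mulmxA DE mulmxA uD scalemxAl.
have wn0 : w != 0 by rewrite mulmx_free_eq0 ?row_base_free.
have /submxP[y yE] : (w <= V)%MS.
  by rewrite (submx_trans (submxMl _ _))// eq_row_base.
have lA : complex.Re l <= 0 by apply: hA; apply/eigenvalueP; exists w.
set al := complex.Re l in lA; pose om := complex.Im l.
pose a := (Remx y)^T; pose b := (Immx y)^T.
have aE : P *m a = (Remx w)^T by rewrite yE Remx_mul trmx_mul Ps.
have bE : P *m b = (Immx w)^T by rewrite yE Immx_mul trmx_mul Ps.
have aA : A^T *m (P *m a) = al *: (P *m a) - om *: (P *m b).
  by rewrite aE bE -trmx_mul -Remx_mul wA RemxZ linearB !linearZ.
have bA : A^T *m (P *m b) = om *: (P *m a) + al *: (P *m b).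
  by rewrite aE bE -trmx_mul -Immx_mul wA ImmxZ linearD !linearZ.
have sym u' v' : dot (P *m u') v' = dot (P *m v') u'.
  by rewrite -{1}Ps -dot_mul dotC.
have E : dot (P *m a) (A *m a) + dot (P *m b) (A *m b) =
   al * (dot a (P *m a) + dot b (P *m b)).
  rewrite !(dot_mul _ A) aA bA dotDl dotNl !dotZl dotDl !dotZl.
  by rewrite (sym b a) (dotC a) (dotC b); ring.
have qa := P0 a; have qb := P0 b.
have na := nsq_ge0 (B^T *m (P *m a)); have nb := nsq_ge0 (B^T *m (P *m b)).
have Ra := Ric a; have Rb := Ric b.
have neg : al * (dot a (P *m a) + dot b (P *m b)) <= 0.
  by rewrite mulr_le0_ge0// addr_ge0.
(* [Ric] at [a] and [b] adds up to a nonnegative left side and [2 * al] times a nonnegative form; as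
   [al <= 0], both input terms vanish, that is [w B = 0]. *)
have na0 : nsq (B^T *m (P *m a)) <= 0 by rewrite -(pmulr_rle0 _ del0); nra.
have nb0 : nsq (B^T *m (P *m b)) <= 0 by rewrite -(pmulr_rle0 _ del0); nra.
have wBK : w *m cmx (B *m K) = 0.
  suff [re0 im0] : Remx (w *m cmx (B *m K)) = 0 /\ Immx (w *m cmx (B *m K)) = 0.
    apply/matrixP => i j; move: re0 im0 => /matrixP/(_ i j) + /matrixP/(_ i j).
    by rewrite ![Remx _ _ _]mxE ![Immx _ _ _]mxE; case: (fun_of_matrix _ _ _) => x x' /=; rewrite !mxE => -> ->.
  rewrite Remx_mul Immx_mul !mulmxA; split.
    have -> : Remx w *m B = 0; last by rewrite mul0mx.
    by apply: trmx_inj; rewrite trmx_mul -aE (nsq_eq0 na0) trmx0.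
  have -> : Immx w *m B = 0; last by rewrite mul0mx.
  by apply: trmx_inj; rewrite trmx_mul -bE (nsq_eq0 nb0) trmx0.
(* With [w B = 0], [w] is also a left eigenvector of the Hurwitz matrix [A + B K]. Strict negativity
   of [al] turns the same balance into vanishing of the form at [a] and [b], hence [w = 0]. *)
have al_lt0 : al < 0.
  apply: hK; apply/eigenvalueP; exists w; last exact: wn0.
  have -> : cmx (A + B *m K) = cmx A + cmx (B *m K).
    by apply/matrixP => i j; rewrite !mxE /= rmorphD.
  by rewrite mulmxDr wBK addr0.
have pos : 0 <= al * (dot a (P *m a) + dot b (P *m b)) by nra.
have qab : dot a (P *m a) + dot b (P *m b) <= 0 by rewrite -(nmulr_rge0 _ al_lt0).
have Pa : P *m a = 0 by apply: psd_kernel => //; lra.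
have Pb : P *m b = 0 by apply: psd_kernel => //; lra.
case/negP: wn0; apply/eqP/matrixP => i j.
have re0 : complex.Re (w i j) = 0.
  by have := congr1 (fun X : 'cV[R]_n => X j i) Pa; rewrite aE [LHS]mxE [LHS]mxE [RHS]mxE.
have im0 : complex.Im (w i j) = 0.
  by have := congr1 (fun X : 'cV[R]_n => X j i) Pb; rewrite bE [LHS]mxE [LHS]mxE [RHS]mxE.
by rewrite [RHS]mxE; case: (w i j) re0 im0 => x x' /= -> ->.
Qed.

End DotProduct.

Section LowGain.
Context {R : realType}.

(** Along an ultrafilter all entries of a bounded sequence of matrices converge at once, without
    successive extraction of subsequences. *)
Lemma ultra_bounded_cvg (U : set_system nat) (u : nat -> R) :
  UltraFilter U -> (forall k, `|u k| <= 1) -> exists l : R, u @ U --> l.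
Proof.
move=> UU u1.
have FU : U (u @^-1` [set` `[-1, 1]%R]).
  by apply: filterE => k /=; rewrite in_itv /= -ler_norml u1.
have [l [_ cl]] := @segment_compact R (-1) 1 (u @ U) _ FU.
exists l => V Vl.
have [//|nV] := in_ultra_setVsetC (u @^-1` V) UU.
by have [x [/= Vx]] := cl (~` V) V nV Vl.
Qed.

Lemma cvg_bigsum (T : Type) (F : set_system T) (I : Type) (l : seq I)
    (u : I -> T -> R) (v : I -> R) : ProperFilter F ->
  (forall i, u i @ F --> v i) ->
  (fun k => \sum_(i <- l) u i k) @ F --> \sum_(i <- l) v i.
Proof.
move=> FF uv; elim: l => [|i l IH].
  by rewrite big_nil; under eq_fun do rewrite big_nil; exact: cvg_cst.
by rewrite big_cons; under eq_fun do rewrite big_cons; exact: cvgD.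
Qed.

Lemma cvg_mulmx (T : Type) (F : set_system T) n p (u : T -> 'M[R]_n) (v : 'M[R]_n)
    (y : 'M[R]_(n, p)) : ProperFilter F ->
  (forall i j, (fun k => u k i j) @ F --> v i j) ->
  forall i j, (fun k => (u k *m y) i j) @ F --> (v *m y) i j.
Proof.
move=> FF uv i j; rewrite mxE; under eq_fun do rewrite mxE.
by apply: cvg_bigsum => k; apply: cvgM; [exact: uv | exact: cvg_cst].
Qed.

Lemma dot_delta n (i : 'I_n) (v : 'cV[R]_n) : dot (delta_mx i 0) v = v i 0.
Proof.
rewrite /dot (bigD1 i)//= big1 ?addr0 ?mxE ?eqxx ?mul1r// => j ji.
by rewrite mxE (negbTE ji) mul0r.
Qed.

Lemma mul_delta n (P : 'M[R]_n) i j : (P *m delta_mx j (0 : 'I_1)) i 0 = P i j.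
Proof. by rewrite -colE mxE. Qed.

Lemma psd_entry_le n (P : 'M[R]_n) i j : P^T = P -> (forall v, 0 <= dot v (P *m v)) ->
  `|P i j| <= \tr P.
Proof.
move=> Ps P0.
have Pii k : 0 <= P k k by have := P0 (delta_mx k 0); rewrite dot_delta mul_delta.
have Ptr k : P k k <= \tr P.
  by rewrite /mxtrace (bigD1 k)//= lerDl sumr_ge0.
have Pji : P j i = P i j by rewrite -{1}Ps mxE.
have q s : 0 <= P i i + 2 * s * P i j + s ^+ 2 * P j j.
  have := P0 (delta_mx i 0 + s *: delta_mx j 0).
  rewrite mulmxDr -scalemxAr !dotDr !dotDl !dotZr !dotZl !dot_delta !mul_delta Pji.
  by lra.
have := q 1; have := q (-1); have := Ptr i; have := Ptr j.
by rewrite ler_norml; lra.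
Qed.

Lemma psd_dot_le n (P : 'M[R]_n) v : P^T = P -> (forall v, 0 <= dot v (P *m v)) ->
  dot v (P *m v) <= n%:R * \tr P * nsq v.
Proof.
move=> Ps P0.
have -> : n%:R * \tr P * nsq v = \sum_(i < n) \sum_(j < n) \tr P * ((v i 0 ^+ 2 + v j 0 ^+ 2) / 2).
  have cst x : \sum_(j < n) x = n%:R * x :> R by rewrite sumr_const card_ord mulr_natl.
  transitivity (\tr P * (\sum_(i < n) \sum_(j < n) (v i 0 ^+ 2 / 2)
                         + \sum_(i < n) \sum_(j < n) (v j 0 ^+ 2 / 2))).
    rewrite cst (eq_bigr _ (fun i _ => cst _)) -mulr_sumr -mulr_suml -/(nsq v); lra.
  rewrite -big_split mulr_sumr; apply: eq_bigr => i _ /=.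
  rewrite -big_split mulr_sumr; apply: eq_bigr => j _ /=; lra.
rewrite /dot; apply: ler_sum => i _; rewrite mxE mulr_sumr; apply: ler_sum => j _.
have := psd_entry_le i j Ps P0; have tr0 := le_trans (normr_ge0 _) (psd_entry_le i j Ps P0).
rewrite ler_norml => /andP[p1 p2].
have : `|v i 0 * v j 0| <= (v i 0 ^+ 2 + v j 0 ^+ 2) / 2.
  by rewrite ler_norml; have := sqr_ge0 (v i 0 - v j 0); have := sqr_ge0 (v i 0 + v j 0); lra.
move=> h; apply: le_trans (ler_norm _) _.
rewrite mulrCA normrM; apply: ler_pM => //.
by rewrite ler_norml p1.
Qed.

(** Expanding the form at [v - c^-1 P v] takes the place of a square root of [P]. *)
Lemma psd_nsq_le n (P : 'M[R]_n) (c : R) v : P^T = P -> 0 < c ->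
  (forall v, 0 <= dot v (P *m v)) -> (forall w, dot w (P *m w) <= c * nsq w) ->
  nsq (P *m v) <= c * dot v (P *m v).
Proof.
move=> Ps c0 P0 Pc; set w := P *m v.
have := Pc w; have := P0 (v - c^-1 *: w).
rewrite mulmxDr mulmxN -scalemxAr -/w.
rewrite !dotDr !dotDl !dotNr !dotNl !dotZr !dotZl -/(nsq w).
have E : dot v (P *m w) = nsq w by rewrite dot_mul Ps.
have cV : 0 < c^-1 by rewrite invr_gt0.
have cE : c^-1 * c = 1 by rewrite mulVf ?gt_eqF.
move=> V W; rewrite -(ler_pM2l cV) mulrA cE mul1r.
have := ler_wpM2l (mulr_ge0 (ltW cV) (ltW cV)) W; rewrite -[X in _ <= X]mulrA (mulrA c^-1 c) cE mul1r.
by move: V; rewrite E -nsqE; lra.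
Qed.

Lemma riccati_dot n m (A : 'M[R]_n) (B : 'M[R]_(n, m)) (P : 'M[R]_n) (eps : R) v :
  P^T = P -> A^T *m P + P *m A - P *m B *m B^T *m P + eps%:M = 0 ->
  2 * dot (P *m v) (A *m v) = nsq (B^T *m (P *m v)) - eps * nsq v.
Proof.
move=> Ps ric.
have := congr1 (fun X => dot v (X *m v)) ric.
rewrite mul0mx !mulmxDl mulNmx !dotDr dotNr -!mulmxA.
rewrite (dot_mul v A^T) trmxK (dot_mul v P) Ps (dot_mul v P) Ps (dot_mul _ B) mul_scalar_mx dotZr.
rewrite -!nsqE (dotC (A *m v)).
have -> : dot v 0 = 0 :> R by rewrite -[X in dot _ X](scale0r v) dotZr mul0r.
by lra.
Qed.

(** By contradiction, from solutions with [eps <= 1 / (k + 1)] and trace above [del]. Division by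
    the trace gives the limit trace 1, so it is nonzero, and leaves the trace as a factor of the
    quadratic term; bounding it below by [del] keeps that term alive in the limit. *)
Lemma riccati_trace_small n m (A : 'M[R]_n) (B : 'M[R]_(n, m)) (del : R) :
  stabilizable A B -> eig_closed_lhp A -> 0 < del ->
  exists2 eps_star : R, 0 < eps_star & forall (eps : R) (P : 'M[R]_n),
    0 < eps <= eps_star -> posdef P ->
    A^T *m P + P *m A - P *m B *m B^T *m P + eps%:M = 0 -> \tr P <= del.
Proof.
move=> stab lhp del0; apply: contrapT => H.
have /choice[eP ePE] : forall k : nat, exists eP : R * 'M[R]_n,
    [/\ 0 < eP.1 <= k.+1%:R^-1, posdef eP.2,
    A^T *m eP.2 + eP.2 *m A - eP.2 *m B *m B^T *m eP.2 + eP.1%:M = 0 & del < \tr eP.2].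
  move=> k; apply: contrapT => Hk; apply: H; exists k.+1%:R^-1.
    by rewrite invr_gt0.
  move=> eps P epsk pP ric; rewrite leNgt; apply/negP => trP.
  by apply: Hk; exists (eps, P).
pose tr k := \tr (eP k).2.
have tr0 k : 0 < tr k by have [_ _ _] := ePE k; exact: lt_trans.
pose Pi k : 'M[R]_n := (tr k)^-1 *: (eP k).2.
have Pis k : (Pi k)^T = Pi k by rewrite /Pi linearZ /=; have [_ [-> _] _ _] := ePE k.
have Pi0 k v : 0 <= dot v (Pi k *m v).
  rewrite -scalemxAl dotZr; apply: mulr_ge0; first by rewrite invr_ge0 ltW.
  have [_ [_ pd] _ _] := ePE k.
  have [->|v0] := eqVneq v 0; first by rewrite mulmx0; exact: nsq_ge0.
  by rewrite dotE mulmxA ltW// pd.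
have trPi k : \tr (Pi k) = 1 by rewrite linearZ /= -/(tr k) mulVf ?gt_eqF.
have [U [UU ooU]] := ultraFilterLemma eventually_filter.
have lims i j : exists l : R, (fun k => Pi k i j) @ U --> l.
  by apply: ultra_bounded_cvg => // k; rewrite -(trPi k); exact: psd_entry_le.
have /choice[L0 HL0] : forall ij : 'I_n * 'I_n, exists l : R, (fun k => Pi k ij.1 ij.2) @ U --> l.
  by move=> ij; exact: lims.
pose L : 'M[R]_n := \matrix_(i, j) L0 (i, j).
have HL i j : (fun k => Pi k i j) @ U --> L i j by rewrite mxE; exact: HL0 (i, j).
have HLv p (y : 'M[R]_(n, p)) i j : (fun k => (Pi k *m y) i j) @ U --> (L *m y) i j.
  exact: cvg_mulmx.
have cdot p (u : nat -> 'cV[R]_p) (u' : 'cV[R]_p) (w : 'cV[R]_p) :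
    (forall i, (fun k => u k i 0) @ U --> u' i 0) ->
    (fun k => dot (u k) w) @ U --> dot u' w.
  move=> uu; apply: cvg_bigsum => i; apply: cvgM; [exact: uu | exact: cvg_cst].
have ge0 (f : nat -> R) (l : R) : f @ U --> l -> (forall k, 0 <= f k) -> 0 <= l.
  move=> fl f0; apply: (@closed_cvg _ _ U _ f (fun x => 0 <= x)) fl.
    exact: closed_ge.
  exact: nearW.
suff L00 : L = 0.
  have : (fun k => \tr (Pi k)) @ U --> \tr L.
    by rewrite /mxtrace; apply: cvg_bigsum => i; exact: HL.
  rewrite L00 mxtrace0; under eq_fun do rewrite trPi.
  move=> cL; have c1 : (fun=> 1 : R) @ U --> (1 : R) by exact: cvg_cst.
  have e : 0 = 1 :> R by apply: norm_cvg_unique cL c1.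
  by move/eqP: e; rewrite eq_sym oner_eq0.
apply: (@riccati_limit_eq0 _ _ _ A B L del) => //.
- apply/matrixP => i j; rewrite mxE.
  suff cji : (fun k => Pi k i j) @ U --> L j i by apply: norm_cvg_unique cji (HL i j).
  rewrite (_ : (fun k => _) = (fun k => Pi k j i)); first exact: HL.
  by apply/funext => k; rewrite -{1}(Pis k) mxE.
- move=> v; apply: (ge0 (fun k => dot v (Pi k *m v))) => //.
  rewrite dotC; under eq_fun do rewrite dotC; apply: cdot => i; exact: HLv.
- move=> v.
  pose f k := 2 * dot (Pi k *m v) (A *m v) - del * nsq (B^T *m (Pi k *m v)).
  have fl : f @ U --> 2 * dot (L *m v) (A *m v) - del * nsq (B^T *m (L *m v)).
    apply: cvgB; apply: cvgM; try exact: cvg_cst.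
      by apply: cdot => i; exact: HLv.
    apply: cvg_bigsum => i; apply: cvgM;
      (rewrite mxE; under eq_fun do rewrite mxE; apply: cvg_bigsum => j;
       apply: cvgM; [exact: cvg_cst | exact: HLv]).
  (* The [eps] term divided by the trace is at most this, and disappears in the limit. *)
  have gl : (fun k => del^-1 * harmonic k * nsq v) @ U --> del^-1 * 0 * nsq v.
    apply: cvgM; last exact: cvg_cst.
    by apply: cvgM; [exact: cvg_cst | move=> V /(@cvg_harmonic R); exact: ooU].
  suff : 0 <= 2 * dot (L *m v) (A *m v) - del * nsq (B^T *m (L *m v)) + del^-1 * 0 * nsq v.
    by rewrite mulr0 mul0r addr0 subr_ge0.
  apply: (ge0 (fun k => f k + del^-1 * harmonic k * nsq v)); first exact: cvgD.
  move=> k; rewrite /f.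
  have [/andP[e0 ek] [Ps _] ric trk] := ePE k.
  have := riccati_dot v Ps ric; rewrite /Pi -scalemxAl -scalemxAr dotZl nsqZ.
  move: trk; rewrite -/(tr k) => trk.
  have it0 : 0 < (tr k)^-1 by rewrite invr_gt0.
  have dV : (tr k)^-1 <= del^-1 by rewrite lef_pV2 ?posrE// ltW.
  have dt : 0 <= 1 - del * (tr k)^-1 by rewrite subr_ge0 ler_pdivrMr// mul1r ltW.
  have v0 := nsq_ge0 v; have n0 := nsq_ge0 (B^T *m ((eP k).2 *m v)).
  have h1 : (tr k)^-1 * (eP k).1 * nsq v <= del^-1 * harmonic k * nsq v.
    by rewrite ler_wpM2r// ler_pM// ltW.
  have := mulr_ge0 (mulr_ge0 (ltW it0) n0) dt.
  move: h1; move: (tr k)^-1 (del^-1 * harmonic k * nsq v) => it g.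
  by move: (dot _ _) (nsq (B^T *m _)) (nsq v) => d1 d2 d3 *; nra.
Qed.

Lemma posdef_ge0 n (P : 'M[R]_n) v : posdef P -> 0 <= dot v (P *m v).
Proof.
move=> [_ pd]; have [->|v0] := eqVneq v 0; first by rewrite mulmx0; exact: nsq_ge0.
by rewrite dotE mulmxA ltW// pd.
Qed.

Lemma riccati_small n m (A : 'M[R]_n) (B : 'M[R]_(n, m)) (del : R) :
  stabilizable A B -> eig_closed_lhp A -> 0 < del ->
  exists2 eps_star : R, 0 < eps_star & forall (eps : R) (P : 'M[R]_n),
    0 < eps <= eps_star -> posdef P ->
    A^T *m P + P *m A - P *m B *m B^T *m P + eps%:M = 0 ->
    forall w, dot w (P *m w) <= del * nsq w.
Proof.
move=> stab lhp del0.
have dn : 0 < del / n.+1%:R by rewrite divr_gt0.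
have [es es0 H] := riccati_trace_small stab lhp dn.
exists es => // eps P epsP pP ric w.
have P0 v : 0 <= dot v (P *m v) by exact: posdef_ge0.
apply: le_trans (psd_dot_le _ pP.1 P0) _; rewrite ler_wpM2r ?nsq_ge0//.
apply: (@le_trans _ _ (n%:R * (del / n.+1%:R))); first by rewrite ler_wpM2l// (H eps).
by rewrite mulrCA ler_piMr ?ltW// ltr_pdivrMr// mul1r ltr_nat.
Qed.

End LowGain.

(** * The low-gain delayed loop *)

Section Norms.
Context {R : realType}.

(** The squared Frobenius norm. *)
Definition mxb m n (X : 'M[R]_(m, n)) : R := \sum_i nsq (row i X)^T.

Lemma mxb_ge0 m n (X : 'M[R]_(m, n)) : 0 <= mxb X.
Proof. by apply: sumr_ge0 => i _; exact: nsq_ge0. Qed.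

Lemma nsq_mul_le m n (X : 'M[R]_(m, n)) v : nsq (X *m v) <= mxb X * nsq v.
Proof.
rewrite /mxb mulr_suml; apply: ler_sum => i _.
by have := ev_sqr_le (row i X) v; rewrite /ev -row_mul mxE.
Qed.

Lemma nsqD_le n (u v : 'cV[R]_n) : nsq (u + v) <= 2 * nsq u + 2 * nsq v.
Proof.
rewrite /nsq !mulr_sumr -big_split; apply: ler_sum => i _ /=; rewrite mxE.
by have := sqr_ge0 (u i 0 - v i 0); lra.
Qed.

Lemma dot_young n (k : R) (u v : 'cV[R]_n) : 0 < k ->
  `|2 * dot u v| <= k * nsq u + k^-1 * nsq v.
Proof.
move=> k0; rewrite /dot /nsq !mulr_sumr -big_split; apply: le_trans (ler_norm_sum _ _ _) _.
by apply: ler_sum => i _; exact: young.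
Qed.

(** With the derivative bounded above only, a value over [e] at time [T] forces [h >= e / 2] on the
    interval of length [e / (2 * D)] before [T]. Its contribution to the integral exceeds what is
    left of the total beyond [T1]. *)
Lemma barbalat (h h' : R -> R) (a C D : R) : 0 < a -> continuous h -> (forall t, 0 <= h t) ->
  (forall t, a <= t -> has_deriv t h (h' t)) -> (forall t, a <= t -> h' t <= D) -> 0 < D ->
  (forall T, a <= T -> prim h T <= C) ->
  forall e : R, 0 < e -> exists2 T0, a <= T0 & forall T, T0 <= T -> h T <= e.
Proof.
move=> a0 ch h0 dh hD D0 hC e e0.
pose eta := e / (2 * D); have eta0 : 0 < eta by rewrite divr_gt0// mulr_gt0.
have etaD : eta * D = e / 2 by rewrite /eta; field; rewrite gt_eqF.
have nd s t : a <= s -> s <= t -> prim h s <= prim h t.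
  by move=> as_; apply: prim_ndecr => //; exact: lt_le_trans as_.
pose S := [set x | exists2 T, a <= T & x = prim h T].
have S0 : S !=set0 by exists (prim h a), a.
have Sub : has_ubound S by exists C => x [T aT ->]; exact: hC.
have hS : has_sup S by [].
have gap : 0 < eta * (e / 2) by rewrite mulr_gt0// divr_gt0.
have [_ [T1 aT1 ->] supT1] := sup_adherent gap hS.
exists (T1 + eta); first by lra.
move=> T T1T; rewrite leNgt; apply/negP => eT.
have T1T' : a <= T - eta by lra.
have inc : prim h T - prim h (T - eta) < eta * (e / 2).
  have : prim h T <= sup S by apply: ub_le_sup => //; exists T => //; lra.
  by have := nd T1 (T - eta) aT1; lra.
have hs s : T - eta <= s <= T -> e / 2 <= h s.
  move=> /andP[s1 s2].
  have : h T - h s <= D * T - D * s.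
    apply: (@le_drv R h (fun t => D * t) h' (fun=> D * 1) s T s2) => t /andP[st tT].
    - by apply: dh; lra.
    - by apply: drvZ; exact: drv_id.
    - by rewrite mulr1; apply: hD; lra.
  have : D * (T - s) <= D * eta by apply: ler_wpM2l; [exact: ltW | lra].
  by lra.
have le1 : T - eta <= T by lra.
have : e / 2 * T - e / 2 * (T - eta) <= prim h T - prim h (T - eta).
  apply: (@le_drv R (fun t => e / 2 * t) (prim h) (fun=> e / 2 * 1) h (T - eta) T le1) => t.
  - by move=> _; apply: drvZ; exact: drv_id.
  - by move=> /andP[t1 _]; apply: drv_prim => //; lra.
  - by rewrite mulr1; exact: hs.
by lra.
Qed.

End Norms.

(** * Imaginary eigenvalues and the phase margin *)

Lemma eigenvalue_unit (F : fieldType) n (A : 'M[F]_n) l :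
  eigenvalue A l = ~~ (A - l%:M \in unitmx).
Proof. by rewrite /eigenvalue /eigenspace kermx_eq0 row_free_unit. Qed.

Lemma eigenvalue_trmx (F : fieldType) n (A : 'M[F]_n) l :
  eigenvalue A^T l = eigenvalue A l.
Proof. by rewrite !eigenvalue_unit -[in RHS]unitmx_tr linearB /= tr_scalar_mx. Qed.

Lemma eigenvalue_opp (F : fieldType) n (A : 'M[F]_n) l :
  eigenvalue (- A) l = eigenvalue A (- l).
Proof.
by apply/eigenvalueP/eigenvalueP => -[v vA v0]; exists v => //; move: vA;
  rewrite mulmxN scaleNr => /(congr1 (fun x => - x)); rewrite !opprK.
Qed.

Lemma eigenvalue_det (F : fieldType) n (A : 'M[F]_n) l :
  eigenvalue A l = (\det (l%:M - A) == 0).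
Proof.
rewrite eigenvalue_unit unitmxE unitfE negbK -[A - _]opprB -scaleN1r detZ mulf_eq0.
by rewrite signr_eq0.
Qed.

Section ClosedLeftHalfPlane.
Context {R : realType}.
Variables (n : nat) (A : 'M[R]_n).

Lemma cmxN (X : 'M[R]_n) : cmx (- X) = - cmx X.
Proof. by apply/matrixP => i j; rewrite !mxE /= rmorphN. Qed.

Lemma cmx_tr (X : 'M[R]_n) : cmx X^T = (cmx X)^T.
Proof. by apply/matrixP => i j; rewrite !mxE. Qed.

Lemma eigenvalue_conj (x y : R) :
  eigenvalue (cmx A) (Complex x y) -> eigenvalue (cmx A) (Complex x (- y)).
Proof.
move=> /eigenvalueP[v vA v0]; apply/eigenvalueP.
exists (map_mx (fun z : R[i] => Complex (complex.Re z) (- complex.Im z)) v).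
  have re := congr1 (@Remx R 1 n) vA; have im := congr1 (@Immx R 1 n) vA.
  rewrite Remx_mul RemxZ in re; rewrite Immx_mul ImmxZ in im.
  set w := map_mx _ v.
  have rw : Remx w = Remx v by apply/matrixP => i j; rewrite !mxE.
  have iw : Immx w = - Immx v by apply/matrixP => i j; rewrite !mxE.
  have reE : Remx (w *m cmx A) = Remx (Complex x (- y) *: w).
    by rewrite Remx_mul RemxZ rw iw /= re scalerN scaleNr opprK.
  have imE : Immx (w *m cmx A) = Immx (Complex x (- y) *: w).
    by rewrite Immx_mul ImmxZ rw iw /= mulNmx im scalerN scaleNr opprD.
  apply/matrixP => i j.
  move: reE imE => /matrixP/(_ i j) + /matrixP/(_ i j).
  rewrite [LHS]mxE [RHS]mxE => re' ; rewrite [LHS]mxE [RHS]mxE => im'.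
  by apply/eqP; rewrite eq_complex re' im' !eqxx.
apply: contra_neq v0 => w0; apply/matrixP => i j.
have := congr1 (fun X : 'rV[R[i]]_n => X i j) w0; rewrite !mxE.
by case: (v i j) => a b [-> /eqP]; rewrite oppr_eq0 => /eqP ->.
Qed.

(** The supremum runs over signed frequencies; conjugate eigenvalues of the real matrix give the
    bound for [- w]. The set is bounded, its members being imaginary parts of roots of the
    characteristic polynomial. *)
Lemma omega_max_ge (w : R) : eigenvalue (cmx A) (Complex 0 w) -> `|w| <= omega_max A.
Proof.
move=> wA; have wA' := eigenvalue_conj wA; rewrite /omega_max.
case: asboolP => [/(_ _ wA)|_]; first by rewrite /= ltxx.
set S := [set x | _].
have inS x : eigenvalue (cmx A) (Complex 0 x) -> S x by rewrite eigenvalue_det => /eqP.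
suff Sb : has_ubound S.
  have w1 := ub_le_sup Sb (inS _ wA); have w2 := ub_le_sup Sb (inS _ wA').
  by rewrite ler_norml; move: (sup S) w1 w2 => s *; lra.
have [rs] := closed_field_poly_normal (char_poly (cmx A)).
rewrite (monicP (char_poly_monic _)) scale1r => chE.
exists (\sum_(z <- rs) `|complex.Im z|) => x /eqP Sx.
have : eigenvalue (cmx A) (Complex 0 x) by rewrite eigenvalue_det.
rewrite eigenvalue_root_char chE root_prod_XsubC => xrs.
rewrite (big_rem _ xrs) /=; apply: (le_trans (ler_norm x)).
by rewrite lerDl sumr_ge0.
Qed.

Lemma omega_max_ge0 : eig_closed_lhp A -> 0 <= omega_max A.
Proof.
move=> lhp; case: (pselect (hurwitz A)) => [h|nh].
  by rewrite /omega_max; case: asboolP.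
have [l lA l0] : exists2 l, eigenvalue (cmx A) l & 0 <= complex.Re l.
  apply: contrapT => H; apply: nh => l lA; rewrite ltNge; apply/negP => l0.
  by apply: H; exists l.
have lE : l = Complex 0 (complex.Im l).
  have := lhp _ lA; case: l l0 {lA} => x y /= x0 x0'.
  by congr Complex; apply/eqP; rewrite eq_le x0 x0'.
rewrite lE in lA; exact: le_trans (normr_ge0 _) (omega_max_ge lA).
Qed.

(** The cosine is even and decreasing on [[0, pi]], so the worst phase is [taubar * omega_max A].
    Passing to [- A^T] negates the frequencies, which conjugation undoes. *)
Lemma cos_omega_max taubar : eig_closed_lhp A -> 0 <= taubar ->
  taubar * omega_max A < pi / 2 -> 0 < cos (taubar * omega_max A) /\
  forall w, eigenvalue (cmx (- A^T)) (Complex 0 w) ->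
    forall tau, 0 <= tau <= taubar -> cos (taubar * omega_max A) <= cos (w * tau).
Proof.
move=> lhp tb0 small; have om0 := omega_max_ge0 lhp.
have tom0 : 0 <= taubar * omega_max A by exact: mulr_ge0.
have pi0 := pi_gt0 R.
split; first by apply: cos_gt0_pihalf; rewrite small andbT; lra.
move=> w; rewrite cmxN cmx_tr eigenvalue_opp eigenvalue_trmx => wA tau /andP[tau0 taub].
have {wA} : eigenvalue (cmx A) (Complex 0 w).
  by rewrite -[w]opprK; apply: eigenvalue_conj; move: wA; rewrite /GRing.opp /= oppr0.
move=> /omega_max_ge wom.
have wtau : `|w * tau| <= taubar * omega_max A.
  by rewrite normrM (ger0_norm tau0) mulrC ler_pM.
have -> : cos (w * tau) = cos `|w * tau|.
  by case: (ger0P (w * tau)) => // _; rewrite cosN.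
have [e|ne] := eqVneq `|w * tau| (taubar * omega_max A); first by rewrite e.
apply/ltW; rewrite ltr_cos ?in_itv /= ?normr_ge0 ?tom0 /=; lra.
Qed.

End ClosedLeftHalfPlane.

Section ColumnEntries.
Context {R : realType}.
Variables (n : nat) (u v : 'cV[R]_n) (k : R) (i : 'I_n).

Lemma cVD : (u + v) i 0 = u i 0 + v i 0. Proof. by rewrite mxE. Qed.
Lemma cVN : (- u) i 0 = - u i 0. Proof. by rewrite mxE. Qed.
Lemma cVZ : (k *: u) i 0 = k * u i 0. Proof. by rewrite mxE. Qed.

End ColumnEntries.

(** The differential inequality with its signals abstracted: [nv = |v|^2], [d = v . v(t - tau)],
    [nx = |chi|^2], [dg = z . g], [ie = eps^-1]. *)
Lemma energy_rate_arith (R : realFieldType) (rho kappa eps ie nv d nx ng nPg dg : R) :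
  1 * nv <= rho * kappa * nv -> 2 * dg <= eps / 2 * nx + 2 * ie * nPg ->
  ie * nPg <= ie * ng ->
  nv - eps * nx - 2 * (rho * d) + 2 * dg <=
  2 * rho * (kappa * nv - d) + - 1 * nv + - (eps / 2) * nx + 2 * ie * ng.
Proof. by move=> *; lra. Qed.

(** The integrated balance: [F], [Pv], [Pvt], [Px], [Pg] are the primitives of the squared norms of
    [f], [v], delayed [v], [chi] and [g], [cr] that of the correlation deficit, [V] the energy and
    [z] the boundary term [|P chi|^2]. *)
Lemma energy_total_arith (R : realFieldType)
    (rho K D k1 k2 k3 c eps ie C1 C2 C3 Cg cr F Pv Pvt Px Pg V z : R) : D = 2 * rho * K ->
  0 <= 2 * rho * (K * (F + z) + C1 - cr) ->
  0 <= D * (k1 * Pv + k2 * Pvt + k3 * Px + 2 * Pg + C3 - F) ->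
  V <= 2 * rho * cr + - 1 * Pv + - (eps / 2) * Px + 2 * ie * Pg + C2 ->
  D * k2 * Pvt <= D * k2 * Pv -> D * (k1 + k2) * Pv <= 1 * Pv ->
  D * k3 * Px <= eps / 4 * Px -> (D * 2 + 2 * ie) * Pg <= (D * 2 + 2 * ie) * Cg ->
  D * z <= D * (c * V) -> D * c * V <= 1 / 2 * V ->
  V / 2 + eps / 4 * Px <= C2 + 2 * rho * C1 + D * C3 + (D * 2 + 2 * ie) * Cg.
Proof. by move=> -> *; lra. Qed.

Section Energy.
Context {R : realType}.
Variables (n m : nat) (A : 'M[R]_n) (B : 'M[R]_(n, m)) (taubar : R).
Implicit Types (chi g z f : R -> 'cV[R]_n) (P : 'M[R]_n).

Definition closed_loop (rho tau : R) P chi g := forall t : R, 0 < t ->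
  vderiv t chi (A *m chi t - rho *: (B *m (B^T *m (P *m chi (t - tau)))) + g t).

(** The Riccati equation trades [P A] for [- A^T P]; its other terms, the delayed feedback and [g]
    all go into the forcing. *)
Lemma vderiv_costate rho eps tau P chi g : P^T = P ->
  A^T *m P + P *m A - P *m B *m B^T *m P + eps%:M = 0 -> closed_loop rho tau P chi g ->
  forall t : R, 0 < t -> vderiv t (fun t => P *m chi t)
    ((- A^T) *m (P *m chi t) +
     (P *m (B *m (B^T *m (P *m chi t) - rho *: (B^T *m (P *m chi (t - tau)))))
      - eps *: chi t + P *m g t)).
Proof.
move=> Ps ric loop t t0; have := vderiv_mul P (loop t t0); congr vderiv.
have := congr1 (fun X => X *m chi t) ric.
rewrite mul0mx !mulmxDl mulNmx -!mulmxA mul_scalar_mx => E.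
rewrite !mulmxDr !mulmxN mulNmx -!scalemxAr.
move: (A^T *m _) (P *m (A *m _)) (P *m (B *m (B^T *m (P *m chi t)))) (eps *: _) E
  (rho *: _) (P *m g t) => a b c d E x y.
by apply/colP => i; have := congr1 (fun X : 'cV[R]_n => X i 0) E; rewrite !mxE; lra.
Qed.

Lemma psd_nsq_le2 P (c : R) v : P^T = P -> 0 < c ->
  (forall v, 0 <= dot v (P *m v)) -> (forall w, dot w (P *m w) <= c * nsq w) ->
  nsq (P *m v) <= c ^+ 2 * nsq v.
Proof.
move=> Ps c0 P0 Pc; apply: le_trans (psd_nsq_le v Ps c0 P0 Pc) _.
by rewrite expr2 -mulrA ler_pM2l.
Qed.

Variables (kappa K rho c eps : R).
Hypothesis K0 : 0 <= K.
Hypothesis corr : forall z f (a tau : R), vcont z -> vcont f ->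
    (forall t : R, 0 < t -> vderiv t z ((- A^T) *m z t + f t)) ->
    0 <= tau <= taubar -> taubar < a ->
    bdle a (prim (fun t => kappa * nsq (B^T *m z t)
                           - dot (B^T *m z t) (B^T *m z (t - tau))))
           (fun T => K * (prim (fun t => nsq (f t)) T + nsq (z T))).
Hypothesis rho_kappa : 1 <= rho * kappa.
Hypothesis rho0 : 0 < rho.
Hypothesis c0 : 0 < c.
Hypothesis c1 : c <= 1.
Hypothesis eps0 : 0 < eps.
(** Three absorptions of what the correlation estimate costs: [h1] puts the boundary term into half
    of the energy, [h2] the part of [f] made of [v] into [- |v|^2], [h3] the part [eps chi] into
    half of the available [eps / 2 * |chi|^2]. *)
Hypothesis h1 : 2 * rho * K * c <= 1 / 2.
Hypothesis h2 : 2 * rho * K * (8 * c ^+ 2 * mxb B * (1 + rho ^+ 2)) <= 1.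
Hypothesis h3 : 2 * rho * K * (4 * eps ^+ 2) <= eps / 4.

(** Since [rho * kappa >= 1], [|v|^2 - 2 rho v . v(t - tau)] is at most [- |v|^2] plus [2 rho] times
    the deficit [kappa |v|^2 - v . v(t - tau)], whose integral the correlation estimate bounds. *)
Lemma energy_bound P chi g (tau a Cg : R) :
  P^T = P -> (forall v, 0 <= dot v (P *m v)) -> (forall w, dot w (P *m w) <= c * nsq w) ->
  A^T *m P + P *m A - P *m B *m B^T *m P + eps%:M = 0 ->
  vcont chi -> vcont g -> closed_loop rho tau P chi g ->
  0 <= tau <= taubar -> taubar < a ->
  (forall T, a <= T -> prim (fun t => nsq (g t)) T <= Cg) ->
  exists C, forall T, a <= T ->
    dot (chi T) (P *m chi T) <= C /\ prim (fun t => nsq (chi t)) T <= C.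
Proof.
move=> Ps P0 Pc ric cchi cg loop tautb tba gC.
have [tau0 tauta] := andP tautb.
have a0 : 0 < a by lra.
have cz : vcont (fun t => P *m chi t) by exact: (vcont_mul (A := P) cchi).
pose v t := B^T *m (P *m chi t).
have cv : vcont v by exact: (vcont_mul (A := B^T) cz).
have cvt : vcont (fun t => v (t - tau)).
  by move=> i; exact: (cont_shift (f := fun s => v s i 0) (cv i)).
pose f t := P *m (B *m (v t - rho *: v (t - tau))) - eps *: chi t + P *m g t.
have cf : vcont f.
  have c3 : vcont (fun t => v t - rho *: v (t - tau)).
    move=> i; have -> : (fun s => (v s - rho *: v (s - tau)) i 0) =
        (fun s => v s i 0 - rho * v (s - tau) i 0).
      by apply/funext => s; rewrite cVD cVN cVZ.
    apply: contD; first exact: (cv i).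
    by apply: contN; apply: contM; [exact: cont_cst | exact: (cvt i)].
  have c4 := vcont_mul (A := P) (vcont_mul (A := B) c3).
  have c5 := vcont_mul (A := P) cg.
  move=> i; rewrite /f.
  have -> : (fun s => (P *m (B *m (v s - rho *: v (s - tau))) - eps *: chi s + P *m g s) i 0)
    = (fun s => (P *m (B *m (v s - rho *: v (s - tau)))) i 0 - eps * chi s i 0 + (P *m g s) i 0).
    by apply/funext => s; rewrite !cVD cVN cVZ.
  apply: contD; last exact: c5.
  apply: contD; first exact: c4.
  by apply: contN; apply: contM; [exact: cont_cst | exact: cchi].
have [C1 H1] := corr cz cf (vderiv_costate Ps ric loop) tautb tba.
have cnv := cont_nsq cv; have cnchi := cont_nsq cchi; have cng := cont_nsq cg.
have cnvt := cont_nsq cvt; have cnf := cont_nsq cf.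
have cdot : continuous (fun t => dot (v t) (v (t - tau))) by exact: cont_dot.
pose cr t := kappa * nsq (v t) - dot (v t) (v (t - tau)).
have ccr : continuous cr by rewrite /cr; cont.
have Pn w : nsq (P *m w) <= c ^+ 2 * nsq w by exact: psd_nsq_le2.
have c2 : c ^+ 2 <= 1 by rewrite expr_le1// ltW.
have eV : 0 < eps^-1 by rewrite invr_gt0.
have [C2 H2] : bdle a (fun T => dot (chi T) (P *m chi T))
    (fun T => 2 * rho * prim cr T + - 1 * prim (fun t => nsq (v t)) T
       + - (eps / 2) * prim (fun t => nsq (chi t)) T
       + 2 * eps^-1 * prim (fun t => nsq (g t)) T).
  apply: (bdle_drv (F' := fun t =>
    2 * dot (P *m chi t) (A *m chi t - rho *: (B *m v (t - tau)) + g t))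
    (G' := fun t => 2 * rho * cr t + - 1 * nsq (v t) + - (eps / 2) * nsq (chi t)
      + 2 * eps^-1 * nsq (g t))).
  - move=> t at_; have t0 := lt_le_trans a0 at_; have dchi := loop t t0.
    apply: drv_eq (drv_dot dchi (vderiv_mul P dchi)) _.
    by rewrite dot_mul Ps [X in _ + X]dotC -/(v _); lra.
  - move=> t at_; have t0 := lt_le_trans a0 at_.
    have d1 := drv_prim ccr t0; have d2 := drv_prim cnv t0.
    have d3 := drv_prim cnchi t0; have d4 := drv_prim cng t0.
    by drv.
  - move=> t at_; rewrite !dotDr dotNr dotZr (dot_mul _ B) -/(v t) mulrDr mulrBr.
    rewrite (riccati_dot (chi t) Ps ric) -/(v t).
    have e2 : 0 < eps / 2 by rewrite divr_gt0.
    have := dot_young (chi t) (P *m g t) e2.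
    rewrite (dot_mul (chi t)) Ps ler_norml invf_div => /andP[_ Y].
    have Pg : eps^-1 * nsq (P *m g t) <= eps^-1 * nsq (g t).
      apply: ler_wpM2l; first exact: ltW.
      apply: le_trans (Pn _) _; rewrite ler_piMl ?nsq_ge0//.
    have := ler_wpM2r (nsq_ge0 (v t)) rho_kappa.
    by move=> rk; exact: energy_rate_arith rk Y Pg.
have [C3 H3] : bdle a (prim (fun t => nsq (f t)))
    (fun T => 8 * c ^+ 2 * mxb B * prim (fun t => nsq (v t)) T
      + 8 * c ^+ 2 * mxb B * rho ^+ 2 * prim (fun t => nsq (v t)) (T - tau)
      + 4 * eps ^+ 2 * prim (fun t => nsq (chi t)) T + 2 * prim (fun t => nsq (g t)) T).
  apply: (bdle_prim (F' := fun t => 8 * c ^+ 2 * mxb B * nsq (v t)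
      + 8 * c ^+ 2 * mxb B * rho ^+ 2 * nsq (v (t - tau))
      + 4 * eps ^+ 2 * nsq (chi t) + 2 * nsq (g t)) a0 cnf).
  - move=> t at_; have t0 := lt_le_trans a0 at_.
    have tt : 0 < t - tau by lra.
    have d1 := drv_prim cnv t0; have d2 := drv_shift (drv_prim cnv tt).
    have d3 := drv_prim cnchi t0; have d4 := drv_prim cng t0.
    by drv.
  - move=> t at_; rewrite /f.
    have N1 := nsqD_le (P *m (B *m (v t - rho *: v (t - tau))) - eps *: chi t) (P *m g t).
    have := nsqD_le (P *m (B *m (v t - rho *: v (t - tau)))) (- (eps *: chi t)).
    rewrite nsqN nsqZ => N2.
    have := nsqD_le (v t) (- (rho *: v (t - tau))); rewrite nsqN nsqZ => N3.
    have Pg : nsq (P *m g t) <= nsq (g t).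
      by apply: le_trans (Pn _) _; rewrite ler_piMl ?nsq_ge0.
    have N4 : nsq (P *m (B *m (v t - rho *: v (t - tau)))) <=
       c ^+ 2 * mxb B * (2 * nsq (v t) + 2 * (rho ^+ 2 * nsq (v (t - tau)))).
      apply: le_trans (Pn _) _; rewrite -mulrA ler_wpM2l ?sqr_ge0//.
      by apply: le_trans (nsq_mul_le _ _) _; rewrite ler_wpM2l ?mxb_ge0.
    by lra.
pose D := 2 * rho * K.
have D0 : 0 <= D by rewrite /D; nng.
have [C4 HC] : exists C4, forall T, a <= T ->
    dot (chi T) (P *m chi T) / 2 + eps / 4 * prim (fun t => nsq (chi t)) T <= C4.
  exists (C2 + 2 * rho * C1 + D * C3 + (D * 2 + 2 * eps^-1) * Cg) => T aT.
  have Pv0 : 0 <= prim (fun t => nsq (v t)) T by apply: prim_ge0 => u; exact: nsq_ge0.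
  have Px0 : 0 <= prim (fun t => nsq (chi t)) T by apply: prim_ge0 => u; exact: nsq_ge0.
  have nd : prim (fun t => nsq (v t)) (T - tau) <= prim (fun t => nsq (v t)) T.
    by apply: prim_ndecr => //; [move=> u; exact: nsq_ge0 | lra | lra].
  have k0 : 0 <= D * (8 * c ^+ 2 * mxb B * rho ^+ 2).
    by rewrite /D; have := mxb_ge0 B => ?; nng.
  have e0 : 0 <= D * 2 + 2 * eps^-1 by have := ltW eV => ?; nng.
  have rho20 := mulr_ge0 (ler0n R 2) (ltW rho0).
  apply: (@energy_total_arith _ rho K D (8 * c ^+ 2 * mxb B)
    (8 * c ^+ 2 * mxb B * rho ^+ 2) (4 * eps ^+ 2) c eps eps^-1 C1 C2 C3 Cg (prim cr T)
    (prim (fun t => nsq (f t)) T) (prim (fun t => nsq (v t)) T)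
    (prim (fun t => nsq (v t)) (T - tau)) (prim (fun t => nsq (chi t)) T)
    (prim (fun t => nsq (g t)) T) _ (nsq (P *m chi T))) => //.
  - by have := H1 T aT; rewrite -subr_ge0 => /(mulr_ge0 rho20).
  - by have := H3 T aT; rewrite -subr_ge0 => /(mulr_ge0 D0).
  - exact: H2.
  - by have := ler_wpM2l k0 nd.
  - by have := ler_wpM2r Pv0 h2; rewrite [(_ * mxb B) * (1 + _)]mulrDr mulr1.
  - by have := ler_wpM2r Px0 h3.
  - by have := ler_wpM2l e0 (gC T aT).
  - by have := ler_wpM2l D0 (psd_nsq_le (chi T) Ps c0 P0 Pc).
  - by have := ler_wpM2r (P0 (chi T)) h1.
exists (2 * C4 + 4 * eps^-1 * C4) => T aT; have := HC T aT.
have Px0 : 0 <= prim (fun t => nsq (chi t)) T by apply: prim_ge0 => u; exact: nsq_ge0.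
have V0 := P0 (chi T).
have ex0 := mulr_ge0 (ltW eps0) Px0 => HH.
have C40 : 0 <= C4 by lra.
have e4 := mulr_ge0 (ltW eV) C40.
split; first by lra.
have : eps^-1 * (eps * prim (fun t => nsq (chi t)) T) <= eps^-1 * (4 * C4).
  by apply: ler_wpM2l; [exact: ltW | lra].
by rewrite mulrA mulVf ?gt_eqF// mul1r; lra.
Qed.

End Energy.

(** A lower bound on [P] read off the Riccati equation: [eps |v|^2] equals
    [|B' P v|^2 - 2 P v . A v], hence is bounded by [|P v|^2] after half of it is absorbed. The
    constant may depend on [eps]. *)
Lemma riccati_coercive (R : realType) n m (A : 'M[R]_n) (B : 'M[R]_(n, m)) (P : 'M[R]_n)
    (eps c : R) : 0 < eps -> 0 < c -> posdef P ->
  A^T *m P + P *m A - P *m B *m B^T *m P + eps%:M = 0 ->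
  (forall w, dot w (P *m w) <= c * nsq w) ->
  exists2 k : R, 0 <= k & forall v, nsq v <= k * dot v (P *m v).
Proof.
move=> e0 c0 pP ric Pc.
have [bA bB] := (mxb_ge0 A, mxb_ge0 B^T).
have bA1 : 0 < mxb A + 1 by lra.
pose k := eps / (2 * (mxb A + 1)).
have k0 : 0 < k by rewrite divr_gt0// mulr_gt0.
have kA : k * mxb A <= eps / 2.
  have -> : eps / 2 = k * (mxb A + 1) by rewrite /k; field; rewrite gt_eqF.
  by rewrite ler_pM2l//; lra.
have kV : 0 < k^-1 by rewrite invr_gt0.
have eV : 0 < eps^-1 by rewrite invr_gt0.
exists (2 * eps^-1 * ((mxb B^T + k^-1) * c)); first by nng.
move=> v; have ricv := riccati_dot v pP.1 ric.
have := dot_young (A *m v) (P *m v) k0; rewrite dotC ler_norml => /andP[Y _].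
have N1 : k * nsq (A *m v) <= eps / 2 * nsq v.
  apply: (@le_trans _ _ (k * (mxb A * nsq v))).
    by apply: ler_wpM2l; [exact: ltW | exact: nsq_mul_le].
  by rewrite mulrA ler_wpM2r ?nsq_ge0.
have N2 := nsq_mul_le B^T (P *m v).
have P0 w := posdef_ge0 w pP.
have N3 : (mxb B^T + k^-1) * nsq (P *m v) <= (mxb B^T + k^-1) * (c * dot v (P *m v)).
  by apply: ler_wpM2l; [lra | exact: psd_nsq_le pP.1 c0 P0 Pc].
have N4 : eps / 2 * nsq v <= (mxb B^T + k^-1) * (c * dot v (P *m v)).
  by move: (k^-1) kV Y N3 => ik *; lra.
have := ler_wpM2l (ltW eV) N4.
have -> : eps^-1 * (eps / 2 * nsq v) = nsq v / 2 by field; rewrite gt_eqF.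
by move: (k^-1) (eps^-1) => ik ie; lra.
Qed.

Lemma drv_nsq (R : realType) n (z : R -> 'cV[R]_n) t D : vderiv t z D ->
  has_deriv t (fun t => nsq (z t)) (2 * dot (z t) D).
Proof. by move=> dz; apply: drv_eq (drv_dot dz dz) _; rewrite (dotC D); ring. Qed.

(** One agent with its coupling [g] as an external signal; boundedness and square integrability of
    [g] from some time on suffice, so the constants are chosen without any network. *)
Lemma low_gain_delay_stable (R : realType) n m (A : 'M[R]_n) (B : 'M[R]_(n, m)) (taubar : R) :
  stabilizable A B -> eig_closed_lhp A -> 0 <= taubar -> taubar * omega_max A < pi / 2 ->
  exists rho eps_star : R, 1 < rho /\ 0 < eps_star /\
  forall (eps : R) (P : 'M[R]_n), 0 < eps <= eps_star -> posdef P ->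
  A^T *m P + P *m A - P *m B *m B^T *m P + eps%:M = 0 ->
  forall (chi g : R -> 'cV[R]_n) (tau Cg G : R), vcont chi -> vcont g ->
  closed_loop A B rho tau P chi g -> 0 <= tau <= taubar ->
  (forall T, taubar + 1 <= T -> prim (fun t => nsq (g t)) T <= Cg) ->
  (forall t, taubar + 1 <= t -> nsq (g t) <= G) ->
  forall e : R, 0 < e -> exists T0 : R, forall T, T0 <= T -> nsq (chi T) <= e.
Proof.
move=> stab lhp tb0 small.
have [cos0 cosw] := cos_omega_max lhp tb0 small.
have Mre l : eigenvalue (cmx (- A^T)) l -> 0 <= complex.Re l.
  rewrite cmxN cmx_tr eigenvalue_opp eigenvalue_trmx => /lhp.
  by case: l => x y /=; rewrite oppr_le0.
have [kappa kap0 [K K0 corr]] := delay_correlation B Mre cosw cos0 tb0.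
(* This gives [rho * kappa = 1 + kappa], and [rho > 1] for every [kappa]. *)
pose rho := kappa^-1 + 1.
have kV : 0 < kappa^-1 by rewrite invr_gt0.
have rho1 : 1 < rho by rewrite /rho; lra.
have rho0 : 0 < rho by lra.
have rk : 1 <= rho * kappa by rewrite /rho mulrDl mulVf ?gt_eqF//; lra.
pose D := 2 * rho * K.
have D0 : 0 <= D by rewrite /D; nng.
have bB := mxb_ge0 B.
(* Large enough for its inverse [c] to meet both [h1], linear in [c], and [h2], quadratic in [c];
   [h3] is left to [eps]. *)
pose E := 8 * (D + 1) * (mxb B + 1) * (1 + rho ^+ 2).
have r2 := sqr_ge0 rho.
have E8 : 8 * (D + 1) <= E.
  rewrite /E -mulrA ler_peMr//; first by lra.
  by rewrite -[1 in X in X <= _]mulr1 ler_pM//; lra.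
have E0 : 0 < E by lra.
pose c := E^-1.
have c0 : 0 < c by rewrite invr_gt0.
have cE : c * E = 1 by rewrite mulVf ?gt_eqF.
have c1 : c <= 1 by rewrite invf_le1//; lra.
have h1 : D * c <= 1 / 2.
  by have := ler_wpM2l (ltW c0) E8; rewrite cE; lra.
have h2 : D * (8 * c ^+ 2 * mxb B * (1 + rho ^+ 2)) <= 1.
  have -> : D * (8 * c ^+ 2 * mxb B * (1 + rho ^+ 2)) =
    c * (c * (8 * D * mxb B * (1 + rho ^+ 2))) by ring.
  have le1 : 8 * D * mxb B * (1 + rho ^+ 2) <= E.
    rewrite /E ler_wpM2r//; first by lra.
    by rewrite ler_pM//; [nng | lra | lra].
  have := ler_wpM2l (ltW c0) le1; rewrite cE => le2.
  apply: le_trans (ler_wpM2l (ltW c0) le2) _; lra.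
have [es es0 Hes] := riccati_small stab lhp c0.
pose es' := Num.min es (16 * (D + 1))^-1.
have D16 : 0 < (16 * (D + 1))^-1 by rewrite invr_gt0; lra.
exists rho, es'; split=> //; split; first by rewrite lt_min es0 D16.
move=> eps P /andP[eps0]; rewrite le_min => /andP[epses epsD] pP ric.
move=> chi g tau Cg G cchi cg loop tautb gC gG e e0.
have Ps := pP.1; have P0 v := posdef_ge0 v pP.
have Pc : forall w, dot w (P *m w) <= c * nsq w.
  by apply: Hes ric => //; rewrite eps0.
have h3 : D * (4 * eps ^+ 2) <= eps / 4.
  have : eps * (16 * (D + 1)) <= 1.
    by rewrite -ler_pdivlMr ?div1r//; lra.
  move=> /(ler_wpM2l (ltW eps0)); have := sqr_ge0 eps; lra.
have tba : taubar < taubar + 1 by lra.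
have [C HC] := energy_bound K0 corr rk rho0 c0 c1 eps0 h1 h2 h3
  Ps P0 Pc ric cchi cg loop tautb tba gC.
have [k k0 Hk] := riccati_coercive eps0 c0 pP ric Pc.
have chiC t : taubar + 1 <= t -> nsq (chi t) <= k * C.
  by move=> tt; apply: le_trans (Hk _) _; apply: ler_wpM2l => //; have [] := HC t tt.
(* The rate of [|chi|^2] involves [chi (t - tau)], which is bounded only from [taubar + 1] on. *)
pose a := 2 * taubar + 1.
have a0 : 0 < a by rewrite /a; lra.
have [tau0 tautb'] := andP tautb.
pose W := B *m B^T *m P.
pose DD := k * C + 4 * mxb A * (k * C) + 4 * rho ^+ 2 * mxb W * (k * C) + 2 * G + 1.
pose rhs t := A *m chi t - rho *: (B *m (B^T *m (P *m chi (t - tau)))) + g t.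
have rate t : a <= t -> 2 * dot (chi t) (rhs t) <= DD.
  rewrite /a => at_.
  have x1 : nsq (chi t) <= k * C by apply: chiC; lra.
  have x2 : nsq (chi (t - tau)) <= k * C by apply: chiC; lra.
  have x3 : nsq (g t) <= G by apply: gG; lra.
  have := dot_young (chi t) (rhs t) ltr01; rewrite ler_norml invr1 => /andP[_ Y].
  have N1 := nsqD_le (A *m chi t - rho *: (B *m (B^T *m (P *m chi (t - tau))))) (g t).
  have := nsqD_le (A *m chi t) (- (rho *: (B *m (B^T *m (P *m chi (t - tau)))))).
  rewrite nsqN nsqZ => N2.
  have N3 : nsq (A *m chi t) <= mxb A * (k * C).
    by apply: le_trans (nsq_mul_le _ _) _; rewrite ler_wpM2l// mxb_ge0.
  have N4 : nsq (B *m (B^T *m (P *m chi (t - tau)))) <= mxb W * (k * C).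
    rewrite !mulmxA; apply: le_trans (nsq_mul_le _ _) _.
    by rewrite ler_wpM2l// mxb_ge0.
  have N5 := ler_wpM2l r2 N4.
  rewrite -/(rhs t) in N1; rewrite /DD.
  move: (dot _ _) (nsq (rhs t)) (nsq (A *m chi t)) (nsq (B *m _)) (nsq (chi t)) (nsq (g t))
    (nsq (A *m chi t - _)) (k * C) (mxb A) (mxb W) (rho ^+ 2)
    Y N1 N2 N3 N5 x1 x3 => *; lra.
have DD0 : 0 < DD.
  have kC0 : 0 <= k * C by apply: le_trans (nsq_ge0 (chi a)) (chiC a _); rewrite /a; lra.
  have G0 : 0 <= G by apply: le_trans (nsq_ge0 (g a)) (gG a _); rewrite /a; lra.
  have A1 := mulr_ge0 (mxb_ge0 A) kC0.
  have A2 := mulr_ge0 r2 (mulr_ge0 (mxb_ge0 W) kC0).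
  by rewrite /DD; lra.
have dh t : a <= t -> has_deriv t (fun t => nsq (chi t)) (2 * dot (chi t) (rhs t)).
  by move=> at_; apply: drv_nsq; apply: loop; lra.
have a1 : taubar + 1 <= a by rewrite /a; lra.
have [T0 _ HT0] := barbalat (C := C) a0 (cont_nsq cchi) (fun t => nsq_ge0 (chi t)) dh rate DD0
  (fun T aT => (HC T (le_trans a1 aT)).2) e0.
by exists T0.
Qed.

(** * Pinned consensus *)

Section PinnedLaplacian.
Context {R : realType}.
Variables (N : nat) (C : {set 'I_N}) (a : 'I_N -> 'I_N -> R).
Hypothesis graph : graph_in_GC C a.

Definition pin (i : 'I_N) : R := if i \in C then 1 else 0.

Definition lap (x : 'I_N -> R) (i : 'I_N) : R :=
  \sum_j a i j * (x i - x j) + pin i * x i.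

(** Reachability from [C] along at most [k] edges, boolean so that [ex_minn] yields the depth of a
    node. *)
Fixpoint reach (k : nat) (i : 'I_N) : bool :=
  if k is k'.+1 then (i \in C) || [exists j, (0 < a i j) && reach k' j] else i \in C.

Lemma pin_ge0 i : 0 <= pin i. Proof. by rewrite /pin; case: ifP. Qed.

Lemma reach_ex i : exists k, reach k i.
Proof.
have [_ [_ /(_ i)[T [r [par [[rT [parT iterT]] [iT rC]]]]]]] := graph.
have [k ik] := iterT _ iT; exists k.
elim: k i iT ik => [|k IH] i iT /=; first by move=> ->.
rewrite -iterS iterSr => ik.
have [->|ir] := eqVneq i r; first by rewrite rC.
have [pT ap] := parT _ iT ir.
by apply/orP; right; apply/existsP; exists (par i); rewrite ap IH.
Qed.

Lemma depth_ex : exists h : 'I_N -> nat, forall i,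
  if h i is k.+1 then exists2 j, 0 < a i j & (h j <= k)%N else is_true (i \in C).
Proof.
exists (fun i => ex_minn (reach_ex i)) => i.
case: (ex_minnP (reach_ex i)) => [[|k]] //= rk mink.
case: (boolP (i \in C)) rk => [iC _|_ /= /existsP[j /andP[aij rj]]].
  by have := mink 0%N iC.
exists j => //; case: (ex_minnP (reach_ex j)) => l _; exact.
Qed.

(** [d i = 1 - c * eta ^+ h i] increases with the depth [h]. At depth [k + 1] some in-neighbour lies
    below [d i] by at least [H - 1] times [c * eta ^+ k.+1], while no node lies above it by more
    than [c * eta ^+ k.+1]. At depth 0 the pinning term compensates. *)
Lemma superharmonic_ex : exists2 d : 'I_N -> R, (forall i, 0 < d i) & forall i, 0 < lap d i.
Proof.
have [a0 _] := graph; have [h hP] := depth_ex.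
pose S : R := \sum_i \sum_j a i j.
have S0 : 0 <= S by apply: sumr_ge0 => i _; apply: sumr_ge0 => j _.
have Si i : \sum_j a i j <= S.
  rewrite /S [leRHS](bigD1 i)//= lerDl; apply: sumr_ge0 => k _; exact: sumr_ge0.
(* On every edge [H - 1] exceeds [S / a i j], so a single parent outweighs all other neighbours
   together. *)
pose H : R := 2 + \sum_i \sum_j (if 0 < a i j then S / a i j else 0).
have HS i j : 0 < a i j -> 2 + S / a i j <= H.
  move=> aij; rewrite /H lerD2l (bigD1 i)//= (bigD1 j)//= aij -addrA lerDl addr_ge0//.
    by apply: sumr_ge0 => k _; case: ifP => // ?; rewrite divr_ge0.
  by apply: sumr_ge0 => k _; apply: sumr_ge0 => l _; case: ifP => // ?; rewrite divr_ge0.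
have H2 : 2 <= H.
  rewrite /H lerDl; apply: sumr_ge0 => k _; apply: sumr_ge0 => l _.
  by case: ifP => // ?; rewrite divr_ge0.
have H0 : 0 < H by lra.
pose eta : R := H^-1.
have eta0 : 0 < eta by rewrite invr_gt0.
have etaH : eta * H = 1 by rewrite mulVf ?gt_eqF.
have eta1 : eta <= 1 by rewrite invf_le1//; lra.
(* At a pinned node the neighbours cost at most [c * S] and the pin gives [1 - c], which leaves at
   least [c]. *)
pose c : R := (S + 2)^-1.
have c0 : 0 < c by rewrite invr_gt0; lra.
have cS : c * (S + 2) = 1 by rewrite mulVf// gt_eqF//; lra.
have c1 : c < 1 by rewrite -cS; have := mulr_ge0 (ltW c0) S0; lra.
have ek k : 0 < eta ^+ k <= 1 by rewrite exprn_gt0//= exprn_ile1// ltW.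
pose d i := 1 - c * eta ^+ h i.
have d1 j : d j <= 1 by rewrite /d; have /andP[e1 _] := ek (h j); have := mulr_gt0 c0 e1; lra.
have d0 i : 0 < d i.
  by rewrite subr_gt0; have /andP[_ e2] := ek (h i); have := ler_wpM2l (ltW c0) e2; lra.
exists d => // i; have := hP i; case E : (h i) => [|k].
  move=> iC; rewrite /lap /pin iC mul1r.
  have : \sum_j a i j * (- c) <= \sum_j a i j * (d i - d j).
    apply: ler_sum => j _; apply: ler_wpM2l => //.
    by rewrite {1}/d E expr0; have := d1 j; lra.
  rewrite -mulr_suml; have dE : d i = 1 - c by rewrite /d E expr0 mulr1.
  have := ler_wpM2l (ltW c0) (Si i).
  by move: (\sum_j a i j) (\sum_j a i j * (d i - d j)) (d i) dE => *; lra.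
move=> [j0 aij0 hj0].
have /andP[k0 k1] := ek k.+1.
have dij j : - (c * eta ^+ k.+1) <= d i - d j by rewrite {1}/d E; have := d1 j; lra.
have dij0 : c * eta ^+ k.+1 * (H - 1) <= d i - d j0.
  have : eta ^+ k <= eta ^+ h j0 by rewrite ler_wiXn2l// ltW.
  move=> /(ler_wpM2l (ltW c0)).
  have -> : c * eta ^+ k = c * eta ^+ k.+1 * H by rewrite exprSr -!mulrA etaH mulr1.
  by rewrite /d E; lra.
rewrite /lap (bigD1 j0)//=.
have A1 : a i j0 * (c * eta ^+ k.+1 * (H - 1)) <= a i j0 * (d i - d j0).
  by apply: ler_wpM2l.
have A2 : \sum_(j | j != j0) a i j * (- (c * eta ^+ k.+1)) <=
    \sum_(j | j != j0) a i j * (d i - d j).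
  by apply: ler_sum => j _; apply: ler_wpM2l.
rewrite -mulr_suml in A2.
have A3 : \sum_(j | j != j0) a i j <= S.
  by apply: le_trans (Si i); rewrite [leRHS](bigD1 j0)//= lerDr.
have A4 : a i j0 + S <= a i j0 * (H - 1).
  have := HS _ _ aij0; rewrite -(ler_pM2l aij0) mulrDr mulrCA divff ?gt_eqF// mulr1.
  by lra.
have A5 := mulr_ge0 (pin_ge0 i) (ltW (d0 i)).
have ce := mulr_gt0 c0 k0.
have A6 := ler_wpM2l (ltW ce) A4; have A7 := ler_wpM2l (ltW ce) A3.
have A8 := mulr_gt0 ce aij0.
move: (\sum_(j | j != j0) a i j) (\sum_(j | j != j0) a i j * (d i - d j)) (c * eta ^+ k.+1)
  (pin i * d i) A1 A2 A5 A6 A7 A8 => *; lra.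
Qed.

(** A minimum principle for [x / d]: at a negative minimum [s], [lap x] would be at most
    [s * lap d], which is negative. *)
Lemma lap_monotone (x : 'I_N -> R) : (forall i, 0 <= lap x i) -> forall i, 0 <= x i.
Proof.
move=> Lx i0; have [d d0 Ld] := superharmonic_ex; have [a0 _] := graph.
have [i _ imin] := @Order.TotalTheory.arg_minP _ R _ i0 xpredT (fun i => x i / d i) isT.
rewrite leNgt; apply/negP => xi0.
pose s := x i / d i.
have s0 : s < 0.
  apply: le_lt_trans (imin i0 isT) _; rewrite pmulr_llt0// invr_gt0//.
have xj j : s * d j <= x j by rewrite -ler_pdivlMr//; exact: imin.
have xi : x i = s * d i by rewrite /s mulfVK ?gt_eqF.
have : lap x i <= s * lap d i.
  rewrite /lap mulrDr mulr_sumr; apply: lerD; last by rewrite xi mulrCA.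
  apply: ler_sum => j _; rewrite mulrCA; apply: ler_wpM2l => //.
  by rewrite xi mulrBr; have := xj j; lra.
have := Lx i; have : s * lap d i < 0 by rewrite nmulr_rlt0.
by lra.
Qed.

Definition lapmx : 'M[R]_N :=
  \matrix_(i, j) ((if i == j then \sum_k a i k + pin i else 0) - a i j).

Lemma lapmxE (x : 'cV[R]_N) i : (lapmx *m x) i 0 = lap (fun i => x i 0) i.
Proof.
pose c : R := \sum_k a i k + pin i.
have E1 : \sum_j (if i == j then c else 0) * x j 0 = c * x i 0.
  by rewrite (bigD1 i)//= eqxx big1 ?addr0// => j ji; rewrite eq_sym (negbTE ji) mul0r.
have -> : (lapmx *m x) i 0 = \sum_j (if i == j then c else 0) * x j 0 - \sum_j a i j * x j 0.
  by rewrite mxE -sumrB; apply: eq_bigr => j _; rewrite mxE mulrBl.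
rewrite E1 /lap; have -> : \sum_j a i j * (x i 0 - x j 0) =
  (\sum_j a i j) * x i 0 - \sum_j a i j * x j 0.
  by rewrite mulr_suml -sumrB; apply: eq_bigr => j _; rewrite mulrBr.
by rewrite /c; lra.
Qed.

(** [p] is the row of column sums of the inverse Laplacian, which exists and is entrywise
    nonnegative by monotonicity. *)
Lemma colap_ex : exists2 p : 'I_N -> R, (forall i, 0 < p i) &
  forall x, \sum_i p i * lap x i = \sum_i x i.
Proof.
have [a0 _] := graph.
have unitL : lapmx \in unitmx.
  rewrite -unitmx_tr -row_free_unit; apply: inj_row_free => v vL.
  have Lv : lapmx *m v^T = 0 by apply: trmx_inj; rewrite trmx_mul trmxK vL trmx0.
  have v0 i : 0 <= v^T i 0 by apply: (@lap_monotone (fun i => v^T i 0)) => k; rewrite -lapmxE Lv mxE.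
  have nv0 i : 0 <= (- v^T) i 0.
    by apply: (@lap_monotone (fun i => (- v^T) i 0)) => k; rewrite -lapmxE mulmxN Lv oppr0 mxE.
  apply/rowP => i; rewrite mxE; apply/eqP; rewrite eq_le.
  by have := v0 i; have := nv0 i; rewrite !mxE oppr_ge0 => -> ->.
pose pr : 'rV[R]_N := const_mx 1 *m invmx lapmx.
have dualE x : \sum_i pr 0 i * lap x i = \sum_i x i.
  transitivity ((pr *m (lapmx *m \col_i x i)) 0 0).
    rewrite mxE; apply: eq_bigr => i _; rewrite lapmxE; congr (_ * _).
    by rewrite /lap !mxE; congr (_ + _); apply: eq_bigr => j _; rewrite !mxE.
  rewrite /pr mulmxA mulmxKV// mxE; apply: eq_bigr => i _.
  by rewrite !mxE mul1r.
have pr0 j : 0 <= pr 0 j.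
  rewrite /pr mxE; apply: sumr_ge0 => i _; rewrite mxE mul1r.
  have -> : invmx lapmx i j = (invmx lapmx *m delta_mx j (0 : 'I_1)) i 0 by rewrite mul_delta.
  apply: (@lap_monotone (fun i => (invmx lapmx *m delta_mx j (0 : 'I_1)) i 0)) => k.
  by rewrite -lapmxE mulKVmx// mxE; case: (_ && _).
exists (fun i => pr 0 i) => // j; rewrite lt_def pr0 andbT; apply/negP => /eqP pj.
(* If [p j] vanished, the indicator of [j] would meet only off-diagonal entries, which are
   nonpositive, against a total of 1. *)
have := dualE (fun i => (i == j)%:R).
have -> : \sum_(i < N) (i == j)%:R = 1 :> R.
  by rewrite (bigD1 j)//= eqxx big1 ?addr0// => i /negbTE ->.
rewrite (bigD1 j)//= pj mul0r add0r => E; have : \sum_(i < N | i != j) pr 0 i * lap (fun i => (i == j)%:R) i <= 0.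
  apply: sumr_le0 => i ij; rewrite mulr_ge0_le0// /lap (negbTE ij) mulr0 addr0.
  apply: sumr_le0 => k _; rewrite sub0r mulrN oppr_le0 mulr_ge0//.
by rewrite E; lra.
Qed.

(* With [d] superharmonic and [p] a left solution, the diagonal weights [p / d]
   make the Laplacian coercive. *)
Lemma pinned_dissipation (d p q : 'I_N -> R) (b : 'I_N -> 'I_N -> R) :
  (forall i, 0 < d i) -> (forall i, 0 <= lap d i) ->
  (forall i, 0 <= p i) -> (forall x, \sum_i p i * lap x i = \sum_i x i) ->
  (forall i, 0 <= q i) ->
  (forall i j, 2 * b i j <= d j / d i * q i + d i / d j * q j) ->
  \sum_i q i / d i <=
  \sum_i p i / d i * (\sum_j a i j * (2 * q i - 2 * b i j) + 2 * pin i * q i).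
Proof.
move=> d0 Ld p0 pE q0 hb; have [a0 _] := graph.
rewrite -pE -subr_ge0 -sumrB; apply: sumr_ge0 => i _.
have dn0 j : d j != 0 by rewrite gt_eqF.
(* Edge by edge, the bound on [b] yields exactly the Laplacian of [q / d], whose [p]-weighted sum is
   wanted, plus a nonnegative multiple of [lap d]. *)
suff H : lap (fun i => q i / d i) i + q i / d i ^+ 2 * lap d i <=
    (\sum_j a i j * (2 * q i - 2 * b i j) + 2 * pin i * q i) / d i.
  have := ler_wpM2l (p0 i) H.
  have := mulr_ge0 (p0 i) (mulr_ge0 (divr_ge0 (q0 i) (sqr_ge0 (d i))) (Ld i)).
  move: (lap _ i) (q i / d i ^+ 2 * lap d i) (\sum_j _) (d i)^-1 => *; lra.
rewrite /lap mulrDl mulr_suml mulrDr addrACA mulr_sumr -big_split /=.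
apply: lerD.
  apply: ler_sum => j _.
  have h := hb i j.
  have -> : a i j * (q i / d i - q j / d j) + q i / d i ^+ 2 * (a i j * (d i - d j)) =
    a i j * ((2 * q i - (d j / d i * q i + d i / d j * q j)) / d i).
    by field; rewrite !dn0.
  rewrite -[leRHS]mulrA; apply: ler_wpM2l => //; rewrite ler_pM2r ?invr_gt0//; lra.
by rewrite le_eqVlt; apply/orP; left; apply/eqP; field.
Qed.

End PinnedLaplacian.

(** * A quadratic form for [A] and the decay of the consensus error *)

Section Lyapunov.
Context {R : realType}.

Lemma dot_rank1 n (r : 'rV[R]_n) (x y : 'cV[R]_n) : dot x (r^T *m r *m y) = ev r x * ev r y.
Proof.
rewrite -mulmxA dot_mul trmxK /dot big_ord1 /ev.
by congr (_ * _); rewrite !ord1.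
Qed.

Lemma dot_summx n (I : Type) (l : seq I) (F : I -> 'M[R]_n) (x y : 'cV[R]_n) :
  dot x ((\sum_(i <- l) F i) *m y) = \sum_(i <- l) dot x (F i *m y).
Proof.
elim: l => [|i l IH]; last by rewrite !big_cons mulmxDl dotDr IH.
by rewrite !big_nil mul0mx -[X in dot _ X](scale0r x) dotZr mul0r.
Qed.

(* Weighting the [j]-th element of a Jordan chain by [mu ^- (2 j)] makes the nilpotent
   part at most [mu]. *)
Lemma jordan_weight_bound (mu al om : R) n (y z : nat -> R) : 0 < mu -> al <= 0 ->
  y n.+1 = 0 -> z n.+1 = 0 ->
  \sum_(j < n.+1) mu ^- (2 * j) * (y j * (al * y j - om * z j + y j.+1)
                                   + z j * (om * y j + al * z j + z j.+1)) <=
  mu * \sum_(j < n.+1) mu ^- (2 * j) * (y j ^+ 2 + z j ^+ 2).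
Proof.
move=> mu0 al0 yn zn; pose w j : R := mu ^- (2 * j) * (y j ^+ 2 + z j ^+ 2).
have wj j : 0 < mu ^- (2 * j) by rewrite invr_gt0 exprn_gt0.
have w0 j : 0 <= w j by rewrite mulr_ge0 ?addr_ge0 ?sqr_ge0// ltW.
have shift : \sum_(j < n.+1) w j.+1 <= \sum_(j < n.+1) w j.
  have E : \sum_(j < n.+2) w j = \sum_(j < n.+1) w j.
    by rewrite big_ord_recr /= {2}/w yn zn expr0n addr0 mulr0 addr0.
  by rewrite -E [leRHS]big_ord_recl /= lerDr.
apply: (@le_trans _ _ (\sum_(j < n.+1) (mu / 2 * w j + mu / 2 * w j.+1))).
  apply: ler_sum => j _.
  have -> : mu / 2 * w j + mu / 2 * w j.+1 = mu ^- (2 * j) *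
      (mu / 2 * (y j ^+ 2 + z j ^+ 2) + mu^-1 / 2 * (y j.+1 ^+ 2 + z j.+1 ^+ 2)).
    have muE : mu * mu ^- (2 * j.+1) = mu^-1 * mu ^- (2 * j).
      rewrite mulnS exprD expr2 !invfM; have := gt_eqF mu0 => /negbT mun0.
      by rewrite !mulrA divff// mul1r.
    rewrite /w; have -> : mu / 2 * (mu ^- (2 * j.+1) * (y j.+1 ^+ 2 + z j.+1 ^+ 2)) =
      (mu * mu ^- (2 * j.+1)) / 2 * (y j.+1 ^+ 2 + z j.+1 ^+ 2) by field; rewrite expf_neq0 ?gt_eqF.
    rewrite muE; move: (mu ^- (2 * j)) => W; lra.
  apply: ler_wpM2l; first exact: ltW.
  have := young (y j) (y j.+1) mu0; have := young (z j) (z j.+1) mu0.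
  rewrite !ler_norml => /andP[_ Y1] /andP[_ Y2].
  have := mulr_le0_ge0 al0 (addr_ge0 (sqr_ge0 (y j)) (sqr_ge0 (z j))).
  by move: (mu^-1) Y1 Y2 => im; lra.
rewrite big_split /= -!mulr_sumr.
by have := ler_wpM2l (ltW mu0) shift; lra.
Qed.

(** [Q] sums the weighted squares of the chain vectors of all coordinate rows. Jordan blocks on the
    imaginary axis rule out growth rate 0 in general, hence an arbitrary [mu > 0], which the network
    dissipation will absorb. *)
Lemma lyapunov_ex n (A : 'M[R]_n) (mu : R) : eig_closed_lhp A -> 0 < mu ->
  exists (Q : 'M[R]_n) (k : R), [/\ Q^T = Q, forall x, 0 <= dot x (Q *m x), 0 <= k,
    forall x, nsq x <= k * dot x (Q *m x) &
    forall x, dot (Q *m x) (A *m x) <= mu * dot x (Q *m x)].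
Proof.
move=> lhp mu0; have [L [al [om [eigA _ rows]]]] := generalized_eigenrows A.
have al0 i : al i <= 0 by exact: lhp (eigA i).
have /choice[rs rsE] : forall c : 'I_n, exists rs : ('I_L -> nat -> 'rV[R]_n) * ('I_L -> nat -> 'rV[R]_n),
   [/\ forall i k, rs.1 i k *m A = al i *: rs.1 i k - om i *: rs.2 i k + rs.1 i k.+1,
       forall i k, rs.2 i k *m A = om i *: rs.1 i k + al i *: rs.2 i k + rs.2 i k.+1,
       forall i k, (n < k)%N -> rs.1 i k = 0 /\ rs.2 i k = 0 &
       delta_mx 0 c = \sum_i rs.1 i 0%N].
  by move=> c; have [r [s [h1 h2 h3 h4 _]]] := rows (delta_mx 0 c); exists (r, s).
pose r c := (rs c).1; pose s c := (rs c).2.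
pose T c i j : 'M[R]_n := (r c i j)^T *m r c i j + (s c i j)^T *m s c i j.
pose Q : 'M[R]_n := \sum_c \sum_i \sum_(j < n.+1) mu ^- (2 * j) *: T c i j.
have QE x y : dot x (Q *m y) = \sum_c \sum_i \sum_(j < n.+1) mu ^- (2 * j) *
    (ev (r c i j) x * ev (r c i j) y + ev (s c i j) x * ev (s c i j) y).
  rewrite /Q dot_summx; apply: eq_bigr => c _; rewrite dot_summx; apply: eq_bigr => i _.
  rewrite dot_summx; apply: eq_bigr => j _.
  by rewrite -scalemxAl dotZr mulmxDl dotDr !dot_rank1.
have Qs : Q^T = Q.
  rewrite /Q linear_sum; apply: eq_bigr => c _; rewrite linear_sum; apply: eq_bigr => i _.
  rewrite linear_sum; apply: eq_bigr => j _.
  by rewrite linearZ /= linearD /= !trmx_mul !trmxK.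
have wj (j : nat) : 0 < mu ^- (2 * j) by rewrite invr_gt0 exprn_gt0.
have t0 c i j x : 0 <= mu ^- (2 * j) * (ev (r c i j) x * ev (r c i j) x + ev (s c i j) x * ev (s c i j) x).
  by rewrite mulr_ge0 ?addr_ge0 -?expr2 ?sqr_ge0// ltW.
(* Heads have weight 1 and sum to the coordinate row; Cauchy-Schwarz over [L] of them gives this
   constant. *)
exists Q, L%:R; split => //.
- move=> x; rewrite QE; apply: sumr_ge0 => c _; apply: sumr_ge0 => i _.
  by apply: sumr_ge0 => j _; exact: t0.
- move=> x; rewrite QE mulr_sumr; apply: ler_sum => c _.
  have [_ _ _ cE] := rsE c.
  have -> : x c 0 = \sum_i ev (r c i 0%N) x.
    by rewrite -ev_suml -cE /ev -rowE mxE.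
  apply: le_trans (sqr_sum_le _) _; apply: ler_wpM2l => //; apply: ler_sum => i _.
  rewrite big_ord_recl /= muln0 expr0 invr1 mul1r -addrA -expr2 lerDl addr_ge0//.
    by rewrite -expr2 sqr_ge0.
  by apply: sumr_ge0 => j _; exact: t0.
- move=> x; rewrite -{1}Qs -dot_mul !QE mulr_sumr; apply: ler_sum => c _.
  rewrite mulr_sumr; apply: ler_sum => i _.
  have [rA sA rs0 _] := rsE c.
  have yn : ev (r c i n.+1) x = 0.
    by rewrite /r; have [-> _] := rs0 i n.+1 (ltnSn n); rewrite /ev mul0mx mxE.
  have zn : ev (s c i n.+1) x = 0.
    by rewrite /s; have [_ ->] := rs0 i n.+1 (ltnSn n); rewrite /ev mul0mx mxE.
  have := @jordan_weight_bound mu (al i) (om i) n (fun j => ev (r c i j) x)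
    (fun j => ev (s c i j) x) mu0 (al0 i) yn zn.
  have -> : \sum_(j < n.+1) mu ^- (2 * j) * (ev (r c i j) x ^+ 2 + ev (s c i j) x ^+ 2) =
    \sum_(j < n.+1) mu ^- (2 * j) *
      (ev (r c i j) x * ev (r c i j) x + ev (s c i j) x * ev (s c i j) x).
    by apply: eq_bigr => j _; rewrite !expr2.
  apply: le_trans; rewrite le_eqVlt; apply/orP; left; apply/eqP; apply: eq_bigr => j _.
  rewrite !ev_mul rA sA -/(r c) -/(s c) /ev !mulmxDl mulNmx -!scalemxAl.
  by congr (_ * (_ * _ + _ * _)); rewrite !mxE.
Qed.

Section PinnedConsensus.
Variables (n N : nat) (A : 'M[R]_n) (C : {set 'I_N}) (a : 'I_N -> 'I_N -> R).

(** Boundedness is recorded along with square integrability and decay, because the convergence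
    argument for the delayed loop needs a bounded forcing. *)
Lemma pinned_consensus (e : 'I_N -> R -> 'cV[R]_n) (t0 : R) :
  eig_closed_lhp A -> graph_in_GC C a -> 0 < t0 -> (forall i, vcont (e i)) ->
  (forall i (t : R), 0 < t -> vderiv t (e i)
     (A *m e i t - (\sum_j a i j *: (e i t - e j t) + pin C i *: e i t))) ->
  forall i, (exists D : R, forall T, t0 <= T ->
               prim (fun t => nsq (e i t)) T <= D /\ nsq (e i T) <= D) /\
    forall eps : R, 0 < eps -> exists T0 : R, forall T, T0 <= T -> nsq (e i T) <= eps.
Proof.
move=> lhp graph t00 ce de.
have [d d0 Ld] := superharmonic_ex graph; have [p p0 pE] := colap_ex graph.
have sp0 : 0 <= \sum_i p i by apply: sumr_ge0 => i _; exact: ltW.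
(* [kap * p i <= 1] turns the dissipation into [kap * V]; the growth [mu = kap / 4] of [Q] along [A]
   consumes half of it. *)
pose kap : R := (1 + \sum_i p i)^-1.
have kap0 : 0 < kap by rewrite invr_gt0; lra.
have kapp i : kap * p i <= 1.
  rewrite mulrC ler_pdivrMr ?mul1r; last by lra.
  by rewrite (bigD1 i)//= addrCA lerDl addr_ge0// sumr_ge0// => j _; exact: ltW.
have mu0 : 0 < kap / 4 by lra.
have [Q [k [Qs Q0 k0 Qk QA]]] := lyapunov_ex lhp mu0.
pose q i t := dot (e i t) (Q *m e i t).
have q0 i t : 0 <= q i t by exact: Q0.
have cq i : continuous (q i) by apply: cont_dot => //; exact: (vcont_mul (A := Q) (ce i)).
pose V t := \sum_i p i / d i * q i t.
have pd0 i : 0 <= p i / d i by rewrite divr_ge0 ?ltW.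
have V0 t : 0 <= V t by apply: sumr_ge0 => i _; exact: mulr_ge0.
have cV : continuous V.
  by apply: cont_sum => i; apply: contM; [exact: cont_cst | exact: cq].
pose rhs i t := A *m e i t - (\sum_j a i j *: (e i t - e j t) + pin C i *: e i t).
pose V' t := \sum_i p i / d i * (2 * dot (Q *m e i t) (rhs i t)).
have dV t : 0 < t -> has_deriv t V (V' t).
  move=> tp; apply: drv_sum => i; apply: drvZ.
  apply: drv_eq (drv_dot (de i t tp) (vderiv_mul Q (de i t tp))) _.
  by rewrite dot_mul Qs [X in _ + X]dotC -/(rhs i t); lra.
have VV t : V' t <= - (kap / 2) * V t.
  pose b i j := dot (Q *m e i t) (e j t).
  have rhsE i : 2 * dot (Q *m e i t) (rhs i t) = 2 * dot (Q *m e i t) (A *m e i t)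
      - (\sum_j a i j * (2 * q i t - 2 * b i j) + 2 * pin C i * q i t).
    have qE : q i t = dot (Q *m e i t) (e i t) by rewrite /q dotC.
    rewrite /rhs dotDr dotNr dotDr dotZr -qE.
    have -> : dot (Q *m e i t) (\sum_j a i j *: (e i t - e j t)) =
       \sum_j a i j * (q i t - b i j).
      elim/big_rec2: _ => [|j y1 y2 _ IH].
        by rewrite -[X in dot _ X](scale0r (e i t)) dotZr mul0r.
      by rewrite dotDr IH dotZr dotDr dotNr -qE.
    have -> : \sum_j a i j * (2 * q i t - 2 * b i j) = 2 * \sum_j a i j * (q i t - b i j).
      by rewrite mulr_sumr; apply: eq_bigr => j _; ring.
    by move: (\sum_j _) => S; lra.
  (* Positivity of [Q] at [e_i / d_i - e_j / d_j], multiplied by [d_i d_j]. *)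
  have bY i j : 2 * b i j <= d j / d i * q i t + d i / d j * q j t.
    have di0 := d0 i; have dj0 := d0 j.
    have := Q0 ((d i)^-1 *: e i t - (d j)^-1 *: e j t).
    rewrite mulmxDr mulmxN -!scalemxAr !dotDr !dotDl !dotNr !dotNl !dotZr !dotZl.
    have -> : dot (e i t) (Q *m e j t) = b i j by rewrite dot_mul Qs.
    have -> : dot (e j t) (Q *m e i t) = b i j by rewrite dotC.
    rewrite -/(q i t) -/(q j t) => H.
    have H2 := mulr_ge0 (ltW (mulr_gt0 di0 dj0)) H.
    have : 0 <= d j / d i * q i t + d i / d j * q j t - 2 * b i j.
      apply: le_trans H2 _; rewrite le_eqVlt; apply/orP; left; apply/eqP.
      by field; rewrite !gt_eqF.
    by lra.
  have := pinned_dissipation graph d0 (fun i => ltW (Ld i)) (fun i => ltW (p0 i)) pE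
    (fun i => q0 i t) bY.
  rewrite /V' /V; under [X in _ -> X <= _]eq_bigr do rewrite rhsE mulrBr.
  rewrite sumrB; set S2 := \sum_i p i / d i * (_ + _) => diss.
  have : \sum_i p i / d i * (2 * dot (Q *m e i t) (A *m e i t)) <=
     kap / 2 * \sum_i p i / d i * q i t.
    rewrite mulr_sumr; apply: ler_sum => i _; rewrite [leRHS]mulrCA; apply: ler_wpM2l => //.
    by have := QA (e i t); rewrite -/(q i t); lra.
  have : kap * \sum_i p i / d i * q i t <= \sum_i q i t / d i.
    rewrite mulr_sumr; apply: ler_sum => i _.
    have -> : kap * (p i / d i * q i t) = (kap * p i) * (q i t / d i) by field; rewrite gt_eqF.
    by rewrite ler_piMl// divr_ge0// ltW.
  by move: (\sum_i p i / d i * q i t) (\sum_i q i t / d i)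
    (\sum_i p i / d i * (2 * _)) S2 diss => *; lra.
have [D HD] : bdle t0 (prim V) (fun T => - (2 / kap) * V T).
  apply: (bdle_prim (F' := fun t => - (2 / kap) * V' t) t00 cV).
    by move=> t tt; apply: drvZ; apply: dV; exact: lt_le_trans tt.
  move=> t tt; have := VV t; rewrite -(ler_nM2l (_ : - (2 / kap) < 0)); last first.
    by rewrite oppr_lt0 divr_gt0.
  by have -> : - (2 / kap) * (- (kap / 2) * V t) = V t by field; rewrite gt_eqF.
have primV T : t0 <= T -> prim V T <= D.
  move=> tT; apply: le_trans (HD T tT) _; rewrite gerDr mulNr oppr_le0.
  by rewrite mulr_ge0// divr_ge0// ltW.
have Vle T : t0 <= T -> V T <= V t0.
  move=> tT; have := @le_drv R V (fun=> 0) V' (fun=> 0) t0 T tT.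
  move=> H; suff : V T - V t0 <= 0 - 0 by lra.
  apply: H => t /andP[tt _].
  - by apply: dV; exact: lt_le_trans tt.
  - exact: drv_cst.
  - apply: le_trans (VV t) _; rewrite mulNr oppr_le0 mulr_ge0//; lra.
move=> i.
pose ki := k * (d i / p i).
have ki0 : 0 <= ki by rewrite mulr_ge0// divr_ge0 ?ltW.
have ei t : nsq (e i t) <= ki * V t.
  apply: le_trans (Qk _) _; rewrite -/(q i t) /ki -mulrA; apply: ler_wpM2l => //.
  apply: (@le_trans _ _ (d i / p i * (p i / d i * q i t))).
    by rewrite le_eqVlt; apply/orP; left; apply/eqP; field; rewrite !gt_eqF.
  apply: ler_wpM2l; first by rewrite divr_ge0 ?ltW.
  by rewrite /V (bigD1 i)//= lerDl; apply: sumr_ge0 => j _; exact: mulr_ge0.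
split.
  have cn := cont_nsq (ce i).
  have [D' HD'] : bdle t0 (prim (fun t => nsq (e i t))) (fun T => ki * prim V T).
    apply: (bdle_prim (F' := fun t => ki * V t) t00 cn) => t tt; last exact: ei.
    by apply: drvZ; apply: (drv_prim cV); exact: lt_le_trans tt.
  (* [D] and [D'] have no known sign; the absolute values let one constant serve both bounds. *)
  exists (ki * D + D' + `|ki * D| + `|D'| + ki * V t0) => T tT; split.
    have := HD' T tT; have := ler_wpM2l ki0 (primV T tT); have := mulr_ge0 ki0 (V0 t0).
    have := normr_ge0 (ki * D); have := normr_ge0 D'; lra.
  have := ei T; have := ler_wpM2l ki0 (Vle T tT).
  have := lerNnormlW (lexx `|ki * D|); have := lerNnormlW (lexx `|D'|); lra.
move=> eps eps0; have e1 : 0 < eps / (ki + 1) by rewrite divr_gt0//; lra.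
have V1 t : V' t <= 1 by have := VV t; have := mulr_ge0 (ltW kap0) (V0 t); lra.
have [T0 _ HT0] := barbalat (D := 1) t00 cV V0 (fun t tt => dV t (lt_le_trans t00 tt))
  (fun t _ => V1 t) ltr01 primV e1.
exists T0 => T TT; apply: le_trans (ei T) _.
apply: le_trans (ler_wpM2l ki0 (HT0 T TT)) _.
rewrite mulrCA ler_piMr// ?ltW// ltr_pdivrMr; lra.
Qed.

End PinnedConsensus.

End Lyapunov.

(** * The network *)

Section Clamping.
Context {R : realType}.
Implicit Types (taubar t : R) (f : R -> R).

(* Time is moved past the first delay interval and frozen before it, so that all
   signals become continuous on the whole line. *)
Definition clamp taubar t : R := Num.max t (- taubar) + (taubar + 1).

Lemma clamp_gt0 taubar t : 0 < clamp taubar t.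
Proof. by rewrite /clamp; have := le_max (- taubar) t (- taubar); rewrite lexx orbT; lra. Qed.

Lemma clampE taubar t : - taubar <= t -> clamp taubar t = t + (taubar + 1).
Proof. by move=> h; rewrite /clamp max_l. Qed.

Lemma cont_clamp taubar f : (forall t, 0 < t -> {for t, continuous f}) ->
  continuous (fun t => f (clamp taubar t)).
Proof.
move=> cf t; apply: (@continuous_comp _ _ _ (clamp taubar) f); last exact/cf/clamp_gt0.
apply: cvgD; last exact: cvg_cst.
by apply: (@continuous_max _ _ id (fun=> - taubar)); [exact: cvg_id | exact: cvg_cst].
Qed.

Lemma drv_clamp taubar f t d : 0 <= taubar -> 0 < t -> has_deriv (t + (taubar + 1)) f d ->
  has_deriv t (fun s => f (clamp taubar s)) d.
Proof.
move=> tb0 t0 fd.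
have sd : has_deriv t (fun s => f (s - - (taubar + 1))) d.
  by apply: drv_shift; rewrite opprK.
apply: near_eq_is_derive sd.
near=> s; rewrite opprK clampE//.
near: s; exists t => //= s; rewrite /ball_ /= => st.
by have := ler_norm (t - s); lra.
Unshelve. all: by end_near. Qed.

End Clamping.

Section VectorDerivatives.
Context {R : realType}.

Lemma is_derive_vderiv n (z : R -> 'cV[R]_n) (t : R) D :
  is_derive t (1 : R) z D -> vderiv t z D.
Proof.
move=> [dz zD] i; have /derivable_mxP/(_ i 0) dzi := dz.
apply: DeriveDef => //; have := derive_mx dz; rewrite zD => /matrixP/(_ i 0).
by rewrite mxE => <-.
Qed.

Lemma nsq_sum_le n (N : nat) (v : 'I_N -> 'cV[R]_n) :
  nsq (\sum_j v j) <= N%:R * \sum_j nsq (v j).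
Proof.
rewrite /nsq exchange_big mulr_sumr; apply: ler_sum => i _ /=.
by rewrite summxE; exact: sqr_sum_le.
Qed.

Lemma cvg_nsq0 n (y : R -> 'cV[R]_n) :
  (forall eps : R, 0 < eps -> exists T0 : R, forall T, T0 <= T -> nsq (y T) <= eps) ->
  y @ +oo --> (0 : 'cV[R]_n).
Proof.
move=> H; apply/cvgrPdist_le => /= eps eps0.
have [T0 HT0] := H _ (exprn_gt0 2 eps0).
exists T0; split; first exact: num_real.
move=> t /ltW /HT0 yt.
rewrite /Num.Def.normr /= mx_normrE (bigmax_le _ (ltW eps0))//= => -[i j] _.
rewrite !mxE sub0r normrN (ord1 j).
suff : `|y t i 0| ^+ 2 <= eps ^+ 2 by rewrite ler_pXn2r ?nnegrE ?normr_ge0 ?(ltW eps0).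
rewrite real_normK ?num_real//; apply: le_trans yt.
rewrite /nsq (bigD1 i)//= lerDl; apply: sumr_ge0 => k _; exact: sqr_ge0.
Qed.

End VectorDerivatives.

Theorem theorem1 (R : realType) (n m : nat) (A : 'M[R]_n) (B : 'M[R]_(n, m))
  (taubar : R) :
  stabilizable A B -> eig_closed_lhp A -> 0 <= taubar ->
  taubar * omega_max A < pi / 2 ->
  exists rho eps_star : R, 1 < rho /\ 0 < eps_star /\
  forall (eps : R) (P : 'M[R]_n), 0 < eps <= eps_star ->
  posdef P ->
  A^T *m P + P *m A - P *m B *m B^T *m P + eps%:M = 0 ->
  forall (N : nat) (C : {set 'I_N}) (a : 'I_N -> 'I_N -> R)
         (tau : 'I_N -> R)
         (phi : 'I_N -> R -> 'cV[R]_n)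
         (x chi : 'I_N -> R -> 'cV[R]_n) (u : 'I_N -> R -> 'cV[R]_m)
         (xr : R -> 'cV[R]_n),
  (0 < N)%N -> (0 < #|C|)%N -> graph_in_GC C a ->
  (forall i : 'I_N, 0 <= tau i <= taubar) ->
  (* agents: continuous initial functions phi_i on [-taubar, 0] *)
  (forall i : 'I_N, {within `[- taubar, 0], continuous (phi i)}) ->
  (forall (i : 'I_N) (d : R), - taubar <= d <= 0 -> x i d = phi i d) ->
  (forall i : 'I_N, {within `[- taubar, +oo[, continuous (x i)}) ->
  (forall (i : 'I_N) (t : R), 0 < t ->
     is_derive t 1 (x i) (A *m x i t + B *m u i (t - tau i))) ->
  (* exosystem *)
  (forall t : R, 0 < t -> is_derive t 1 xr (A *m xr t)) ->
  (* protocol: arbitrary continuous initial data for chi on [-taubar, 0] *)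
  (forall i : 'I_N, {within `[- taubar, +oo[, continuous (chi i)}) ->
  (forall (i : 'I_N) (t : R), - taubar <= t -> u i t = - rho *: (B^T *m P *m chi i t)) ->
  (forall (i : 'I_N) (t : R), 0 < t ->
     let iota := if i \in C then 1 else 0 in
     let zbar := \sum_j a i j *: (x i t - x j t) + iota *: (x i t - xr t) in
     let zhat := \sum_j a i j *: (chi i t - chi j t) in
     is_derive t 1 (chi i)
       (A *m chi i t + B *m u i (t - tau i) + zbar - zhat - iota *: chi i t)) ->
  forall i, (fun t => x i t - xr t) @ +oo --> (0 : 'cV[R]_n).
Proof.
move=> stab lhp tb0 small.
have [rho [eps_star [rho1 [es0 stable]]]] := low_gain_delay_stable stab lhp tb0 small.
exists rho, eps_star; split=> //; split=> //.
move=> eps P epsE pP ric N C a tau phi x chi u xr _ _ graph tauE _ _ _ dx dxr _ uE dchi.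
pose e i t := x i t - xr t - chi i t.
pose g i t := \sum_j a i j *: (e i t - e j t) + pin C i *: e i t.
(* The whole coupling depends on [e] alone, so the error dynamics closes without the delayed input,
   which cancels between [x i] and [chi i]. *)
have couple i t : \sum_j a i j *: (x i t - x j t) + pin C i *: (x i t - xr t)
    - \sum_j a i j *: (chi i t - chi j t) - pin C i *: chi i t = g i t.
  have -> : \sum_j a i j *: (x i t - x j t) =
      \sum_j a i j *: (e i t - e j t) + \sum_j a i j *: (chi i t - chi j t).
    rewrite -big_split; apply: eq_bigr => j _; rewrite /= -scalerDr; congr (_ *: _).
    by apply/colP => k; rewrite /e !mxE; lra.
  rewrite /g /e; move: (\sum_j _) (\sum_j _) => S1 S2.
  by apply/colP => k; rewrite !mxE; lra.
have dchi' i (t : R) : 0 < t -> vderiv t (chi i)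
    (A *m chi i t - rho *: (B *m (B^T *m (P *m chi i (t - tau i)))) + g i t).
  move=> t0; have := is_derive_vderiv (dchi i t t0); congr vderiv.
  have /andP[_ ti] := tauE i.
  rewrite uE; last by lra.
  rewrite -couple -/(pin C i) scaleNr mulmxN -scalemxAr -!mulmxA.
  move: (A *m chi i t) (rho *: (B *m (B^T *m (P *m chi i (t - tau i)))))
    (\sum_j a i j *: (x i t - x j t)) (\sum_j a i j *: (chi i t - chi j t))
    (pin C i *: (x i t - xr t)) (pin C i *: chi i t) => *.
  by apply/colP => k; rewrite !mxE; lra.
have de i (t : R) : 0 < t -> vderiv t (e i) (A *m e i t - g i t).
  move=> t0 k.
  have d1 := is_derive_vderiv (dx i t t0) k; have d2 := is_derive_vderiv (dxr t t0) k.
  have d3 := is_derive_vderiv (dchi i t t0) k.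
  have -> : (fun s => e i s k 0) = (fun s => x i s k 0 - xr s k 0 - chi i s k 0).
    by apply/funext => s; rewrite /e !mxE.
  apply: drv_eq; first by apply: drvD; [apply: drvD; [exact: d1 | apply: drvN; exact: d2]
    | apply: drvN; exact: d3].
  rewrite -(couple i t) -/(pin C i) /e !mulmxBr.
  move: (A *m x i t) (A *m xr t) (A *m chi i t) (B *m u i (t - tau i))
    (\sum_j a i j *: (x i t - x j t)) (\sum_j a i j *: (chi i t - chi j t))
    (pin C i *: (x i t - xr t)) (pin C i *: chi i t) => *.
  by rewrite !mxE; lra.
have cl n' (z : R -> 'cV[R]_n') (D : R -> 'cV[R]_n') :
    (forall t : R, 0 < t -> vderiv t z (D t)) -> vcont (fun t => z (clamp taubar t)).
  move=> dz i; apply: (@cont_clamp _ taubar (fun t => z t i 0)) => t t0.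
  exact: drv_continuous (dz t t0 i).
have dl n' (z : R -> 'cV[R]_n') (t : R) D : 0 < t -> vderiv (t + (taubar + 1)) z D ->
    vderiv t (fun t => z (clamp taubar t)) D.
  by move=> t0 dz i; apply: (drv_clamp (f := fun t => z t i 0)) => //; exact: dz.
pose e' i t := e i (clamp taubar t).
have ce i : vcont (e' i) by exact: cl (de i).
have shift_gt0 (t : R) : 0 < t -> 0 < t + (taubar + 1) by lra.
have de' i (t : R) : 0 < t -> vderiv t (e' i)
    (A *m e' i t - (\sum_j a i j *: (e' i t - e' j t) + pin C i *: e' i t)).
  move=> t0; have := dl _ _ _ _ t0 (de i _ (shift_gt0 t t0)).
  by rewrite /e' clampE//; lra.
have tb1 : 0 < taubar + 1 by lra.
have cons := pinned_consensus lhp graph tb1 ce de'.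
have /choice[D HD] : forall i, exists D : R, forall T, taubar + 1 <= T ->
    prim (fun t => nsq (e' i t)) T <= D /\ nsq (e' i T) <= D.
  by move=> i; have [] := cons i.
move=> i.
pose g' t := g i (clamp taubar t).
pose c' t := chi i (clamp taubar t).
have cc : vcont c' by exact: cl (dchi' i).
pose S4 : R := \sum_j (a i j ^+ 2 * 4).
have S40 : 0 <= S4 by apply: sumr_ge0 => j _; rewrite mulr_ge0 ?sqr_ge0.
pose K : R := 2 * (N%:R * S4) + 2.
have K0 : 0 <= K by rewrite /K; nng.
have gK t : nsq (g' t) <= K * \sum_j nsq (e' j t).
  set S := \sum_j nsq (e' j t).
  have eS j : nsq (e' j t) <= S.
    rewrite /S (bigD1 j)//= lerDl; apply: sumr_ge0 => k _; exact: nsq_ge0.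
  have S0 : 0 <= S := le_trans (nsq_ge0 _) (eS i).
  rewrite /g' /g; apply: le_trans (nsqD_le _ _) _.
  have h1 : nsq (\sum_j a i j *: (e' i t - e' j t)) <= N%:R * (S4 * S).
    apply: le_trans (nsq_sum_le _) _; apply: ler_wpM2l => //.
    rewrite /S4 mulr_suml; apply: ler_sum => j _; rewrite nsqZ -mulrA.
    apply: ler_wpM2l; first exact: sqr_ge0.
    have := nsqD_le (e' i t) (- e' j t); rewrite nsqN.
    by have := eS i; have := eS j; lra.
  have h2 : nsq (pin C i *: e' i t) <= S.
    rewrite nsqZ /pin; case: ifP => _; rewrite ?expr1n ?mul1r// expr0n mul0r//.
  by rewrite /K; move: h1 h2; rewrite /e'; lra.
have cg : vcont g'.
  have E : g' = (fun t => \sum_j a i j *: (e' i t - e' j t) + pin C i *: e' i t) by [].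
  move=> k; rewrite E.
  have -> : (fun s => (\sum_j a i j *: (e' i s - e' j s) + pin C i *: e' i s) k 0) =
     (fun s => \sum_j a i j * (e' i s k 0 - e' j s k 0) + pin C i * e' i s k 0).
    apply/funext => s; rewrite cVD cVZ summxE; congr (_ + _).
    by apply: eq_bigr => j _; rewrite cVZ cVD cVN.
  apply: contD; last by apply: contM; [exact: cont_cst | exact: ce].
  apply: cont_sum => j; apply: contM; first exact: cont_cst.
  by apply: contD; [exact: (ce i) | apply: contN; exact: (ce j)].
have [Cg HCg] : exists Cg : R, forall T, taubar + 1 <= T ->
    prim (fun t => nsq (g' t)) T <= Cg.
  have gK' t : nsq (g' t) <= \sum_j K * nsq (e' j t) by rewrite -mulr_sumr.
  have [C1 H1] := @bdle_prim_sum R (taubar + 1) (fun t => nsq (g' t)) _ (index_enum 'I_N)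
    (fun=> K) (fun j t => nsq (e' j t)) tb1 (cont_nsq cg) (fun j => cont_nsq (ce j))
    (fun t _ => gK' t).
  exists (\sum_j K * D j + C1) => T TT; apply: le_trans (H1 T TT) _.
  by rewrite lerD2r; apply: ler_sum => j _; apply: ler_wpM2l => //; have [] := HD j T TT.
have HG t : taubar + 1 <= t -> nsq (g' t) <= K * \sum_j D j.
  move=> tt; apply: le_trans (gK t) _; apply: ler_wpM2l => //.
  by apply: ler_sum => j _; have [] := HD j t tt.
have loop : closed_loop A B rho (tau i) P c' g'.
  (* For [t > 0] both [t] and [t - tau i] are at least [- taubar], where [clamp] is a translation,
     so the delayed equation survives. *)
  move=> t t0; have := dl _ _ _ _ t0 (dchi' i _ (shift_gt0 t t0)).
  have /andP[ti0 ti] := tauE i.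
  rewrite /c' /g' !clampE; [|lra|lra].
  by rewrite (_ : t + (taubar + 1) - tau i = t - tau i + (taubar + 1))//; lra.
have chi0 := stable eps P epsE pP ric c' g' (tau i) Cg (K * \sum_j D j) cc cg loop (tauE i) HCg HG.
apply: cvg_nsq0 => eta eta0.
have eta4 : 0 < eta / 4 by lra.
have [T1 HT1] := chi0 _ eta4; have [T2 HT2] := (cons i).2 _ eta4.
exists (Num.max (Num.max T1 T2) 0 + (taubar + 1)) => T.
rewrite -lerBrDr !ge_max => /andP[/andP[TT1 TT2] T0].
have TE : clamp taubar (T - (taubar + 1)) = T by rewrite clampE; lra.
have := HT1 _ TT1; have := HT2 _ TT2; rewrite /c' /e' TE => n1 n2.
have -> : x i T - xr T = e i T + chi i T by rewrite /e subrK.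
by apply: le_trans (nsqD_le _ _) _; lra.
Qed.
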